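(* 1. Every algebraic expansion of $L_\mathcal{P}$ is $\tau_\mathcal{MV}$-equipollent to exactly one of the following: the inconsistent logic; classical propositional logic; $L_\mathcal{P}^S$ for some set $S$ of prime numbers. 2. The algebraic expansions of $L_\mathcal{P}$, modulo $\tau_\mathcal{MV}$-equipollence and ordered by existence of $\tau_\mathcal{MV}$-morphisms, form a lattice isomorphic with $\mathbf{2}^\omega\oplus\mathbf{2}$. 3. Given sets $S\subseteq S'$ of prime numbers, the expansion $L_\mathcal{P}^{S'}$ is conservative over $L_\mathcal{P}^S$.
   Context: $\tau_\mathcal{MV}:=\{+,\neg,0\}$. In this language write $1:=\neg 0$, $x\vee y:=\neg(\neg x+y)+y$, $x\wedge y:=\neg(\neg x\vee\neg y)$, $x*y:=\neg(\neg x+\neg y)$, $x\leftrightarrow y:=(\neg x+y)\wedge(\neg y+x)$, $kx:=x+\dots+x$, $x^k:=x*\dots*x$ ($k$ times). $L_\mathcal{P}$ (the logic of perfect MV-algebras) is the extension of Łukasiewicz infinite-valued logic by the axiom $2x^2\leftrightarrow(2x)^2$; it is algebraizable (with the algebraizing data of Łukasiewicz logic, e.g. equivalence formula $x\leftrightarrow y$ and defining equation $x=1$) with equivalent algebraic semantics the variety generated by perfect MV-algebras. For a prime $p$ and a new unary connective $\mathsf d_p$, $D_p$ is the axiom $((p\,\mathsf d_p(x)\wedge\neg 2\,\mathsf d_p(x)^2)\vee\mathsf d_p(x)^p)\leftrightarrow x$; $L_\mathcal P^S$ is the expansion of $L_\mathcal P$ by the axioms $\{D_p:p\in S\}$. Algebraic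 expansions of an algebraizable logic $L$ with equivalence formulas $\Delta(x,y)$: for a finite set $\Phi(\bar x,\bar z)$ of formulas ($\bar x=x_1..x_n$, $\bar z=z_1..z_m$), $L^\Phi$ is the least logic containing $L$ with new $n$-ary connectives $f_1,\dots,f_m$ such that $\vdash\Phi(\bar x,f_1(\bar x),\dots,f_m(\bar x))$ and $\Phi(\bar x,\bar y),\Phi(\bar x,\bar z)\vdash\bigcup_j\Delta(y_j,z_j)$; for a set $\Sigma$ of such $\Phi$, $L^\Sigma$ is the least logic containing all $L^\Phi$ (distinct new connectives). A $\tau$-translation from an expansion $\tau_1$ of $\tau$ into an expansion $\tau_2$ maps each $n$-ary symbol of $\tau_1$ to a $\tau_2$-term in $x_1,\dots,x_n$, fixing the symbols of $\tau$, extended homomorphically; it is a $\tau$-morphism from $L_1$ to $L_2$ if $\Gamma\vdash_{L_1}\varphi$ implies $T(\Gamma)\vdash_{L_2}T(\varphi)$; $L_1,L_2$ are $\tau$-equipollent if there are $\tau$-morphisms $T:L_1\to L_2$, $S:L_2\to L_1$ with $\varphi\dashv\vdash_{L_1}S(T(\varphi))$ and $\psi\dashv\vdash_{L_2}T(S(\psi))$ for all formulas. An expansion $L'$ of $L$ is conservative if $\Gamma\vdash_{L'}\varphi$ implies $\Gamma\vdash_L\varphi$ for all $L$-formulas. $\mathbf 2^\omega$ is the lattice of subsets of a countably infinite set, $\mathbf 2$ the two-element lattice, $\oplus$ ordinal sum. *)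

(* Defs.v *)
From HB Require Import structures.
From mathcomp Require Import all_boot all_order.
From mathcomp Require Import boolp classical_sets functions cardinality.

Set Implicit Arguments.
Unset Strict Implicit.
Unset Printing Implicit Defensive.

Import Order.TTheory.
Local Open Scope classical_set_scope.

(* A signature lists the symbols that are added to {+, neg, 0}: it stands for
   the expansion of tau_MV by these symbols. *)
Record signature := Signature { symb : Type; arity : symb -> nat }.

Definition mv : signature := @Signature void (fun _ => 0%N).

(* Terms with variables in V; the formulas of a logic are the terms with
   variables in nat, and a term in x_1, ..., x_n has variables in 'I_n. *)
Inductive term (E : signature) (V : Type) : Type :=
| Var of V
| Zero
| Neg of term E V
| Plus of term E V & term E V
| App (f : symb E) of ('I_(arity f) -> term E V).

Arguments Var {E V} _.
Arguments Zero {E V}.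
Arguments App {E V} f _.

Notation formula E := (term E nat).

Declare Scope mv_scope.
Delimit Scope mv_scope with MV.
Bind Scope mv_scope with term.

Notation "x + y" := (Plus x y) : mv_scope.
Notation "~~ x" := (Neg x) : mv_scope.

Section Connectives.
Variables (E : signature) (V : Type).
Implicit Types x y : term E V.
Local Open Scope mv_scope.

Definition One : term E V := ~~ Zero.
Definition Imp x y := ~~ x + y.
Definition Or x y := ~~ (~~ x + y) + y.
Definition And x y := ~~ Or (~~ x) (~~ y).
Definition Star x y := ~~ (~~ x + ~~ y).
Definition Iff x y := And (~~ x + y) (~~ y + x).
Definition nmul (k : nat) x := iterop k (@Plus E V) x Zero.
Definition power x (k : nat) := iterop k Star x One.
End Connectives.

Arguments One {E V}.

Notation "x ==> y" := (Imp x y) : mv_scope.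
Notation "x || y" := (Or x y) : mv_scope.
Notation "x && y" := (And x y) : mv_scope.
Notation "x * y" := (Star x y) : mv_scope.
Notation "x <==> y" := (Iff x y) (at level 70, no associativity) : mv_scope.
Notation "x ^ k" := (power x k) : mv_scope.

Fixpoint subst E V W (s : V -> term E W) (t : term E V) : term E W :=
  match t with
  | Var v => s v
  | Zero => Zero
  | Neg t1 => Neg (subst s t1)
  | Plus t1 t2 => Plus (subst s t1) (subst s t2)
  | App f a => App f (fun i => subst s (a i))
  end.

(* A tau_MV-translation; the symbols of tau_MV are fixed by [translate]. *)
Definition translation (E1 E2 : signature) : Type :=
  forall f : symb E1, term E2 'I_(arity f).

Fixpoint translate E1 E2 (T : translation E1 E2) V (t : term E1 V) :
    term E2 V :=
  match t with
  | Var v => Var v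
  | Zero => Zero
  | Neg t1 => Neg (translate T t1)
  | Plus t1 t2 => Plus (translate T t1) (translate T t2)
  | App f a => subst (fun i => translate T (a i)) (T f)
  end.

Arguments translate {E1 E2} T {V} t.

Definition mv_incl (E : signature) : translation mv E :=
  fun f => match f with end.

Arguments mv_incl E f : clear implicits.

Definition conseq (E : signature) : Type :=
  set (formula E) -> formula E -> Prop.

Record is_logic E (L : conseq E) : Prop := IsLogic {
  logic_refl : forall G phi, G phi -> L G phi;
  logic_cut : forall G D phi,
    L G phi -> (forall psi, G psi -> L D psi) -> L D phi;
  logic_struct : forall (s : nat -> formula E) G phi,
    L G phi -> L (subst s @` G) (subst s phi);
  logic_fin : forall G phi,
    L G phi -> exists F, [/\ finite_set F, F `<=` G & L F phi] }.

Definition least_logic E (P : conseq E -> Prop) : conseq E :=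
  fun G phi => forall L, is_logic L -> P L -> L G phi.

Definition morphism E1 E2 (T : translation E1 E2)
    (L1 : conseq E1) (L2 : conseq E2) : Prop :=
  forall G phi, L1 G phi -> L2 (translate T @` G) (translate T phi).

Definition morphic E1 E2 (L1 : conseq E1) (L2 : conseq E2) : Prop :=
  exists T : translation E1 E2, morphism T L1 L2.

Definition interderivable E (L : conseq E) (phi psi : formula E) : Prop :=
  L [set phi] psi /\ L [set psi] phi.

Definition equipollent E1 E2 (L1 : conseq E1) (L2 : conseq E2) : Prop :=
  exists (T : translation E1 E2) (S : translation E2 E1),
    [/\ morphism T L1 L2, morphism S L2 L1,
        forall phi, interderivable L1 phi (translate S (translate T phi)) &
        forall psi, interderivable L2 psi (translate T (translate S psi))].

(* [I] is the inclusion of the language of L into that of L'. *)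
Definition conservative E E' (I : translation E E')
    (L : conseq E) (L' : conseq E') : Prop :=
  morphism I L L' /\
  forall G phi, L' (translate I @` G) (translate I phi) -> L G phi.

Section Lukasiewicz.
Local Open Scope mv_scope.
Let x : formula mv := Var 0%N.
Let y : formula mv := Var 1%N.
Let z : formula mv := Var 2%N.

(* Lukasiewicz's axioms and modus ponens are stated for -> and neg, where
   x -> y is ~x + y; [luk_plus1], [luk_plus2] and [luk_one] say that + and 0
   are the connectives (~x -> y) and ~(x -> x). *)
Record luk_rules (L : conseq mv) : Prop := LukRules {
  luk_K : L set0 (x ==> (y ==> x));
  luk_trans : L set0 ((x ==> y) ==> ((y ==> z) ==> (x ==> z)));
  luk_or : L set0 (((x ==> y) ==> y) ==> ((y ==> x) ==> x));
  luk_contra : L set0 ((~~ x ==> ~~ y) ==> (y ==> x));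
  luk_plus1 : L set0 ((x + y) ==> (~~ x ==> y));
  luk_plus2 : L set0 ((~~ x ==> y) ==> (x + y));
  luk_one : L set0 One;
  luk_mp : L [set x; x ==> y] y }.

Definition lukasiewicz : conseq mv := least_logic luk_rules.

Definition LP : conseq mv := least_logic (fun L =>
  (forall G phi, lukasiewicz G phi -> L G phi) /\
  L set0 (nmul 2 (x ^ 2) <==> (nmul 2 x) ^ 2)).
End Lukasiewicz.

(* A finite set Phi(x_1..x_n, z_1..z_m) of formulas: inl i is x_i, and inr j
   is z_j. *)
Record fset_formulas := FsetFormulas {
  nx : nat;
  nz : nat;
  formulas : set (term mv ('I_nx + 'I_nz));
  formulas_finite : finite_set formulas }.

Arguments formulas : clear implicits.

Section AlgebraicExpansion.
Variable L : conseq mv.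

Definition sig1 (Phi : fset_formulas) : signature :=
  @Signature 'I_(nz Phi) (fun _ => nx Phi).

(* Phi(x, w), where x_i is the variable of index i. *)
Definition instance (Phi : fset_formulas) E (w : 'I_(nz Phi) -> formula E) :
    set (formula E) :=
  let s (v : 'I_(nx Phi) + 'I_(nz Phi)) : formula E :=
    match v with inl i => Var (nat_of_ord i) | inr j => w j end in
  (fun phi => subst s (translate (mv_incl E) phi)) @` formulas Phi.

(* y_j and z_j are the variables of indices n + j and n + m + j. *)
Definition expansion1 (Phi : fset_formulas) : conseq (sig1 Phi) :=
  let n := nx Phi in
  let m := nz Phi in
  let f (j : 'I_m) : formula (sig1 Phi) :=
    @App (sig1 Phi) nat j (fun i => Var (nat_of_ord i)) in
  let y (j : 'I_m) : formula (sig1 Phi) := Var (n + j)%N in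
  let z (j : 'I_m) : formula (sig1 Phi) := Var (n + m + j)%N in
  least_logic (fun L' =>
    [/\ morphism (mv_incl (sig1 Phi)) L L',
        forall phi, instance f phi -> L' set0 phi &
        forall j, L' (instance y `|` instance z) (y j <==> z j)%MV]).

Variable Sigma : set fset_formulas.

Definition sig_of : signature :=
  @Signature {Phi : {Phi | Sigma Phi} & 'I_(nz (sval Phi))}
             (fun f => nx (sval (projT1 f))).

Definition sig1_incl (Phi : {Phi | Sigma Phi}) :
    translation (sig1 (sval Phi)) sig_of :=
  fun j => @App sig_of _ (existT _ Phi j) Var.

(* The first clause only matters when Sigma is empty. *)
Definition expansion : conseq sig_of := least_logic (fun L' =>
  morphism (mv_incl sig_of) L L' /\
  forall Phi : {Phi | Sigma Phi},
    morphism (sig1_incl (Phi := Phi)) (expansion1 (Phi := sval Phi)) L').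

End AlgebraicExpansion.

Arguments expansion L Sigma : clear implicits.

Definition prime_number : Type := {p : nat | prime p}.

Section DivisionOperators.
Variable S : set prime_number.

Definition sigS : signature := @Signature {p | S p} (fun _ => 1%N).

Definition div_op (p : {p | S p}) (t : formula sigS) : formula sigS :=
  @App sigS nat p (fun _ => t).

Definition axD (p : {p | S p}) : formula sigS :=
  let x := Var 0%N in
  let d := div_op p x in
  let k := sval (sval p) in
  (((nmul k d && ~~ nmul 2 (d ^ 2)) || d ^ k) <==> x)%MV.

Definition LPS : conseq sigS := least_logic (fun L =>
  morphism (mv_incl sigS) LP L /\ forall p, L set0 (axD p)).
End DivisionOperators.

Definition sigS_incl (S S' : set prime_number) (SS' : S `<=` S') :
    translation (sigS S) (sigS S') :=
  fun p => @App (sigS S') _ (exist _ (sval p) (SS' _ (svalP p))) Var.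

Definition inconsistent : conseq mv := fun _ _ => True.

Fixpoint beval (v : nat -> bool) (t : formula mv) : bool :=
  match t with
  | Var n => v n
  | Zero => false
  | Neg t1 => ~~ beval v t1
  | Plus t1 t2 => beval v t1 || beval v t2
  | App f _ => match f with end
  end.

Definition classical : conseq mv := fun G phi =>
  forall v, (forall psi, G psi -> beval v psi) -> beval v phi.

Inductive listed : Type :=
| Inconsistent
| Classical
| Perfect (P : set prime_number).

Definition listed_sig (k : listed) : signature :=
  match k with Perfect P => sigS P | _ => mv end.

Arguments LPS S : clear implicits.

Definition listed_logic (k : listed) : conseq (listed_sig k) :=
  match k with
  | Inconsistent => inconsistent
  | Classical => classical
  | Perfect P => LPS P
  end.

Arguments listed_logic k : clear implicits.

Fact ordsum_display : Order.disp_t. Proof. exact: Order.Disp tt tt. Qed.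

(* Ordinal sum: every element of A is below every element of B. *)
Definition ordsum (A B : Type) : Type := (A + B)%type.

Section OrdinalSum.
Context {d d' : Order.disp_t} (A : latticeType d) (B : latticeType d').

HB.instance Definition _ := Choice.copy (ordsum A B) (A + B)%type.

Definition ordsum_le (u v : ordsum A B) : bool :=
  match u, v with
  | inl a, inl a' => (a <= a')%O
  | inl _, inr _ => true
  | inr _, inl _ => false
  | inr b, inr b' => (b <= b')%O
  end.

Definition ordsum_meet (u v : ordsum A B) : ordsum A B :=
  match u, v with
  | inl a, inl a' => inl (Order.meet a a')
  | inl a, inr _ => inl a
  | inr _, inl a => inl a
  | inr b, inr b' => inr (Order.meet b b')
  end.

Definition ordsum_join (u v : ordsum A B) : ordsum A B :=
  match u, v with
  | inl a, inl a' => inl (Order.join a a')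
  | inl _, inr b => inr b
  | inr b, inl _ => inr b
  | inr b, inr b' => inr (Order.join b b')
  end.

Fact ordsum_le_refl : reflexive ordsum_le.
Proof. by case=> a /=. Qed.

Fact ordsum_le_anti : antisymmetric ordsum_le.
Proof. by case=> [a|b] [a'|b'] //= /le_anti ->. Qed.

Fact ordsum_le_trans : transitive ordsum_le.
Proof. by case=> [a|b] [a'|b'] [a''|b''] //=; exact: le_trans. Qed.

HB.instance Definition _ := Order.Le_isPOrder.Build ordsum_display (ordsum A B)
  ordsum_le_refl ordsum_le_anti ordsum_le_trans.

Fact ordsum_lexI (u v w : ordsum A B) :
  (u <= ordsum_meet v w)%O = (u <= v)%O && (u <= w)%O.
Proof.
by case: u v w => [a|b] [a'|b'] [a''|b'']; rewrite /Order.le /= ?lexI ?andbT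
  ?andbF.
Qed.

Fact ordsum_leUx (u v w : ordsum A B) :
  (ordsum_join u v <= w)%O = (u <= w)%O && (v <= w)%O.
Proof.
by case: u v w => [a|b] [a'|b'] [a''|b'']; rewrite /Order.le /= ?leUx ?andbT
  ?andbF.
Qed.

HB.instance Definition _ := Order.POrder_isMeetSemilattice.Build ordsum_display
  (ordsum A B) ordsum_lexI.
HB.instance Definition _ := Order.POrder_isJoinSemilattice.Build ordsum_display
  (ordsum A B) ordsum_leUx.

End OrdinalSum.

(* Main.v *)
(* LP is complete for one algebra, the Chang algebra of Q: a subdirectly
   irreducible model is a chain Gamma(Z x_lex G, (1, 0)), and a finite rule that
   fails in it fails over Q, by Fourier-Motzkin elimination on the linear
   inequalities that describe the failure.  On this algebra D_p says that d_p
   divides the infinitesimal part by p, so LPS S is complete for the same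
   algebra with these divisions, which every LPS S shares; conservativity
   follows.

   If an expansion does not prove excluded middle, every finite rule of it in the
   language of LP holds in the Chang algebra: otherwise the rule fails on
   multiples of an infinitesimal, and the expansion would prove that there are
   none.  So each Phi has exactly one solution there.  The solution is piecewise linear
   with rational coefficients, hence a sup of infs of linear functions; the
   values of two such linear functions at multiples of an infinitesimal x are
   definable, and Bezout's identity turns their denominators into terms that
   divide x.  So the new connectives are interdefinable with the divisions d_p
   for the primes p whose division is definable.  If excluded middle is provable,
   every connective is a Boolean term, or the expansion is inconsistent.

   LPS S is not interpretable in LPS S' unless S is a subset of S', because the
   denominators of values of terms of LPS S' have their prime factors in S'. *)

Require Import Defs.
From HB Require Import structures.
From mathcomp Require Import all_boot all_order ssralg ssrnum ssrint rat.
From mathcomp Require Import boolp classical_sets functions cardinality.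
From mathcomp Require Import ring lra zify.
From Stdlib Require List.

Set Implicit Arguments.
Unset Strict Implicit.
Unset Printing Implicit Defensive.

Import Order.TTheory GRing.Theory Num.Theory.
Local Open Scope classical_set_scope.

(** * Logics and translations *)

(** For rational c >= 0, multiplying all infinitesimal parts by c is an endomorphism of the Chang
    algebra of Q. By uniqueness the solution functions commute with it: they are positively
    homogeneous, and c = 0 shows that the Boolean parts of a solution depend only on the Boolean
    parts of the arguments. This leaves one linear problem over Q for each Boolean pattern. The
    obstacle is that an expansion names values of a solution only at integral arguments, as
    multiples of one infinitesimal. The slopes of a linear piece must therefore be differences of
    values at integral points of that piece. This requires pieces of full dimension, and a proof
    that these alone still cover all arguments. The translations obtained in this way are mutually
    inverse up to interderivability because the connectives are uniquely determined: an endomorphism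
    of an expansion fixes every formula up to equivalence, and an endomorphism of [LPS S] fixes all
    values in the Chang algebra. The order is then computed on the list, where morphisms in both
    directions already force equality. *)

Lemma image_lift_finite T U (f : T -> U) (A : set T) (F : set U) :
  finite_set F -> F `<=` f @` A ->
  exists B, [/\ finite_set B, B `<=` A & f @` B = F].
Proof.
move=> finF FA.
pose g u := if pselect (exists2 x, A x & f x = u) is left h
            then Some (s2val (cid2 h)) else None.
have gP u : F u -> exists x, [/\ g u = Some x, A x & f x = u].
  move=> /FA [x Ax xu]; rewrite /g; case: pselect => [h|nh]; last first.
    by case: nh; exists x.
  by exists (s2val (cid2 h)); split=> //; case: (cid2 h).
have [->|/set0P[u0 Fu0]] := eqVneq F set0.
  by exists set0; split=> //; rewrite image_set0.
have [x0 _] := gP _ Fu0.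
pose h u := odflt x0 (g u).
have hP u : F u -> A (h u) /\ f (h u) = u.
  by move=> /gP [x [gu Ax xu]]; rewrite /h gu.
exists (h @` F); split; first exact: finite_image.
  by move=> _ [u /hP[Ah _] <-].
apply/seteqP; split=> [_ [_ [u Fu <-] <-]|u Fu].
  by have [_ ->] := hP _ Fu.
by exists (h u); [exists u|exact: (hP _ Fu).2].
Qed.

Section Substitution.
Variable E : signature.

Lemma eq_subst V W (s1 s2 : V -> term E W) t :
  s1 =1 s2 -> subst s1 t = subst s2 t.
Proof. by move=> /funext ->. Qed.

Lemma subst_subst U V W (s : U -> term E V) (r : V -> term E W) t :
  subst r (subst s t) = subst (fun x => subst r (s x)) t.
Proof.
elim: t => //= [t -> //|t1 -> t2 -> //|f a IH].
by congr App; apply/funext => i; exact: IH.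
Qed.

Lemma subst_Var V (t : term E V) : subst Var t = t.
Proof.
elim: t => //= [t -> //|t1 -> t2 -> //|f a IH].
by congr App; apply/funext => i; exact: IH.
Qed.

End Substitution.

Section Translation.
Variables (E1 E2 : signature) (T : translation E1 E2).

Lemma translate_subst V W (s : V -> term E1 W) t :
  translate T (subst s t) = subst (fun x => translate T (s x)) (translate T t).
Proof.
elim: t => //= [t -> //|t1 -> t2 -> //|f a IH].
by rewrite subst_subst; apply: eq_subst => i; exact: IH.
Qed.

End Translation.

Section Translation.
Variables (E1 E2 : signature) (T : translation E1 E2).

Definition translation_comp E3 (U : translation E2 E3) : translation E1 E3 :=
  fun f => translate U (T f).

Lemma translate_comp E3 (U : translation E2 E3) V (t : term E1 V) :
  translate U (translate T t) = translate (translation_comp U) t.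
Proof.
elim: t => //= [t -> //|t1 -> t2 -> //|f a IH].
by rewrite translate_subst; apply: eq_subst => i; exact: IH.
Qed.

Lemma translate_mv_incl V (t : term mv V) :
  translate T (translate (mv_incl E1) t) = translate (mv_incl E2) t.
Proof. by elim: t => //= [t -> //|t1 -> t2 -> //]. Qed.

End Translation.

Lemma translate_mv_id V (T : translation mv mv) (t : term mv V) :
  translate T t = t.
Proof. by elim: t => //= [t -> //|t1 -> t2 -> //]. Qed.

Lemma translate_id E V (t : term E V) :
  translate (fun f => App f Var) t = t.
Proof.
elim: t => //= [t -> //|t1 -> t2 -> //|f a IH].
by congr App; apply/funext => i /=; exact: IH.
Qed.

Section Logic.
Variables (E : signature) (L : conseq E).
Hypothesis logicL : is_logic L.

Lemma logic_weaken G D phi : G `<=` D -> L G phi -> L D phi.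
Proof.
move=> GD Gphi; apply: (logic_cut logicL Gphi) => psi /GD.
exact: (logic_refl logicL).
Qed.

Lemma logic_thm G phi : L set0 phi -> L G phi.
Proof. exact: logic_weaken. Qed.

Lemma logic_struct0 (s : nat -> formula E) phi :
  L set0 phi -> L set0 (subst s phi).
Proof. by move=> /(logic_struct logicL s); rewrite image_set0. Qed.

Lemma logic_cut_set1 G phi psi : L [set phi] psi -> L G phi -> L G psi.
Proof. by move=> h Gphi; apply: (logic_cut logicL h) => _ ->. Qed.

End Logic.

Section LeastLogic.
Variables (E : signature) (P : conseq E -> Prop).

(* Rules with finitely many premises survive the passage to the finitary part
   of a logic; this makes least_logic a logic. *)
Definition finitary_rules (Q : conseq E -> Prop) : Prop :=
  exists R : set (formula E) -> formula E -> Prop,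
    (forall G phi, R G phi -> finite_set G) /\
    (forall L, is_logic L -> Q L <-> forall G phi, R G phi -> L G phi).

Hypothesis finP : finitary_rules P.

(** An intersection of finitary logics need not be finitary, since the finite set of premises may
    depend on the logic. The finitary part is a logic by construction, and it contains the least one
    as soon as it satisfies P. *)
Let finite_part G phi :=
  exists F, [/\ finite_set F, F `<=` G & least_logic P F phi].

Let finite_part_logic : is_logic finite_part.
Proof.
split.
- move=> G phi Gphi; exists [set phi]; split=> [|_ -> //|L hL _].
    exact: finite_set1.
  exact: (logic_refl hL).
- move=> G D phi [F [finF FG Fphi]] GD.
  pose f psi := if pselect (G psi) is left h then sval (cid (GD _ h)) else set0.
  have fP psi : F psi -> [/\ finite_set (f psi), f psi `<=` D
                           & least_logic P (f psi) psi].
    move=> /FG Gpsi; rewrite /f; case: pselect => // h.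
    exact: (svalP (cid (GD _ h))).
  exists (\bigcup_(psi in F) f psi); split.
  + by apply: bigcup_finite => // psi /fP[].
  + by move=> psi [chi /fP[_ + _]]; apply.
  move=> L hL PL; apply: (logic_cut hL (Fphi _ hL PL)) => psi Fpsi.
  have [_ _ /(_ _ hL PL)] := fP _ Fpsi.
  by apply: logic_weaken => // chi fchi; exists psi.
- move=> s G phi [F [finF FG Fphi]]; exists (subst s @` F).
  split; [exact: finite_image|exact: image_subset|].
  by move=> L hL PL; apply: (logic_struct hL); exact: Fphi.
- move=> G phi [F [finF FG Fphi]]; exists F; split=> //.
  by exists F; split.
Qed.

Lemma least_logicP : is_logic (least_logic P) /\ P (least_logic P).
Proof.
have [R [finR PR]] := finP.
have Pfin : P finite_part.
  apply/(PR _ finite_part_logic) => G phi RG; exists G; split=> //.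
    exact: finR RG.
  by move=> L hL /(PR _ hL); apply.
have -> : least_logic P = finite_part.
  apply/funext => G; apply/funext => phi; apply/propext; split.
    by apply; [exact: finite_part_logic|exact: Pfin].
  move=> [F [_ FG Fphi]] L hL PL.
  exact: (logic_weaken hL FG (Fphi _ hL PL)).
by split; first exact: finite_part_logic.
Qed.

Lemma least_logic_min L :
  is_logic L -> P L -> forall G phi, least_logic P G phi -> L G phi.
Proof. by move=> hL PL G phi; apply. Qed.

End LeastLogic.

Lemma finitary_and E (P Q : conseq E -> Prop) :
  finitary_rules P -> finitary_rules Q ->
  finitary_rules (fun L => P L /\ Q L).
Proof.
move=> [R [finR PR]] [R' [finR' QR]].
exists (fun G phi => R G phi \/ R' G phi); split.
  by move=> G phi [/finR|/finR'].
move=> L hL; split=> [[/(PR _ hL) hP /(QR _ hL) hQ] G phi [/hP|/hQ] //|h].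
by split; [apply/(PR _ hL)|apply/(QR _ hL)] => G phi RG; apply: h; [left|right].
Qed.

Lemma finitary_forall E I (P : I -> conseq E -> Prop) :
  (forall i, finitary_rules (P i)) ->
  finitary_rules (fun L => forall i, P i L).
Proof.
move=> /choice[R hR]; exists (fun G phi => exists i, R i G phi); split.
  by move=> G phi [i]; exact: (hR i).1.
move=> L hL; split=> [h G phi [i]|h i].
  by have /((hR i).2 _ hL) := h i; apply.
by apply/((hR i).2 _ hL) => G phi RG; apply: h; exists i.
Qed.

Lemma finitary_rule E (G : set (formula E)) phi :
  finite_set G -> finitary_rules (fun L => L G phi).
Proof.
move=> finG; exists (fun H psi => H = G /\ psi = phi); split.
  by move=> _ _ [-> _].
by move=> L _; split=> [h _ _ [-> ->] //|]; apply.
Qed.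

Lemma finitary_thm E (phi : formula E) :
  finitary_rules (fun L => L set0 phi).
Proof. exact: finitary_rule. Qed.

Lemma finitary_imply E (A : Prop) (P : conseq E -> Prop) :
  finitary_rules P -> finitary_rules (fun L => A -> P L).
Proof.
move=> [R [finR PR]]; exists (fun G phi => A /\ R G phi); split.
  by move=> G phi [_ /finR].
move=> L hL; split=> [h G phi [/h /(PR _ hL)]|h a]; first exact.
by apply/(PR _ hL) => G phi RG; exact: h.
Qed.

(** L1 may contain rules with infinitely many premises; its finitarity recovers each of them from
    one whose premises form a finite set, and the image of that set is finite. *)
Lemma finitary_morphism E1 E2 (T : translation E1 E2) (L1 : conseq E1) :
  is_logic L1 -> finitary_rules (morphism T L1).
Proof.
move=> hL1.
exists (fun G phi => exists F psi, [/\ finite_set F, L1 F psi,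
  G = translate T @` F & phi = translate T psi]); split.
  by move=> _ _ [F [psi [finF _ -> _]]]; exact: finite_image.
move=> L hL; split=> [h _ _ [F [psi [_ Fpsi -> ->]]]|h G phi]; first exact: h.
move=> /(logic_fin hL1)[F [finF FG Fphi]].
apply: (@logic_weaken _ _ hL (translate T @` F)); first exact: image_subset.
by apply: h; exists F, phi.
Qed.

Lemma finitary_equiv E (P Q : conseq E -> Prop) :
  (forall L, P L <-> Q L) -> finitary_rules P -> finitary_rules Q.
Proof.
move=> PQ [R [finR PR]]; exists R; split=> // L hL.
by rewrite -PQ; exact: PR.
Qed.

Section Pullback.
Variables (E1 E2 : signature) (T : translation E1 E2) (L2 : conseq E2).
Hypothesis logicL2 : is_logic L2.

(** Morphisms out of a least logic are obtained by minimality: it suffices that this preimage of L2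
    satisfies the defining rules. *)
Definition pullback : conseq E1 :=
  fun G phi => L2 (translate T @` G) (translate T phi).

Lemma pullback_logic : is_logic pullback.
Proof.
split.
- by move=> G phi Gphi; apply: (logic_refl logicL2); exists phi.
- move=> G D phi GL DL; apply: (logic_cut logicL2 GL) => _ [psi Gpsi <-].
  exact: DL.
- move=> s G phi.
  move=> /(logic_struct logicL2 (fun n => translate T (s n))).
  rewrite /pullback translate_subst !image_comp.
  rewrite (_ : _ \o translate T = translate T \o subst s) //.
  by apply/funext => psi /=; rewrite translate_subst.
- move=> G phi /(logic_fin logicL2)[F [finF FG Fphi]].
  have [B [finB BG BF]] := image_lift_finite finF FG.
  by exists B; split; rewrite // /pullback BF.
Qed.

End Pullback.

Lemma morphism_comp E1 E2 E3 (T : translation E1 E2) (U : translation E2 E3)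
    L1 L2 L3 :
  morphism T L1 L2 -> morphism U L2 L3 ->
  morphism (translation_comp T U) L1 L3.
Proof.
move=> TL UL G phi /TL /UL; rewrite translate_comp image_comp.
rewrite (_ : _ \o _ = translate (translation_comp T U)) //.
by apply/funext => psi /=; rewrite translate_comp.
Qed.

Lemma morphic_trans E1 E2 E3 (L1 : conseq E1) (L2 : conseq E2) (L3 : conseq E3) :
  morphic L1 L2 -> morphic L2 L3 -> morphic L1 L3.
Proof.
move=> [T hT] [U hU]; exists (translation_comp T U); exact: morphism_comp hU.
Qed.

Lemma equipollent_morphic E1 E2 (L1 : conseq E1) (L2 : conseq E2) :
  equipollent L1 L2 -> morphic L1 L2 /\ morphic L2 L1.
Proof. by move=> [T [S [hT hS _ _]]]; split; [exists T|exists S]. Qed.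

Lemma equipollent_sym E1 E2 (L1 : conseq E1) (L2 : conseq E2) :
  equipollent L1 L2 -> equipollent L2 L1.
Proof. by move=> [T [S [? ? ? ?]]]; exists S, T; split. Qed.

Lemma morphism_interderivable E1 E2 (T : translation E1 E2) L1 L2 phi psi :
  morphism T L1 L2 -> interderivable L1 phi psi ->
  interderivable L2 (translate T phi) (translate T psi).
Proof. by move=> hT [/hT + /hT]; rewrite !image_set1. Qed.

Lemma interderivable_trans E (L : conseq E) phi psi chi : is_logic L ->
  interderivable L phi psi -> interderivable L psi chi ->
  interderivable L phi chi.
Proof.
move=> hL [h1 h2] [h3 h4]; split.
  exact: logic_cut_set1 h3 h1.
exact: logic_cut_set1 h2 h4.
Qed.

Lemma equipollent_trans E1 E2 E3
    (L1 : conseq E1) (L2 : conseq E2) (L3 : conseq E3) :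
  is_logic L1 -> is_logic L3 ->
  equipollent L1 L2 -> equipollent L2 L3 -> equipollent L1 L3.
Proof.
move=> hL1 hL3 [T [S [hT hS ST TS]]] [U [V [hU hV VU UV]]].
exists (translation_comp T U), (translation_comp V S); split.
- exact: morphism_comp hU.
- exact: morphism_comp hS.
- move=> phi; rewrite -!translate_comp.
  apply: interderivable_trans (ST phi) _ => //.
  exact: morphism_interderivable hS (VU _).
- move=> phi; rewrite -!translate_comp.
  apply: interderivable_trans (UV phi) _ => //.
  exact: morphism_interderivable hU (TS _).
Qed.

(** * Algebras and semantic consequence *)

Record algebra (E : signature) := Algebra {
  acar :> Type;
  aZero : acar;
  aNeg : acar -> acar;
  aPlus : acar -> acar -> acar;
  aApp : forall f : symb E, ('I_(arity f) -> acar) -> acar }.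

Fixpoint eval E (A : algebra E) V (w : V -> A) (t : term E V) : A :=
  match t with
  | Var v => w v
  | Zero => aZero A
  | Neg t1 => aNeg (eval w t1)
  | Plus t1 t2 => aPlus (eval w t1) (eval w t2)
  | App f a => aApp (fun i => eval w (a i))
  end.

Definition mv_reduct E (A : algebra E) : algebra mv :=
  @Algebra mv A (aZero A) (@aNeg _ A) (@aPlus _ A)
    (fun f => match f with end).

Section Eval.
Variables (E : signature) (A : algebra E).

Lemma eq_eval_term V (w1 w2 : V -> A) t : w1 =1 w2 -> eval w1 t = eval w2 t.
Proof. by move=> /funext ->. Qed.

Lemma eval_subst V W (s : V -> term E W) (w : W -> A) t :
  eval w (subst s t) = eval (fun v => eval w (s v)) t.
Proof.
elim: t => //= [t -> //|t1 -> t2 -> //|f a IH].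
by congr aApp; apply/funext => i; exact: IH.
Qed.

Lemma eval_mv_incl V (w : V -> A) (t : term mv V) :
  eval w (translate (mv_incl E) t) = @eval _ (mv_reduct A) V w t.
Proof. by elim: t => //= [t -> //|t1 -> t2 -> //]. Qed.

Lemma eval_translate E1 (T : translation E1 E) V (w : V -> A) t :
  eval w (translate T t) =
  @eval _ (@Algebra E1 A (aZero A) (@aNeg _ A) (@aPlus _ A)
    (fun f a => eval a (T f))) V w t.
Proof.
elim: t => //= [t -> //|t1 -> t2 -> //|f a IH].
by rewrite eval_subst; apply: eq_eval_term.
Qed.

End Eval.

(* Consequence over the valuations of A with values in D; it is made finitary
   because semantic consequence over one algebra need not be compact. *)
Definition sem E (A : algebra E) (D : set A) (one : A) : conseq E :=
  fun G phi => exists F, [/\ finite_set F, F `<=` G &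
    forall w : nat -> A, (forall i, D (w i)) ->
      (forall psi, F psi -> eval w psi = one) -> eval w phi = one].

Lemma sem_logic E (A : algebra E) (D : set A) one :
  (forall (w : nat -> A) t, (forall i, D (w i)) -> D (eval w t)) ->
  is_logic (sem D one).
Proof.
move=> Dev; split.
- move=> G phi Gphi; exists [set phi]; split=> [|_ -> //|w _]; last exact.
  exact: finite_set1.
- move=> G D' phi [F [finF FG Fphi]] GD.
  pose f psi := if pselect (G psi) is left h then sval (cid (GD _ h)) else set0.
  have fP psi : F psi -> [/\ finite_set (f psi), f psi `<=` D' &
      forall w : nat -> A, (forall i, D (w i)) ->
      (forall chi, f psi chi -> eval w chi = one) -> eval w psi = one].
    move=> /FG Gpsi; rewrite /f; case: pselect => // h.
    exact: (svalP (cid (GD _ h))).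
  exists (\bigcup_(psi in F) f psi); split.
  + by apply: bigcup_finite => // psi /fP[].
  + by move=> psi [chi /fP[_ + _]]; apply.
  move=> w wD h; apply: (Fphi w wD) => psi Fpsi.
  have [_ _] := fP _ Fpsi; apply=> // chi fchi; by apply: h; exists psi.
- move=> s G phi [F [finF FG Fphi]]; exists (subst s @` F).
  split; [exact: finite_image|exact: image_subset|] => w wD h.
  rewrite eval_subst; apply: Fphi => [i|psi Fpsi]; first exact: Dev.
  by rewrite -eval_subst; apply: h; exists psi.
- move=> G phi [F [finF FG Fphi]]; exists F; split=> //.
  by exists F; split.
Qed.

Lemma sem_thm E (A : algebra E) (D : set A) one phi :
  sem D one set0 phi <->
  (forall w : nat -> A, (forall i, D (w i)) -> eval w phi = one).
Proof.
split=> [[F [_ F0 h]] w wD|h]; first by apply: h => // psi /F0.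
by exists set0; split=> // w wD _; exact: h.
Qed.

Lemma sem_finite E (A : algebra E) (D : set A) one G phi : finite_set G ->
  sem D one G phi <->
  (forall w : nat -> A, (forall i, D (w i)) ->
      (forall psi, G psi -> eval w psi = one) -> eval w phi = one).
Proof.
move=> finG; split=> [[F [_ FG h]] w wD hG|h]; last by exists G; split.
by apply: h => // psi /FG; exact: hG.
Qed.

(** * MV-algebras and the Lindenbaum algebra *)

Lemma luk_rules_finitary : finitary_rules luk_rules.
Proof.
set x : formula mv := Var 0%N; set y : formula mv := Var 1%N.
set z : formula mv := Var 2%N.
apply: (@finitary_equiv _ (fun L : conseq mv => (L set0 (x ==> (y ==> x))%MV /\
   L set0 ((x ==> y) ==> ((y ==> z) ==> (x ==> z)))%MV /\
   L set0 (((x ==> y) ==> y) ==> ((y ==> x) ==> x))%MV /\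
   L set0 ((~~ x ==> ~~ y) ==> (y ==> x))%MV /\
   L set0 ((x + y) ==> (~~ x ==> y))%MV /\
   L set0 ((~~ x ==> y) ==> (x + y))%MV /\
   L set0 One /\
   L [set x; (x ==> y)%MV] y))).
  by move=> L; split=> [[? [? [? [? [? [? []]]]]]]|[]]; split.
by do !apply: finitary_and => //; try exact: finitary_thm; apply: finitary_rule;
  rewrite finite_setU; split; exact: finite_set1.
Qed.

Lemma lukasiewicz_logic : is_logic lukasiewicz /\ luk_rules lukasiewicz.
Proof. exact: least_logicP luk_rules_finitary. Qed.

Lemma finitary_sub E (L0 : conseq E) : is_logic L0 ->
  finitary_rules (fun L => forall G phi, L0 G phi -> L G phi).
Proof.
move=> hL0; exists (fun G phi => finite_set G /\ L0 G phi); split.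
  by move=> G phi [].
move=> L hL; split=> [h G phi [_ /h] //|h G phi].
move=> /(logic_fin hL0)[F [finF FG Fphi]].
by apply: (logic_weaken hL FG); exact: h.
Qed.

Lemma LP_spec : is_logic LP /\ ((forall G phi, lukasiewicz G phi -> LP G phi) /\
  LP set0 (nmul 2 (Var 0%N ^ 2) <==> (nmul 2 (Var 0%N)) ^ 2)%MV).
Proof.
apply: least_logicP; apply: finitary_and; last exact: finitary_thm.
by apply: finitary_sub; case: lukasiewicz_logic.
Qed.

Lemma LP_logic : is_logic LP. Proof. by case: LP_spec. Qed.

Record mv_algebra := MVAlgebra {
  mv_car :> Type;
  mv0 : mv_car;
  mvN : mv_car -> mv_car;
  mvD : mv_car -> mv_car -> mv_car;
  mvDA : forall x y z, mvD x (mvD y z) = mvD (mvD x y) z;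
  mvDC : forall x y, mvD x y = mvD y x;
  mvD0 : forall x, mvD x mv0 = x;
  mvNK : forall x, mvN (mvN x) = x;
  mvD1 : forall x, mvD x (mvN mv0) = mvN mv0;
  mv_or : forall x y,
    mvD (mvN (mvD (mvN x) y)) y = mvD (mvN (mvD (mvN y) x)) x }.

Section MVTheory.
Variable M : mv_algebra.
Implicit Types x y z : M.

Local Notation "0" := (mv0 M).
Local Notation "1" := (mvN (mv0 M)).
Local Notation "- x" := (mvN x).
Local Notation "x + y" := (mvD x y).

Definition mv_le x y := - x + y = 1.
Definition mv_sub x y := - (- x + y).

Lemma mv0D x : 0 + x = x. Proof. by rewrite mvDC mvD0. Qed.
Lemma mv1D x : 1 + x = 1. Proof. by rewrite mvDC mvD1. Qed.
Lemma mvNx x : - x + x = 1.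
Proof. by have := mv_or 1 x; rewrite mvNK mv0D mvD1. Qed.

Lemma mv_le_sub x y : mv_le x y -> y = x + mv_sub y x.
Proof.
move=> xy; have := mv_or x y; rewrite /mv_sub.
by move: (xy); rewrite /mv_le => ->; rewrite mvNK mv0D (mvDC x).
Qed.

Lemma mv_le_add x y : mv_le x (x + y).
Proof. by rewrite /mv_le mvDA mvNx mv1D. Qed.

Lemma mv_le_trans x y z : mv_le x y -> mv_le y z -> mv_le x z.
Proof.
move=> /mv_le_sub -> /mv_le_sub ->; rewrite -!mvDA; exact: mv_le_add.
Qed.

Lemma mv_le_anti x y : mv_le x y -> mv_le y x -> x = y.
Proof.
by move=> /mv_le_sub xy yx; rewrite xy /mv_sub yx mvNK mvD0.
Qed.

Lemma mv_leN x y : mv_le x y -> mv_le (- y) (- x).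
Proof. by rewrite /mv_le mvNK mvDC. Qed.

Lemma mv_leD x y z : mv_le x y -> mv_le (x + z) (y + z).
Proof.
move=> /mv_le_sub ->; rewrite -mvDA (mvDC (mv_sub _ _)) mvDA.
exact: mv_le_add.
Qed.

Lemma mv_le0 x : mv_le 0 x. Proof. by rewrite /mv_le mv1D. Qed.

Lemma mv_le_eq0 x : mv_le x 0 -> x = 0.
Proof. by move=> x0; apply: mv_le_anti (mv_le0 _). Qed.

Lemma mv_sub_le x y : mv_le (mv_sub x y) x.
Proof. by rewrite /mv_le /mv_sub mvNK mvDC mvDA (mvDC x) mvNx mv1D. Qed.

Lemma mv_subK x y : mv_le x (- y) -> mv_sub (x + y) y = x.
Proof.
rewrite /mv_le /mv_sub => xy; have := mv_or (- x) y.
by rewrite mvNK (mvDC (- y)) xy mvNK mv0D => ->; rewrite mvNK.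
Qed.

Definition mv_star x y := - (- x + - y).

Lemma mv_starC x y : mv_star x y = mv_star y x.
Proof. by rewrite /mv_star mvDC. Qed.

Lemma mv_starA x y z : mv_star x (mv_star y z) = mv_star (mv_star x y) z.
Proof. by rewrite /mv_star !mvNK mvDA. Qed.

Lemma mv_starCA x y z : mv_star x (mv_star y z) = mv_star y (mv_star x z).
Proof. by rewrite !mv_starA (mv_starC x). Qed.

Lemma mv_star_imp x y : mv_star x (- x + y) = mv_star y (- y + x).
Proof.
rewrite /mv_star; congr (- _); have := mv_or (- x) (- y).
rewrite !mvNK => h.
by rewrite (mvDC (- x) y) (mvDC (- y) x) (mvDC (- x)) (mvDC (- y)) h.
Qed.

Lemma mv_prelinear x y :
  - (- (- x + y) + (- y + x)) + (- y + x) = 1.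
Proof.
set p := - x + y; set q := - y + x.
pose a := - q; pose c := - p; pose z := - y + c.
(* The join of p and q is 1 exactly when the meet of a and c is 0, and this meet is the product of a
   and -a + c. The product is rearranged until the factors y and -y meet. *)
suff h : mv_star a (- a + c) = 0.
  have : mv_le (- a + c) (- a).
    by rewrite /mv_le -h /mv_star mvNK mvDC.
  by rewrite /mv_le /a /c mvNK (mvDC q).
have -> : - a + c = x + z by rewrite /a /z mvNK /q (mvDC (- y)) mvDA.
have -> : a = mv_star y (- x) by rewrite /a /q /mv_star mvNK.
have cE : c = mv_star x (- y) by rewrite /c /p /mv_star mvNK.
have nz : - z = mv_star y (- c) by rewrite /z /mv_star mvNK.
have -> : mv_star (mv_star y (- x)) (x + z) =
          mv_star (mv_star (- y) (- c + y)) (mv_star x (- x + - z)).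
  rewrite -mv_starA -{2}(mvNK x) mv_star_imp mv_starA.
  rewrite (_ : mv_star y z = mv_star (mv_star x (- y)) (- c + y)); last first.
    by rewrite -cE mv_star_imp.
  by rewrite (mv_starC x) (mvDC (- x)) -!mv_starA (mv_starCA x).
have -> : mv_star x (- x + - z) = mv_star y (mv_star (- c) (z + x)).
  by rewrite mv_star_imp {1}nz mvNK mv_starA.
rewrite mv_starA (mv_starC _ y) (mv_starA y (- y)) (_ : mv_star y (- y) = 0).
  by rewrite /mv_star mv1D mvNK mv1D mvNK.
by rewrite /mv_star mvDC mvNx mvNK.
Qed.

End MVTheory.

Lemma mv_and1 (M : mv_algebra) (x y : M) :
  mvN (mvD (mvN (mvD (mvN (mvN x)) (mvN y))) (mvN y)) = mvN (mv0 M) ->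
  x = mvN (mv0 M) /\ y = mvN (mv0 M).
Proof.
move=> /(congr1 (@mvN M)); rewrite !mvNK => h; split.
  rewrite -[LHS]mvNK; congr mvN; apply: mv_le_eq0; rewrite -h.
  have := mv_or (mvN x) (mvN y); rewrite mvNK => ->.
  by rewrite mvDC; exact: mv_le_add.
rewrite -[LHS]mvNK; congr mvN; apply: mv_le_eq0; rewrite -h.
by rewrite mvDC; exact: mv_le_add.
Qed.

Lemma mv_iff1 (M : mv_algebra) (x y : M) :
  mvN (mvD (mvN (mvD (mvN (mvN (mvD (mvN x) y))) (mvN (mvD (mvN y) x))))
           (mvN (mvD (mvN y) x))) = mvN (mv0 M) -> x = y.
Proof. by move=> /mv_and1[]; exact: mv_le_anti. Qed.

(** * Theories, their Lindenbaum algebras and prime theories *)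

Section Deduction.
Local Open Scope mv_scope.

(** The schemes range over all formulas because the set itself need not be closed under
    substitution: it stands for the consequences of fixed premises. *)
Record theory (Th : set (formula mv)) : Prop := Theory {
  thK : forall x y, Th (x ==> (y ==> x));
  thT : forall x y z, Th ((x ==> y) ==> ((y ==> z) ==> (x ==> z)));
  thO : forall x y, Th (((x ==> y) ==> y) ==> ((y ==> x) ==> x));
  thC : forall x y, Th ((~~ x ==> ~~ y) ==> (y ==> x));
  thD1 : forall x y, Th ((x + y) ==> (~~ x ==> y));
  thD2 : forall x y, Th ((~~ x ==> y) ==> (x + y));
  th1 : Th One;
  thLP : forall x, Th (nmul 2 (x ^ 2) <==> (nmul 2 x) ^ 2);
  thMP : forall x y, Th x -> Th (x ==> y) -> Th y }.

Lemma logic_theory (L : conseq mv) G : is_logic L ->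
  (forall G phi, LP G phi -> L G phi) -> theory [set phi | L G phi].
Proof.
move=> hL LPL.
have [_ [lukLP axLP]] := LP_spec; have [_ luk] := lukasiewicz_logic.
have lukL phi : lukasiewicz set0 phi -> L set0 phi by move=> /lukLP /LPL.
have inst (s : nat -> formula mv) phi : L set0 phi -> L G (subst s phi).
  by move=> h; apply: logic_thm => //; exact: logic_struct0.
pose s (x y z : formula mv) n :=
  match n with 0%N => x | 1%N => y | _ => z end.
have i x y z phi := inst (s x y z) phi \o lukL phi.
split=> /=.
- by move=> x y; exact: (i x y x _ (luk_K luk)).
- by move=> x y z; exact: (i x y z _ (luk_trans luk)).
- by move=> x y; exact: (i x y x _ (luk_or luk)).
- by move=> x y; exact: (i x y x _ (luk_contra luk)).
- by move=> x y; exact: (i x y x _ (luk_plus1 luk)).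
- by move=> x y; exact: (i x y x _ (luk_plus2 luk)).
- exact: (i Zero Zero Zero _ (luk_one luk)).
- by move=> x; exact: (inst (fun=> x) _ (LPL _ _ axLP)).
- move=> x y Lx Lxy.
  have /LPL /(logic_struct hL (s x y x)) := lukLP _ _ (luk_mp luk).
  move=> /(logic_cut hL); apply => _ [_ [->|->] <-] //.
Qed.

Section Quotient.
Variables (Th : set (formula mv)) (hTh : theory Th).
Implicit Types x y z : formula mv.

Let mp x y := @thMP _ hTh x y.

Lemma th_trans x y z : Th (x ==> y) -> Th (y ==> z) -> Th (x ==> z).
Proof. by move=> xy yz; apply: mp yz (mp xy (thT hTh x y z)). Qed.

Lemma th_eval x y : Th (x ==> ((x ==> y) ==> y)).
Proof. exact: th_trans (thK hTh x (y ==> x)) (thO hTh y x). Qed.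

Lemma th_exch x y z : Th ((x ==> (y ==> z)) ==> (y ==> (x ==> z))).
Proof.
apply: th_trans (thT hTh x (y ==> z) z) _.
exact: mp (th_eval y z) (thT hTh _ _ _).
Qed.

Lemma th_refl x : Th (x ==> x).
Proof.
exact: th_trans (thK hTh x One) (mp (th1 hTh) (th_eval One x)).
Qed.

Lemma th_impr x y z : Th (y ==> z) -> Th ((x ==> y) ==> (x ==> z)).
Proof. by move=> yz; apply: mp yz (mp (thT hTh x y z) (th_exch _ _ _)). Qed.

Lemma th_impl x y z : Th (y ==> x) -> Th ((x ==> z) ==> (y ==> z)).
Proof. by move=> yx; apply: mp yx (thT hTh y x z). Qed.

Lemma th_dneg x : Th (~~ ~~ x ==> x).
Proof.
have h : Th (~~ ~~ x ==> (One ==> x)).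
  apply: th_trans (thK hTh (~~ ~~ x) (~~ ~~ One)) _.
  exact: th_trans (thC hTh (~~ One) (~~ x)) (thC hTh x One).
exact: mp (th1 hTh) (mp h (th_exch _ _ _)).
Qed.

Lemma th_dnegI x : Th (x ==> ~~ ~~ x).
Proof. exact: mp (th_dneg (~~ x)) (thC hTh (~~ ~~ x) x). Qed.

Lemma th_neg x y : Th (x ==> y) -> Th (~~ y ==> ~~ x).
Proof.
move=> xy; apply: mp (thC hTh (~~ x) (~~ y)).
exact: th_trans (th_dneg x) (th_trans xy (th_dnegI y)).
Qed.

Lemma th_plus x x' y y' :
  Th (x ==> x') -> Th (y ==> y') -> Th (x + y ==> x' + y').
Proof.
move=> xx yy; apply: th_trans (thD1 hTh x y) _.
apply: th_trans (thD2 hTh x' y').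
exact: th_trans (th_impr (~~ x) yy) (th_impl _ (th_neg xx)).
Qed.

Definition theqv x y := Th (x ==> y) /\ Th (y ==> x).

Lemma theqv_refl x : theqv x x. Proof. by split; exact: th_refl. Qed.

Lemma theqv_sym x y : theqv x y -> theqv y x. Proof. by case. Qed.

Lemma theqv_trans x y z : theqv x y -> theqv y z -> theqv x z.
Proof. by move=> [xy yx] [yz zy]; split; apply: th_trans; eassumption. Qed.

Lemma theqv_neg x y : theqv x y -> theqv (~~ x) (~~ y).
Proof. by move=> [xy yx]; split; exact: th_neg. Qed.

Lemma theqv_plus x x' y y' :
  theqv x x' -> theqv y y' -> theqv (x + y) (x' + y').
Proof. by move=> [? ?] [? ?]; split; exact: th_plus. Qed.

Lemma theqv_true x : Th x -> theqv x One.
Proof.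
move=> Tx; split; last exact: mp Tx (thK hTh _ _).
exact: mp (th1 hTh) (thK hTh _ _).
Qed.

Definition quot := {A : set (formula mv) | exists x, A = theqv x}.

Definition cl x : quot := exist _ (theqv x) (ex_intro _ x erefl).

Lemma cl_eq x y : cl x = cl y <-> theqv x y.
Proof.
split=> [/(congr1 (fun u : quot => sval u y)) /= h|xy].
  by have := theqv_refl y; rewrite -h.
apply: eq_exist; apply/funext => z; apply/propext; split.
  exact: theqv_trans (theqv_sym xy).
exact: theqv_trans.
Qed.

Lemma cl_surj (u : quot) : exists x, u = cl x.
Proof.
case: u => A [x Ax]; exists x; apply: eq_exist; exact: Ax.
Qed.

Let rep u := sval (cid (cl_surj u)).

Let repK u : u = cl (rep u). Proof. exact: svalP (cid (cl_surj u)). Qed.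

Let rep_cl x : theqv (rep (cl x)) x.
Proof. by apply/cl_eq; rewrite -repK. Qed.

Let qN u := cl (~~ rep u).
Let qD u v := cl (rep u + rep v).

Let qNE x : qN (cl x) = cl (~~ x).
Proof. by apply/cl_eq/theqv_neg/rep_cl. Qed.

Let qDE x y : qD (cl x) (cl y) = cl (x + y).
Proof. by apply/cl_eq/theqv_plus; exact: rep_cl. Qed.

Let thDC x y : Th (x + y ==> y + x).
Proof.
apply: th_trans (thD1 hTh x y) (th_trans _ (thD2 hTh y x)).
apply: th_trans (th_impr (~~ x) (th_dnegI y)) (thC hTh _ _).
Qed.

Let thDCA x y z : Th (x + (y + z) ==> y + (x + z)).
Proof.
apply: th_trans (th_plus (th_refl x) (thD1 hTh y z)) _.
apply: th_trans (th_trans (thD1 hTh _ _) (th_exch _ _ _)) _.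
apply: th_trans (thD2 hTh _ _) _.
exact: th_plus (th_refl y) (thD2 hTh x z).
Qed.

Let thD0 x : Th (x + Zero ==> x).
Proof.
apply: th_trans (thDC _ _) (th_trans (thD1 hTh _ _) _).
exact: mp (th1 hTh) (th_eval One x).
Qed.

Let th_addl x y : Th (y ==> x + y).
Proof. exact: th_trans (thK hTh y (~~ x)) (thD2 hTh x y). Qed.

Let qDA u v w : qD u (qD v w) = qD (qD u v) w.
Proof.
have [[[x ->] [y ->]] [z ->]] := (cl_surj u, cl_surj v, cl_surj w).
rewrite !qDE; apply/cl_eq; split.
  apply: th_trans (th_plus (th_refl x) (thDC _ _)) _.
  exact: th_trans (thDCA _ _ _) (thDC _ _).
apply: th_trans (thDC _ _) (th_trans (thDCA _ _ _) _).
exact: th_plus (th_refl x) (thDC _ _).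
Qed.

Let qDC u v : qD u v = qD v u.
Proof.
have [[x ->] [y ->]] := (cl_surj u, cl_surj v).
by rewrite !qDE; apply/cl_eq; split; exact: thDC.
Qed.

Let qD0 u : qD u (cl Zero) = u.
Proof.
have [x ->] := cl_surj u; rewrite qDE; apply/cl_eq; split; first exact: thD0.
exact: th_trans (th_addl Zero x) (thDC _ _).
Qed.

Let qNK u : qN (qN u) = u.
Proof.
have [x ->] := cl_surj u; rewrite !qNE; apply/cl_eq.
by split; [exact: th_dneg|exact: th_dnegI].
Qed.

Let qD1 u : qD u (qN (cl Zero)) = qN (cl Zero).
Proof.
have [x ->] := cl_surj u; rewrite qNE qDE; apply/cl_eq; apply: theqv_true.
exact: mp (th1 hTh) (th_addl x One).
Qed.

Let q_or u v : qD (qN (qD (qN u) v)) v = qD (qN (qD (qN v) u)) u.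
Proof.
have [[x ->] [y ->]] := (cl_surj u, cl_surj v).
by rewrite !(qNE, qDE); apply/cl_eq; split; exact: thO.
Qed.

Definition quot_mv : mv_algebra := MVAlgebra qDA qDC qD0 qNK qD1 q_or.

Lemma cl_neg x : cl (~~ x) = @mvN quot_mv (cl x).
Proof. by rewrite -qNE. Qed.

Lemma cl_plus x y : cl (x + y) = @mvD quot_mv (cl x) (cl y).
Proof. by rewrite -qDE. Qed.

Lemma cl_true x : Th x <-> cl x = mvN (mv0 quot_mv).
Proof.
rewrite -[mvN _]cl_neg; split=> [Tx|/cl_eq[_ h]].
  by apply/cl_eq; exact: theqv_true.
exact: mp (th1 hTh) h.
Qed.

Lemma quot_perfect (u : quot_mv) :
  mvD (mv_star u u) (mv_star u u) = mv_star (mvD u u) (mvD u u).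
Proof.
have [x ->] := cl_surj u; have /cl_true := thLP hTh x.
rewrite /Iff /And /Or !(cl_neg, cl_plus).
exact: (@mv_iff1 quot_mv).
Qed.

Lemma th_prelinear x y : Th ((~~ (x ==> y) + (y ==> x)) ==> (y ==> x)).
Proof.
by apply/cl_true; rewrite /Imp !(cl_neg, cl_plus); exact: (@mv_prelinear quot_mv).
Qed.

End Quotient.

(** This expresses that the k-th power of p implies x, as in the local deduction theorem of
    Lukasiewicz logic. The formulas implied by p itself are in general not closed under modus
    ponens. *)
Definition impn k (p x : formula mv) := iter k (Imp p) x.

Section AddFormula.
Variables (Th : set (formula mv)) (hTh : theory Th).
Implicit Types p x y : formula mv.

Let mp x y := @thMP _ hTh x y.

Lemma th_impn_mono k p x y : Th (x ==> y) -> Th (impn k p x ==> impn k p y).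
Proof. by move=> xy; elim: k => //= k IH; exact: th_impr. Qed.

Lemma th_impn_exch k p x y : Th (impn k p (x ==> y) ==> (x ==> impn k p y)).
Proof.
elim: k => [|k IH] /=; first exact: th_refl.
exact: th_trans (th_impr hTh p IH) (th_exch hTh _ _ _).
Qed.

Definition th_add p := [set x | exists k, Th (impn k p x)].

Lemma th_add_sub p : Th `<=` th_add p.
Proof. by move=> x Tx; exists 0. Qed.

Lemma th_add_mem p : th_add p p.
Proof. by exists 1%N; exact: th_refl. Qed.

Lemma th_add_theory p : theory (th_add p).
Proof.
split; try (move=> *; apply: th_add_sub; first
   [exact: thK|exact: thT|exact: thO|exact: thC|exact: thD1|exact: thD2
    |exact: th1|exact: thLP]).
move=> x y [k Tx] [l Txy]; exists (k + l)%N; rewrite /impn iterD.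
apply: mp Tx (th_impn_mono k p _).
exact: mp Txy (th_impn_exch l p x y).
Qed.

(** Prelinearity makes x -> y and y -> x exhaustive. Since the two hypotheses use powers of these
    formulas, a double induction removes one implication at a time. *)
Lemma th_cases x y z :
  th_add (x ==> y) z -> th_add (y ==> x) z -> Th z.
Proof.
set p := x ==> y; set q := y ==> x => -[k0 Tp] [l0 Tq].
have or_elim u : Th (p ==> u) -> Th (q ==> u) -> Th u.
  move=> pu qu; apply: mp qu _.
  apply: mp (thO hTh u q).
  exact: th_trans (th_impl hTh q pu) (th_prelinear hTh x y).
have one_left l u : Th (p ==> u) -> Th (impn l q u) -> Th u.
  elim: l => //= l IH pu Tql; apply: IH => //.
  apply: or_elim Tql; apply: th_trans pu _ => //.
  elim: l => [|l IH] /=; first exact: th_refl.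
  exact: th_trans IH (thK hTh _ _).
elim: k0 z l0 Tp Tq => [z l //|k IH z l /= Tp Tq].
apply: (IH z l) => //; apply: (one_left l) Tp _.
apply: mp Tq (th_impn_mono _ _ _).
elim: k {IH} => [|k IH] /=; first exact: th_refl.
exact: th_trans IH (thK hTh _ _).
Qed.

End AddFormula.

Lemma prime_theory (Th : set (formula mv)) phi : theory Th -> ~ Th phi ->
  exists Q, [/\ theory Q, Th `<=` Q, ~ Q phi &
                forall x y, Q (x ==> y) \/ Q (y ==> x)].
Proof.
move=> hTh nphi.
(* Zorn's lemma is applied to the additions A to Th, so that the empty union, which bounds the empty
   chain, is still admissible. *)
pose P := [set A | theory (Th `|` A) /\ ~ (Th `|` A) phi].
have [F FP totF|A [[tA nA] maxA]] := @Zorn_bigcup _ P.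
  have [->|/set0P[A0 FA0]] := eqVneq F set0.
    by rewrite /P /= bigcup_set0 setU0; split=> // -[].
  have memF x : (Th `|` \bigcup_(X in F) X) x -> exists2 X, F X & (Th `|` X) x.
    move=> [Tx|[X FX Xx]]; first by exists A0 => //; left.
    by exists X => //; right.
  have Fmem x X : F X -> (Th `|` X) x -> (Th `|` \bigcup_(X in F) X) x.
    by move=> FX [Tx|Xx]; [left|right; exists X].
  split; last by move=> /memF[X /FP[]].
  have hA0 : theory (Th `|` A0) by case: (FP _ FA0).
  split; try (move=> *; apply: (Fmem _ _ FA0); first
   [exact: thK|exact: thT|exact: thO|exact: thC|exact: thD1|exact: thD2
    |exact: th1|exact: thLP]).
  move=> x y /memF[X FX Xx] /memF[Y FY Yxy].
  have [Z [FZ XZ YZ]] : exists Z, [/\ F Z, X `<=` Z & Y `<=` Z].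
    by have [XY|YX] := totF _ _ FX FY; [exists Y|exists X]; split.
  apply: (Fmem _ _ FZ); have [hZ _] := FP _ FZ.
  apply: (thMP hZ (x := x)); [move: Xx|move: Yxy]; exact: setUS.
pose Q := Th `|` A; exists Q; split=> //; first by move=> x; left.
(* By maximality, a formula outside Q yields phi when it is added to Q. *)
have maxQ p : th_add Q p phi \/ Q p.
  apply: contrapT => /not_orP[nphi' np].
  have TQ : Th `|` th_add Q p = th_add Q p.
    by apply/setUidPr => x Tx; apply: th_add_sub; left.
  apply: (maxA (th_add Q p)); last first.
    by split; rewrite TQ //; exact: th_add_theory.
  split=> [x Ax|h]; first by apply: th_add_sub; right.
  by apply: np; right; apply: h; exact: th_add_mem.
move=> x y; apply: contrapT => /not_orP[nxy nyx]; apply: nA.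
have [hxy|//] := maxQ (x ==> y); have [hyx|//] := maxQ (y ==> x).
exact: th_cases hxy hyx.
Qed.

End Deduction.

(** * Perfect chains and elimination *)

(* The positive cone of a totally ordered abelian group, with truncated
   subtraction, carved out of a larger type by cpos. *)
Record cone := Cone {
  ccar :> Type;
  cpos : set ccar;
  c0 : ccar;
  cD : ccar -> ccar -> ccar;
  cB : ccar -> ccar -> ccar;
  cpos0 : cpos c0;
  cposD : forall a b, cpos a -> cpos b -> cpos (cD a b);
  cposB : forall a b, cpos a -> cpos b -> cpos (cB a b);
  cDA : forall a b c, cD a (cD b c) = cD (cD a b) c;
  cDC : forall a b, cD a b = cD b a;
  cD0 : forall a, cD a c0 = a;
  ctotal : forall a b, cpos a -> cpos b ->
    (b = cD a (cB b a) /\ cB a b = c0) \/ (a = cD b (cB a b) /\ cB b a = c0);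
  ccancel : forall a b c, cpos a -> cpos b -> cpos c ->
    cD a c = cD b c -> a = b;
  cD_eq0 : forall a b, cpos a -> cpos b -> cD a b = c0 -> a = c0 }.

(* Gamma(Z x_lex G, (1, 0)) for the cone K of G: (false, g) is the
   infinitesimal (0, g), and (true, g) is (1, -g). *)
Section Chang.
Variable K : cone.

Definition chang_neg (u : bool * K) : bool * K := (~~ u.1, u.2).

Definition chang_plus (u v : bool * K) : bool * K :=
  match u, v with
  | (false, g), (false, h) => (false, cD g h)
  | (false, g), (true, h) => (true, cB h g)
  | (true, g), (false, h) => (true, cB g h)
  | (true, _), (true, _) => (true, c0 K)
  end.

Definition chang : algebra mv :=
  @Algebra mv (bool * K)%type (false, c0 K) chang_neg chang_plus
    (fun f => match f with end).

Definition chang_dom : set (bool * K) := [set u | cpos u.2].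

Lemma chang_plus_dom u v :
  chang_dom u -> chang_dom v -> chang_dom (chang_plus u v).
Proof.
case: u v => [[] g] [[] h] //= pg ph; rewrite /chang_dom /=;
  by [exact: cpos0|exact: cposB|exact: cposD].
Qed.

Lemma chang_eval_dom V (w : V -> chang) (t : term mv V) :
  (forall i, chang_dom (w i)) -> chang_dom (eval w t).
Proof.
by move=> wD; elim: t => //= [|t1 h1 t2 h2];
  [exact: cpos0|exact: chang_plus_dom].
Qed.

End Chang.

(** * Order, multiples and linear combinations in a cone *)

Section ConeTheory.
Variable K : cone.
Local Notation "a + b" := (cD a b).
Local Notation "0" := (c0 K).
Implicit Types a b c d : K.

Lemma c0D a : 0 + a = a. Proof. by rewrite cDC cD0. Qed.

Lemma cDACA a b c d : (a + b) + (c + d) = (a + c) + (b + d).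
Proof. by rewrite -!cDA; congr cD; rewrite !cDA (cDC b). Qed.

Definition cle a b := exists2 c, cpos c & b = a + c.

Lemma cle_refl a : cle a a. Proof. by exists 0; [exact: cpos0|rewrite cD0]. Qed.

Lemma cle0 a : cpos a -> cle 0 a. Proof. by exists a => //; rewrite c0D. Qed.

Lemma cleD a b c d : cle a b -> cle c d -> cle (a + c) (b + d).
Proof.
move=> [e pe ->] [f pf ->]; exists (e + f); first exact: cposD.
by rewrite cDACA.
Qed.

Lemma cle_cancel a b c : cpos a -> cpos b -> cpos c ->
  cle (a + c) (b + c) -> cle a b.
Proof.
move=> pa pb pc [e pe h]; exists e => //.
by apply: (@ccancel _ _ _ c) => //; [exact: cposD|rewrite h -!cDA (cDC c)].
Qed.

Lemma clt_add a b c d : cpos a -> cpos c ->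
  cle a b -> cle c d -> a + c = b + d -> a = b.
Proof.
move=> pa pc [e pe ->] [f pf ->]; rewrite cDACA -{1}[a + c]c0D [_ + (e + f)]cDC.
move=> /ccancel h; rewrite (@cD_eq0 _ e f) ?cD0 //.
by rewrite -h //; [exact: cpos0|exact: cposD|exact: cposD].
Qed.

Lemma cD_idem a c : cpos a -> cpos c -> a = a + c -> c = 0.
Proof.
move=> pa pc h; apply: (@ccancel _ _ _ a) => //; first exact: cpos0.
by rewrite c0D cDC -h.
Qed.

Lemma cle_anti a b : cpos a -> cle a b -> cle b a -> a = b.
Proof.
move=> pa [c pc ->] [d pd h]; rewrite -cDA in h.
by rewrite (@cD_eq0 _ c d) ?cD0 //; apply: cD_idem h => //; exact: cposD.
Qed.

Definition cmul k a := iter k (cD a) 0.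

Lemma cmul_pos k a : cpos a -> cpos (cmul k a).
Proof. by move=> pa; elim: k => [|k IH]; [exact: cpos0|exact: cposD]. Qed.

Lemma cmulS k a : cmul k.+1 a = a + cmul k a. Proof. by []. Qed.

Lemma cmulDl k l a : cmul (k + l)%N a = cmul k a + cmul l a.
Proof.
by elim: k => [|k IH]; rewrite ?c0D // addSn !cmulS IH cDA.
Qed.

Lemma cmulDr k a b : cmul k (a + b) = cmul k a + cmul k b.
Proof. by elim: k => [|k IH]; rewrite ?cD0 // !cmulS IH cDACA. Qed.

Lemma cmulM k l a : cmul (k * l)%N a = cmul k (cmul l a).
Proof. by elim: k => [|k IH] //; rewrite mulSn cmulDl cmulS IH. Qed.

Lemma cmul_le k a b : cle a b -> cle (cmul k a) (cmul k b).
Proof.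
by move=> ab; elim: k => [|k IH]; [exact: cle_refl|exact: cleD].
Qed.

Lemma cmul_inj k a b : cpos a -> cpos b -> (0 < k)%N ->
  cle a b -> cmul k a = cmul k b -> a = b.
Proof.
case: k => // k pa pb _ ab; rewrite !cmulS => h; apply: clt_add h => //.
  exact: cmul_pos.
exact: cmul_le.
Qed.

Fixpoint comb (w : nat -> K) n (p : nat -> nat) : K :=
  if n is n'.+1 then comb w n' p + cmul (p n') (w n') else 0.

Section Comb.
Variable w : nat -> K.
Hypothesis wpos : forall i, cpos (w i).

Lemma comb_pos n p : cpos (comb w n p).
Proof.
by elim: n => [|n IH] /=; [exact: cpos0|apply: cposD => //; exact: cmul_pos].
Qed.

Lemma combD n p q : comb w n (fun i => p i + q i)%N = comb w n p + comb w n q.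
Proof. by elim: n => [|n /= ->]; rewrite ?cD0 // cmulDl cDACA. Qed.

Lemma combM n k p : comb w n (fun i => k * p i)%N = cmul k (comb w n p).
Proof.
elim: n => [|n /= ->]; last by rewrite cmulM cmulDr.
by elim: k => //= k <-; rewrite cD0.
Qed.

Lemma eq_comb n p q : (forall i, i < n -> p i = q i)%N ->
  comb w n p = comb w n q.
Proof.
by elim: n => //= n IH h; rewrite IH ?h // => i /ltnW; exact: h.
Qed.

Lemma comb_delta n k : (k < n)%N -> comb w n (fun i => nat_of_bool (i == k)) = w k.
Proof.
elim: n => //= n IH; rewrite ltnS leq_eqVlt => /orP[/eqP kn|kn].
  rewrite -kn eqxx cmulS cD0 (@eq_comb _ _ (fun=> 0%N)); last first.
    by move=> i; rewrite ltn_neqAle => /andP[/negPf ->].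
  rewrite -[RHS]c0D; congr cD.
  by elim: {IH kn}k => //= k' ->; rewrite cD0.
by rewrite IH // gtn_eqF // cD0.
Qed.

End Comb.

End ConeTheory.

(** * Fourier-Motzkin elimination *)

Local Open Scope ring_scope.

(* ((p, q), s) stands for p . w <= q . w, strictly if s. *)
Definition constraint : Type := ((nat -> nat) * (nat -> nat) * bool)%type.

(** Both sides have natural coefficients because a cone has no negatives; the same constraint can
    then be read in any cone and over Q. *)
Definition csat (K : cone) (w : nat -> K) n (c : constraint) : Prop :=
  cle (comb w n c.1.1) (comb w n c.1.2) /\
  (c.2 -> comb w n c.1.1 <> comb w n c.1.2).

Definition dotn n (p : nat -> nat) (w : nat -> rat) : rat :=
  \sum_(i < n) (p i)%:R * w i.

Definition lts (s : bool) (a b : rat) : bool := if s then a < b else a <= b.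

Definition qsat (w : nat -> rat) n (c : constraint) : bool :=
  lts c.2 (dotn n c.1.1 w) (dotn n c.1.2 w).

Lemma seq_max (I : Type) (f : I -> rat) (s : seq I) i0 :
  exists2 i, List.In i (i0 :: s) & forall j, List.In j (i0 :: s) -> f j <= f i.
Proof.
elim: s i0 => [|i s IH] i0.
  by exists i0; [left|move=> j [->|[]]].
have [j hj jmax] := IH i; have [le|lt] := leP (f i0) (f j).
  exists j; [by right|move=> k [<- //|]]; exact: jmax.
exists i0; [by left|move=> k [<- //|/jmax]] => /le_trans; apply; exact: ltW.
Qed.

(** The midpoint of the greatest lower bound and the least upper bound serves. If the two coincide,
    comparing a bound of one side with the extreme one of the other shows that no strict bound is
    attained. *)
Lemma lts_between (I J : Type) (A : I -> rat) (B : J -> rat)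
    (s : I -> bool) (s' : J -> bool) (lo : seq I) (up : seq J) :
  (forall i j, List.In i lo -> List.In j up -> lts (s i || s' j) (A i) (B j)) ->
  exists x, (forall i, List.In i lo -> lts (s i) (A i) x) /\
            (forall j, List.In j up -> lts (s' j) x (B j)).
Proof.
have ltsW t a b : a < b -> lts t a b by case: t => //=; exact: ltW.
case: lo => [|i0 lo] h.
  case: up h => [|j0 up] _; first by exists 0.
  have [j _ jmax] := seq_max (fun j => - B j) up j0.
  exists (B j - 1); split=> // k /jmax hk; apply: ltsW; lra.
have [i hi imax] := seq_max A lo i0.
case: up h => [|j0 up] h.
  by exists (A i + 1); split=> // k /imax hk; apply: ltsW; lra.
have [j hj jmax] := seq_max (fun j => - B j) up j0.
have ltsN t a b : lts t a b -> a <= b by case: t => //; exact: ltW.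
have AB := ltsN _ _ _ (h _ _ hi hj).
exists ((A i + B j) / 2); split=> k hk.
  have := imax _ hk; have := h _ _ hk hj; rewrite /lts.
  by case: (s k) => /= [hAB le|_ le]; lra.
have := jmax _ hk; have := h _ _ hi hk; rewrite /lts orbC.
by case: (s' k) => /= [hAB le|_ le]; lra.
Qed.

Section FourierMotzkin.
Variable n : nat.

(** Here c bounds the variable n from below and d bounds it from above. The multipliers a and b are
    its net coefficients in d and in c, so that it gets equal coefficients on both sides of the sum
    and cancels. *)
Definition fm_comb (c d : constraint) : constraint :=
  let a := (d.1.1 n - d.1.2 n)%N in
  let b := (c.1.2 n - c.1.1 n)%N in
  ((fun i => a * c.1.1 i + b * d.1.1 i)%N,
   (fun i => a * c.1.2 i + b * d.1.2 i)%N, c.2 || d.2).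

Definition fm_lo (cs : seq constraint) :=
  [seq c <- cs | (c.1.1 n < c.1.2 n)%N].
Definition fm_up (cs : seq constraint) :=
  [seq c <- cs | (c.1.2 n < c.1.1 n)%N].
Definition fm_eq (cs : seq constraint) :=
  [seq c <- cs | c.1.1 n == c.1.2 n].

Definition fm_step (cs : seq constraint) : seq constraint :=
  fm_eq cs ++ List.flat_map (fun c => map (fm_comb c) (fm_up cs)) (fm_lo cs).

Lemma csat_comb (K : cone) (w : nat -> K) c d : (forall i, cpos (w i)) ->
  (c.1.1 n < c.1.2 n)%N -> (d.1.2 n < d.1.1 n)%N ->
  csat w n.+1 c -> csat w n.+1 d -> csat w n (fm_comb c d).
Proof.
case: c d => [[p q] s] [[p' q'] s'] wpos /= pq qp [le ne] [le' ne'].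
rewrite /fm_comb /csat; cbn [fst snd].
set a := (p' n - q' n)%N; set b := (q n - p n)%N.
have a0 : (0 < a)%N by rewrite subn_gt0.
have b0 : (0 < b)%N by rewrite subn_gt0.
have coef : (a * p n + b * p' n = a * q n + b * q' n)%N.
  have -> : q n = (p n + b)%N by rewrite subnKC // ltnW.
  have -> : p' n = (q' n + a)%N by rewrite subnKC // ltnW.
  by rewrite !mulnDr (mulnC b a); lia.
have pc m r : cpos (comb w m r) by exact: comb_pos.
have pm k x : cpos x -> cpos (cmul k x) by exact: cmul_pos.
have exp r r' : comb w n.+1 (fun i => a * r i + b * r' i)%N =
    cD (cmul a (comb w n.+1 r)) (cmul b (comb w n.+1 r')).
  by rewrite (combD _ _ (fun i => a * r i)%N) !combM.
have expS r r' : comb w n.+1 (fun i => a * r i + b * r' i)%N =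
    cD (comb w n (fun i => a * r i + b * r' i)%N)
       (cmul (a * r n + b * r' n)%N (w n)) by [].
split.
  apply: (@cle_cancel _ _ _ (cmul (a * p n + b * p' n)%N (w n))) => //.
    exact: pm.
  rewrite -expS coef -expS !exp; apply: cleD; exact: cmul_le.
move=> ss eqc.
have {}eqc : cD (cmul a (comb w n.+1 p)) (cmul b (comb w n.+1 p')) =
             cD (cmul a (comb w n.+1 q)) (cmul b (comb w n.+1 q')).
  by rewrite -!exp !expS eqc coef.
(* Equality in a sum of two inequalities forces equality in each of them; the positive multiplier is
   then cancelled because the cone is torsion-free. *)
case/orP: ss => ss; [apply: (ne ss)|apply: (ne' ss)].
  apply: (cmul_inj _ _ a0) => //; apply: clt_add eqc; try exact: pm.
    exact: cmul_le.
  exact: cmul_le.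
apply: (cmul_inj _ _ b0) => //.
rewrite cDC [RHS]cDC in eqc; apply: clt_add eqc; try exact: pm.
  exact: cmul_le.
exact: cmul_le.
Qed.

Lemma fm_step_sat (K : cone) (w : nat -> K) cs : (forall i, cpos (w i)) ->
  (forall c, List.In c cs -> csat w n.+1 c) ->
  forall c, List.In c (fm_step cs) -> csat w n c.
Proof.
move=> wpos h c /List.in_app_iff[/List.filter_In[/h [le ne] /eqP e]|].
  have pm := cmul_pos (c.1.1 n) (wpos n).
  split; first by apply: (@cle_cancel _ _ _ _ _ _ pm);
    [exact: comb_pos|exact: comb_pos|move: le => /=; rewrite -e].
  by move=> /ne /= ne' e'; apply: ne'; rewrite e' e.
move=> /List.in_flat_map[d [/List.filter_In[/h hd dn]]].
move=> /List.in_map_iff[e [<- /List.filter_In[/h he en]]].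
exact: csat_comb.
Qed.

Lemma dotnS p w : dotn n.+1 p w = dotn n p w + (p n)%:R * w n.
Proof. by rewrite /dotn big_ord_recr. Qed.

Lemma eq_dotn p w w' : (forall i, (i < n)%N -> w i = w' i) ->
  dotn n p w = dotn n p w'.
Proof. by move=> h; apply: eq_bigr => i _; rewrite h. Qed.

Lemma dotn_lin a b p q w :
  dotn n (fun i => a * p i + b * q i)%N w =
  a%:R * dotn n p w + b%:R * dotn n q w.
Proof.
rewrite /dotn !mulr_sumr -big_split /=; apply: eq_bigr => i _.
by rewrite natrD !natrM; ring.
Qed.

Lemma lts_ratio s (l r x b : rat) : 0 < b ->
  lts s ((l - r) / b) x = lts s l (r + b * x).
Proof.
by move=> b0; case: s; rewrite /= ?ltr_pdivrMr ?ler_pdivrMr // (mulrC x)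
  ?ltrBlDl ?lerBlDl.
Qed.

Lemma lts_ratior s (l r x b : rat) : 0 < b ->
  lts s x ((r - l) / b) = lts s (l + b * x) r.
Proof.
by move=> b0; case: s; rewrite /= ?ltr_pdivlMr ?ler_pdivlMr // (mulrC x)
  ?ltrBrDl ?lerBrDl.
Qed.

Lemma ltsD s (a b c : rat) : lts s (a + c) (b + c) = lts s a b.
Proof. by case: s; rewrite /= ?ltrD2r ?lerD2r. Qed.

Lemma fm_step_complete w cs :
  (forall c, List.In c (fm_step cs) -> qsat w n c) ->
  exists w', forall c, List.In c cs -> qsat w' n.+1 c.
Proof.
move=> h.
(* [A c] and [B c] are the lower and the upper bound that c imposes on the variable n. *)
pose A (c : constraint) := (dotn n c.1.1 w - dotn n c.1.2 w) /
                           (c.1.2 n - c.1.1 n)%:R : rat.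
pose B (c : constraint) := (dotn n c.1.2 w - dotn n c.1.1 w) /
                           (c.1.1 n - c.1.2 n)%:R : rat.
have [c d hc hd|x [hlo hup]] := @lts_between _ _ A B snd snd (fm_lo cs) (fm_up cs).
  have : qsat w n (fm_comb c d).
    apply: h; apply/List.in_app_iff; right; apply/List.in_flat_map.
    by exists c; split=> //; apply/List.in_map_iff; exists d.
  move: hc hd => /List.filter_In[_ cn] /List.filter_In[_ dn].
  rewrite /qsat /fm_comb; cbn [fst snd]; rewrite !dotn_lin /A /B.
  have a0 : 0 < (c.1.2 n - c.1.1 n)%:R :> rat by rewrite ltr0n subn_gt0.
  have b0 : 0 < (d.1.1 n - d.1.2 n)%:R :> rat by rewrite ltr0n subn_gt0.
  move: (_ - _)%:R (_ - _)%:R a0 b0 => b a a0 b0.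
  case: (_ || _); rewrite /lts.
    by rewrite ltr_pdivrMr // mulrAC ltr_pdivlMr // => ?; lra.
  by rewrite ler_pdivrMr // mulrAC ler_pdivlMr // => ?; lra.
exists (fun i => if i == n then x else w i) => c hc.
rewrite /qsat !dotnS !eqxx !(@eq_dotn _ (fun i => if i == n then x else w i) w);
  try by move=> i /ltn_eqF ->.
have [cn|cn|cn] := ltngtP (c.1.1 n) (c.1.2 n).
- have /hlo : List.In c (fm_lo cs) by apply/List.filter_In.
  rewrite /A lts_ratio ?ltr0n ?subn_gt0 // natrB 1?ltnW // => hx.
  rewrite -(ltsD _ _ _ (- ((c.1.1 n)%:R * x))).
  by rewrite addrK -addrA -mulrBl.
- have /hup : List.In c (fm_up cs) by apply/List.filter_In.
  rewrite /B lts_ratior ?ltr0n ?subn_gt0 // natrB 1?ltnW // => hx.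
  rewrite -(ltsD _ _ _ (- ((c.1.2 n)%:R * x))).
  by rewrite addrK -addrA -mulrBl.
have : qsat w n c.
  by apply: h; apply/List.in_app_iff; left; apply/List.filter_In; rewrite cn eqxx.
by rewrite /qsat cn ltsD.
Qed.

End FourierMotzkin.

Lemma fourier_motzkin (K : cone) (w : nat -> K) n cs : (forall i, cpos (w i)) ->
  (forall c, List.In c cs -> csat w n c) ->
  exists w', forall c, List.In c cs -> qsat w' n c.
Proof.
move=> wpos; elim: n cs => [|n IH] cs h.
  exists (fun=> 0) => c /h [_ ne]; rewrite /qsat /dotn !big_ord0.
  by case: c.2 ne => //= /(_ isT).
have [w'] := IH _ (fm_step_sat wpos h).
exact: fm_step_complete.
Qed.

(* ((cs, b), (p, q)): under the constraints cs, the value of the term is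
   (b, q . w - p . w). *)
Definition branch : Type :=
  (seq constraint * bool * ((nat -> nat) * (nat -> nat)))%type.

(** A truncated difference is linear on each side of the comparison of its two arguments. Both
    conditions are weak inequalities, so the two pieces are closed and share their boundary. *)
Definition br_sub (cs : seq constraint) (u v : (nat -> nat) * (nat -> nat)) :
    seq branch :=
  let p i := (v.2 i + u.1 i)%N in
  let q i := (u.2 i + v.1 i)%N in
  [:: ((p, q, false) :: cs, true, (p, q));
      ((q, p, false) :: cs, true, (fun=> 0%N, fun=> 0%N))].

Definition br_plus (x y : branch) : seq branch :=
  let cs := x.1.1 ++ y.1.1 in
  match x.1.2, y.1.2 with
  | false, false => [:: (cs, false, (fun i => (x.2.1 i + y.2.1 i)%N,
                                     fun i => (x.2.2 i + y.2.2 i)%N))]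
  | false, true => br_sub cs y.2 x.2
  | true, false => br_sub cs x.2 y.2
  | true, true => [:: (cs, true, (fun=> 0%N, fun=> 0%N))]
  end.

Fixpoint branches (b : nat -> bool) (t : formula mv) : seq branch :=
  match t with
  | Var i => [:: ([::], b i, (fun=> 0%N, fun j => nat_of_bool (j == i)))]
  | Zero => [:: ([::], false, (fun=> 0%N, fun=> 0%N))]
  | Neg t1 => [seq (x.1.1, ~~ x.1.2, x.2) | x <- branches b t1]
  | Plus t1 t2 => List.flat_map (fun x =>
      List.flat_map (br_plus x) (branches b t2)) (branches b t1)
  | App f _ => match f with end
  end.

Fixpoint vbound (t : formula mv) : nat :=
  match t with
  | Var i => i.+1
  | Zero => 0
  | Neg t1 => vbound t1
  | Plus t1 t2 => maxn (vbound t1) (vbound t2)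
  | App f _ => match f with end
  end.

Lemma eq_eval_vbound (A : algebra mv) (w w' : nat -> A) t :
  (forall i, (i < vbound t)%N -> w i = w' i) -> eval w t = eval w' t.
Proof.
elim: t => //= [i|t IH|t1 IH1 t2 IH2] h; first exact: h.
  by rewrite IH.
by rewrite IH1 ?IH2 // => i hi; apply: h; rewrite leq_max hi ?orbT.
Qed.

Section Branches.
Variables (K : cone) (w : nat -> chang K) (N : nat).
Hypothesis wpos : forall i, cpos (w i).2.

Let W i := (w i).2.
Let b i := (w i).1.

Definition bsat (cs : seq constraint) :=
  forall c, List.In c cs -> csat W N c.

Definition bval (x : branch) (u : bool * K) :=
  [/\ u.1 = x.1.2, cpos u.2 & cD u.2 (comb W N x.2.1) = comb W N x.2.2].

Let cp p : cpos (comb W N p). Proof. exact: comb_pos. Qed.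

Let comb0 : comb W N (fun=> 0%N) = c0 K.
Proof. by elim: N => //= n ->; rewrite cD0. Qed.

Lemma bsat_cat cs cs' : bsat (cs ++ cs') <-> bsat cs /\ bsat cs'.
Proof.
split=> [h|[h h'] c /List.in_app_iff[/h|/h'] //].
by split=> c hc; apply: h; apply/List.in_app_iff; [left|right].
Qed.

Let le_or_ge p q : csat W N (p, q, false) \/ csat W N (q, p, false).
Proof.
case: (ctotal (cp p) (cp q)) => [[h _]|[h _]].
  by left; split=> //; exists (cB (comb W N q) (comb W N p)) => //; exact: cposB.
by right; split=> //; exists (cB (comb W N p) (comb W N q)) => //; exact: cposB.
Qed.

(* The truncated difference of g = u.2 - u.1 and h = v.2 - v.1. *)
Let sub_case (g h : K) (u v : (nat -> nat) * (nat -> nat)) :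
  let p i := (v.2 i + u.1 i)%N in
  let q i := (u.2 i + v.1 i)%N in
  cpos g -> cpos h ->
  cD g (comb W N u.1) = comb W N u.2 -> cD h (comb W N v.1) = comb W N v.2 ->
  (csat W N (p, q, false) -> cD (cB g h) (comb W N p) = comb W N q) /\
  (csat W N (q, p, false) -> cB g h = c0 K).
Proof.
move=> p q pg ph gE hE.
pose r := cD (comb W N u.1) (comb W N v.1).
have pr : cpos r by exact: cposD.
have pE : comb W N p = cD h r.
  by rewrite combD -hE /r -cDA (cDC (comb W N v.1)).
have qE : comb W N q = cD g r by rewrite combD -gE /r -cDA.
have pB x y : cpos x -> cpos y -> cpos (cB x y) by exact: cposB.
case: (ctotal pg ph) => [[hgE gh0]|[ghE hg0]].
  rewrite gh0; split=> // -[/= + _]; rewrite pE qE c0D => /cle_cancel hg.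
  by congr cD; apply: cle_anti (hg _ _ _) _ => //; exists (cB h g) => //; exact: pB.
split=> [_|[/= + _]]; first by rewrite pE qE cDA (cDC _ h) -ghE.
rewrite pE qE => /cle_cancel gh; apply: (@cD_idem _ h) => //; first exact: pB.
rewrite -ghE; apply: cle_anti (gh _ _ _) => //.
by exists (cB g h) => //; exact: pB.
Qed.

Lemma br_sub_val cs u v g h : cpos g -> cpos h ->
  cD g (comb W N u.1) = comb W N u.2 -> cD h (comb W N v.1) = comb W N v.2 ->
  (forall x, List.In x (br_sub cs u v) -> bsat x.1.1 ->
     bsat cs /\ bval x (true, cB g h)) /\
  (bsat cs -> exists2 x, List.In x (br_sub cs u v) & bsat x.1.1).
Proof.
move=> pg ph gE hE; have [hq hp] := sub_case pg ph gE hE.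
have pB : cpos (cB g h) by exact: cposB.
split=> [x [<-|[<-|[]]] hx|hcs].
- have /hq e := hx _ (or_introl erefl).
  by split=> [c hc|]; [apply: hx; right|split].
- have /hp e := hx _ (or_introl erefl).
  by split=> [c hc|]; [apply: hx; right|split=> //=; rewrite comb0 e c0D].
have [h1|h1] := le_or_ge (fun i => v.2 i + u.1 i)%N (fun i => u.2 i + v.1 i)%N.
  by eexists; [left; reflexivity|move=> c [<- //|]; exact: hcs].
by eexists; [right; left; reflexivity|move=> c [<- //|]; exact: hcs].
Qed.

Lemma br_plus_val x y u v : bval x u -> bval y v ->
  (forall z, List.In z (br_plus x y) -> bsat z.1.1 ->
     bsat (x.1.1 ++ y.1.1) /\ bval z (chang_plus u v)) /\
  (bsat (x.1.1 ++ y.1.1) -> exists2 z, List.In z (br_plus x y) & bsat z.1.1).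
Proof.
case: u v => [bu g] [bv h] [/= buE pg gE] [/= bvE ph hE].
rewrite /br_plus -buE -bvE /=; case: {buE} bu; case: {bvE} bv => /=.
- split=> [z [<-|//] hz|hcs]; last by eexists; [left; reflexivity|].
  by split=> //; split=> //=; [exact: cpos0|rewrite comb0 cD0].
- exact: br_sub_val.
- exact: br_sub_val.
- split=> [z [<-|//] hz|hcs]; last by eexists; [left; reflexivity|].
  split=> //; split=> //=; first exact: cposD.
  by rewrite !combD cDACA gE hE.
Qed.

Lemma br_plus_bsat x y z : List.In z (br_plus x y) -> bsat z.1.1 ->
  bsat (x.1.1 ++ y.1.1).
Proof.
rewrite /br_plus; case: x.1.2; case: y.1.2 => /=.
- by move=> [<-|[]].
- by move=> [<-|[<-|[]]] h c hc; apply: h; right.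
- by move=> [<-|[<-|[]]] h c hc; apply: h; right.
- by move=> [<-|[]].
Qed.

Lemma branches_val t x : (vbound t <= N)%N -> List.In x (branches b t) ->
  bsat x.1.1 -> bval x (eval w t).
Proof.
elim: t x => [i||t IH|t1 IH1 t2 IH2|[]] x /=.
- move=> iN [<-|//] _; split=> //=.
  by rewrite comb_delta // comb0 cD0.
- by move=> _ [<-|//] _; split=> //=; [exact: cpos0|rewrite comb0 cD0].
- move=> tN /List.in_map_iff[y [<- hy]] /= hs.
  by have [yE ? ?] := IH y tN hy hs; split; rewrite //= yE.
- rewrite geq_max => /andP[t1N t2N].
  move=> /List.in_flat_map[y [hy /List.in_flat_map[z [hz hx]]]] hs.
  have /bsat_cat[sy sz] := br_plus_bsat hx hs.
  have [h _] := br_plus_val (IH1 y t1N hy sy) (IH2 z t2N hz sz).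
  by have [] := h x hx hs.
Qed.

Lemma branches_cover t : (vbound t <= N)%N ->
  exists2 x, List.In x (branches b t) & bsat x.1.1.
Proof.
elim: t => [i||t IH|t1 IH1 t2 IH2|[]] /=.
- by move=> _; eexists; [left; reflexivity|].
- by move=> _; eexists; [left; reflexivity|].
- move=> /IH[x hx sx]; exists (x.1.1, ~~ x.1.2, x.2) => //.
  by apply/List.in_map_iff; exists x.
- rewrite geq_max => /andP[t1N t2N].
  have [x hx sx] := IH1 t1N; have [y hy sy] := IH2 t2N.
  have [_ h] := br_plus_val (branches_val t1N hx sx) (branches_val t2N hy sy).
  have [z hz sz] := h (proj2 (bsat_cat _ _) (conj sx sy)).
  exists z => //; apply/List.in_flat_map; exists x; split=> //.
  by apply/List.in_flat_map; exists y.
Qed.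

End Branches.

(** Hence a weak solution of the branch conditions, as given by [sat], is a solution in the sense of
    [csat]. *)
Lemma branches_nonstrict b t x c :
  List.In x (branches b t) -> List.In c x.1.1 -> c.2 = false.
Proof.
elim: t x c => [i||t IH|t1 IH1 t2 IH2|[]] x c /=.
- by move=> [<-|//].
- by move=> [<-|//].
- by move=> /List.in_map_iff[y [<- /IH h]] /h.
move=> /List.in_flat_map[y [/IH1 hy /List.in_flat_map[z [/IH2 hz hx]]]].
have hyz d : List.In d (y.1.1 ++ z.1.1) -> d.2 = false.
  by move=> /List.in_app_iff[/hy|/hz].
move: hx; rewrite /br_plus; case: y.1.2; case: z.1.2 => /=.
- by move=> [<-|[]] /hyz.
- by move=> [<-|[<-|[]]] [<-|/hyz].
- by move=> [<-|[<-|[]]] [<-|/hyz].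
- by move=> [<-|[]] /hyz.
Qed.

(** * The Chang algebra of Q *)

Section RatCone.
Definition rat_cB (a b : rat) : rat := Num.max 0 (a - b).

Let pos : set rat := [set a | 0 <= a].

Fact rat_cpos0 : pos 0. Proof. exact: lexx. Qed.
Fact rat_cposD a b : pos a -> pos b -> pos (a + b).
Proof. exact: addr_ge0. Qed.
Fact rat_cposB a b : pos a -> pos b -> pos (rat_cB a b).
Proof. by move=> _ _; rewrite /pos /= /rat_cB le_max lexx. Qed.
Fact rat_ctotal a b : pos a -> pos b ->
  (b = a + rat_cB b a /\ rat_cB a b = 0) \/ (a = b + rat_cB a b /\ rat_cB b a = 0).
Proof.
move=> _ _; rewrite /rat_cB; have [ab|/ltW ba] := leP a b; [left|right];
  by split; [rewrite max_r ?subr_ge0 //; ring|rewrite max_l // subr_le0].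
Qed.
Fact rat_ccancel a b c : pos a -> pos b -> pos c -> a + c = b + c -> a = b.
Proof. by move=> _ _ _; exact: addIr. Qed.
Fact rat_cD_eq0 a b : pos a -> pos b -> a + b = 0 -> a = 0.
Proof. by rewrite /pos /= => a0 b0 ab; lra. Qed.

Definition rat_cone : cone := @Cone rat pos 0 +%R rat_cB rat_cpos0 rat_cposD
  rat_cposB (@addrA _) (@addrC _) (@addr0 _) rat_ctotal rat_ccancel rat_cD_eq0.

Lemma rat_cle a b : @cle rat_cone a b <-> a <= b.
Proof.
split=> [[c c0 ->]|ab]; first by rewrite /= lerDl.
by exists (b - a); rewrite /= ?/pos /= ?subr_ge0 //; ring.
Qed.

Lemma rat_comb (w : nat -> rat) n p : @comb rat_cone w n p = dotn n p w.
Proof.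
elim: n => [|n IH] /=; first by rewrite /dotn big_ord0.
rewrite IH dotnS; congr (_ + _).
by elim: (p n) => [|k IHk]; rewrite ?mul0r // cmulS IHk mulrSr /= mulrDl mul1r addrC.
Qed.

End RatCone.

Definition CQ : algebra mv := chang rat_cone.
Definition CQ_one : CQ := (true, 0).
Definition CQ_dom : set CQ := @chang_dom rat_cone.

Lemma qsat_csat (w : nat -> rat) n c : qsat w n c <-> @csat rat_cone w n c.
Proof.
rewrite /qsat /csat !rat_comb rat_cle; case: c.2 => /=; last first.
  by split=> [|[]].
rewrite lt_neqAle; split=> [/andP[/eqP]|[-> /(_ isT)/eqP ->]] //.
Qed.

(** * Perfect chains as Chang algebras *)

Section PerfectChain.
Variable M : mv_algebra.
Implicit Types x y : M.
Hypothesis total : forall x y, mv_le x y \/ mv_le y x.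
Hypothesis perfect :
  forall x, mvD (mv_star x x) (mv_star x x) = mv_star (mvD x x) (mvD x x).
Hypothesis nontrivial : mv0 M <> mvN (mv0 M).

Definition infinitesimal : set M := [set x | mv_le x (mvN x)].

Let pos := infinitesimal.

Lemma inf_le x y : pos y -> mv_le x y -> pos x.
Proof.
move=> py xy; apply: mv_le_trans (xy) (mv_le_trans py (mv_leN xy)).
Qed.

Fact inf0 : pos (mv0 M). Proof. exact: mv_le0. Qed.

(** For infinitesimal x the product of x with itself is 0, so the perfectness equation gives that
    the square of x + x is 0, which says that x + x is infinitesimal. *)
Lemma inf_double x : pos x -> pos (mvD x x).
Proof.
rewrite /pos /infinitesimal /= /mv_le => px; have := perfect x.
by rewrite /mv_star px mvNK mvD0 => /(congr1 (@mvN M)); rewrite mvNK.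
Qed.

Fact infD x y : pos x -> pos y -> pos (mvD x y).
Proof.
wlog xy : x y / mv_le x y => [h px py|px py].
  by have [|] := total x y => /h; [|rewrite mvDC]; apply.
by apply: inf_le (inf_double py) _; exact: mv_leD.
Qed.

Fact infB x y : pos x -> pos y -> pos (mv_sub x y).
Proof. by move=> px _; apply: inf_le px (mv_sub_le _ _). Qed.

Fact inf_total x y : pos x -> pos y ->
  (y = mvD x (mv_sub y x) /\ mv_sub x y = mv0 M) \/
  (x = mvD y (mv_sub x y) /\ mv_sub y x = mv0 M).
Proof.
by move=> _ _; have [xy|yx] := total x y; [left|right];
  (split; first exact: mv_le_sub); rewrite /mv_sub ?xy ?yx mvNK.
Qed.

Lemma inf_leN x y : pos x -> pos y -> mv_le x (mvN y).
Proof.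
move=> px py; have [xy|yx] := total x y; first exact: mv_le_trans xy py.
exact: mv_le_trans px (mv_leN yx).
Qed.

Fact inf_cancel x y z : pos x -> pos y -> pos z ->
  mvD x z = mvD y z -> x = y.
Proof.
move=> px py pz h.
by rewrite -(mv_subK (inf_leN px pz)) h (mv_subK (inf_leN py pz)).
Qed.

Fact infD_eq0 x y : pos x -> pos y -> mvD x y = mv0 M -> x = mv0 M.
Proof.
by move=> _ _ xy; apply: mv_le_eq0; rewrite -xy; exact: mv_le_add.
Qed.

Definition inf_cone : cone := @Cone M pos (mv0 M) (@mvD M) (@mv_sub M)
  inf0 infD infB (@mvDA M) (@mvDC M) (@mvD0 M) inf_total inf_cancel infD_eq0.

Definition mv_alg : algebra mv :=
  @Algebra mv M (mv0 M) (@mvN M) (@mvD M) (fun f => match f with end).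

Definition chain_val (u : chang inf_cone) : mv_alg :=
  if u.1 then mvN u.2 else u.2.

Lemma chain_val_surj (x : M) : exists2 u, cpos u.2 & chain_val u = x.
Proof.
have [xN|Nx] := total x (mvN x); first by exists (false, x).
exists (true, mvN x); last by rewrite /chain_val /= mvNK.
by rewrite /= /pos /infinitesimal /= mvNK.
Qed.

Lemma eval_chain V (w : V -> chang inf_cone) (t : term mv V) :
  (forall v, cpos (w v).2) ->
  @eval _ mv_alg _ (fun v => chain_val (w v)) t = chain_val (eval w t).
Proof.
move=> wpos; elim: t => //= [t ->|t1 -> t2 ->].
  by case: (eval w t) => [[] g]; rewrite /chain_val //= mvNK.
have := @chang_eval_dom inf_cone _ w t1 wpos.
have := @chang_eval_dom inf_cone _ w t2 wpos.
case: (eval w t1) (eval w t2) => [[] g] [[] h]; rewrite /chang_dom /chain_val /=.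
- move=> ph pg; have := inf_leN pg ph; rewrite /mv_le => ->; by [].
- by move=> _ _; rewrite /mv_sub mvNK.
- by move=> _ _; rewrite /mv_sub mvNK mvDC.
- by [].
Qed.

(** In a nontrivial chain 1 is not infinitesimal, so a value 1 can only come from the
    coinfinitesimal half. *)
Lemma chain_val1 u : cpos u.2 ->
  chain_val u = mvN (mv0 M) -> u = (true, c0 inf_cone).
Proof.
case: u => [[] g]; rewrite /chain_val /= => pg g1.
  by rewrite -[g in LHS]mvNK g1 mvNK.
case: nontrivial; apply/esym/mv_le_eq0.
by move: pg; rewrite /pos /infinitesimal /= g1 mvNK.
Qed.

End PerfectChain.

Lemma eval_cl (Th : set (formula mv)) (hTh : theory Th) t :
  @eval _ (mv_alg (quot_mv hTh)) _ (fun n => cl Th (Var n)) t = cl Th t.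
Proof.
elim: t => [//|//|t IH|t1 IH1 t2 IH2|[]]; rewrite [LHS]/=.
  by rewrite IH; exact/esym/(cl_neg hTh).
by rewrite IH1 IH2; exact/esym/(cl_plus hTh).
Qed.

(** * Completeness of LP for the Chang algebra of Q *)

Section Completeness.
Variables (Q : set (formula mv)) (hQ : theory Q) (phi : formula mv).
Hypotheses (Qphi : ~ Q phi) (primeQ : forall x y, Q (x ==> y)%MV \/ Q (y ==> x)%MV).

Let M := quot_mv hQ.

Lemma quot_total (x y : M) : mv_le x y \/ mv_le y x.
Proof.
have [[a ->] [b ->]] := (cl_surj x, cl_surj y); rewrite /mv_le.
have [/(cl_true hQ)|/(cl_true hQ)] := primeQ a b; rewrite /Imp cl_plus cl_neg => h;
  by [left|right].
Qed.

Lemma quot_nontrivial : mv0 M <> mvN (mv0 M).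
Proof.
move=> h; apply: Qphi; apply/(cl_true hQ).
by rewrite -(@mvD0 M (cl Q phi)) [in LHS]h mvD1.
Qed.

Let K := inf_cone quot_total (@quot_perfect _ hQ).

Lemma prime_valuation : exists (K : cone) (w : nat -> chang K),
  (forall i, cpos (w i).2) /\
  (forall psi, Q psi <-> eval w psi = (true, c0 K)).
Proof.
pose f n := cid2 (@chain_val_surj M quot_total (@quot_perfect _ hQ) (cl Q (Var n))).
have fpos n : @cpos K (s2val (f n)).2 by case: (f n).
have fE n : chain_val (s2val (f n)) = cl Q (Var n) by case: (f n).
pose w n : chang K := s2val (f n); exists K, w; split=> // psi.
have -> : Q psi <-> chain_val (eval w psi) = mvN (mv0 M).
  rewrite (cl_true hQ) -(eval_cl hQ) -(@eval_chain M _ _ _ w) //.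
  by rewrite (_ : (fun n => cl Q (Var n)) = fun v => chain_val (w v)) //;
    apply/funext => n; rewrite fE.
split=> [|->] //.
apply: chain_val1; first exact: quot_nontrivial.
exact: (@chang_eval_dom K).
Qed.

End Completeness.

Lemma seq_of_finite T (G : set T) : finite_set G ->
  exists s : seq T, forall x, G x <-> List.In x s.
Proof.
move=> /finite_setP[n]; elim: n G => [|n IH] G.
  rewrite II0 card_eq0 => /eqP ->; by exists [::].
move=> /eq_cardSP[x Gx /IH[s hs]]; exists (x :: s) => y /=.
rewrite -hs /setD /=; split=> [Gy|[<- //|[]//]].
by have [->|yx] := pselect (y = x); [left|right].
Qed.

(** A prime theory gives a countervaluation over some cone K. Along the branches that it follows,
    the failure of the rule is a finite system of constraints, and a rational solution of this
    system with the same Boolean parts is a countervaluation over Q. *)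
Lemma LP_complete G phi : finite_set G ->
  (forall w : nat -> CQ, (forall i, CQ_dom (w i)) ->
     (forall psi, G psi -> eval w psi = CQ_one) -> eval w phi = CQ_one) ->
  LP G phi.
Proof.
move=> /seq_of_finite[s sG] hG; apply: contrapT => nphi.
have hTh := logic_theory G LP_logic (fun G phi h => h).
have [Q [hQ ThQ Qphi primeQ]] := prime_theory hTh nphi.
have [K [w [wpos wQ]]] := prime_valuation hQ Qphi primeQ.
pose N := foldr (fun t m => maxn (vbound t) m) (vbound phi) s.
have sN t : List.In t s -> (vbound t <= N)%N.
  rewrite /N; elim: (s) => //= t' s' IH [->|/IH]; rewrite leq_max ?leqnn //.
  by move=> ->; rewrite orbT.
have phiN : (vbound phi <= N)%N.
  by rewrite /N; elim: (s) => //= t' s' IH; rewrite leq_max IH orbT.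
pose b i := (w i).1.
have brP (t : formula mv) : exists x, (vbound t <= N)%N ->
    List.In x (branches b t) /\ bsat w N x.1.1.
  case: (leqP (vbound t) N) => [tN|]; last by exists ([::], true, (id, id)).
  by have [x hx sx] := branches_cover wpos tN; exists x.
have {brP}/choice[br brP] := brP.
have sQ t : List.In t s -> eval w t = (true, c0 K).
  move=> /sG Gt; apply/wQ; apply: ThQ; exact: (logic_refl LP_logic).
have phiQ : eval w phi <> (true, c0 K) by move/wQ.
(* After the branch conditions of phi comes the failure of phi: if its Boolean part is true, its
   infinitesimal part is strictly positive. Each premise contributes its branch conditions and an
   infinitesimal part at most 0. The last block makes the variables nonnegative. *)
pose cs := (br phi).1.1 ++
  ((br phi).2, (br phi).1.2) ::
  List.flat_map (fun t => ((br t).2.2, (br t).2.1, false) :: (br t).1.1) s ++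
  [seq (fun=> 0%N, fun j => nat_of_bool (j == i), false) | i <- iota 0 N].
have in_head c : List.In c (br phi).1.1 -> List.In c cs.
  by move=> hc; apply/List.in_app_iff; left.
have in_strict : List.In ((br phi).2, (br phi).1.2) cs.
  by apply/List.in_app_iff; right; left.
have in_tail t c : List.In t s -> 
    List.In c (((br t).2.2, (br t).2.1, false) :: (br t).1.1) -> List.In c cs.
  move=> ht hc; apply/List.in_app_iff; right; right; apply/List.in_app_iff.
  by left; apply/List.in_flat_map; exists t.
have in_pos i : (i < N)%N ->
    List.In (fun=> 0%N, fun j => nat_of_bool (j == i), false) cs.
  move=> iN; apply/List.in_app_iff; right; right; apply/List.in_app_iff; right.
  apply/List.in_map_iff; exists i; split=> //.
  have : i \in iota 0 N by rewrite mem_iota.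
  elim: (iota 0 N) => //= k l IH; rewrite inE => /orP[/eqP ->|/IH]; auto.
have brE t (ht : (vbound t <= N)%N) := branches_val wpos ht (brP t ht).1 (brP t ht).2.
have cp p : @cpos K (comb (fun i => (w i).2) N p) by exact: comb_pos.
have csK c : List.In c cs -> csat (fun i => (w i).2) N c.
  move=> /List.in_app_iff[|[<-|/List.in_app_iff[|]]].
  - by case: (brP _ phiN) => _; apply.
  - have [bE pu uE] := brE _ phiN; split=> /=.
      by exists (eval w phi).2; rewrite // cDC.
    move=> bt pq; apply: phiQ; rewrite -pq in uE.
    move: bE pu uE; case: (eval w phi) => b' u /= -> pu uE; rewrite bt; congr pair.
    by apply: (ccancel pu (cpos0 K) (cp (br phi).2.1)); rewrite uE c0D.
  - move=> /List.in_flat_map[t [ts [<-|]]]; last first.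
      by case: (brP _ (sN _ ts)) => _; apply.
    have [_ _ uE] := brE _ (sN _ ts); split=> //=.
    by rewrite -uE (sQ _ ts) c0D; exact: cle_refl.
  - move=> /List.in_map_iff[i [<- hi]]; split=> //=.
    rewrite (_ : comb _ N (fun=> 0%N) = c0 K); first exact: cle0.
    by elim: (N) => //= n ->; rewrite cD0.
have [v0 hv0] := fourier_motzkin wpos csK.
(* Keeping the Boolean parts of w makes the branches chosen for w available for v. *)
pose v i : CQ := (b i, if (i < N)%N then v0 i else 0).
have vsat c : List.In c cs -> @csat rat_cone (fun i => (v i).2) N c.
  move=> /hv0 hc; apply/qsat_csat; move: hc; rewrite /qsat.
  by rewrite !(@eq_dotn _ _ _ v0) // => i iN; rewrite /v /= iN.
have vpos i : CQ_dom (v i).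
  rewrite /v /CQ_dom /chang_dom /=; case: ifP => [iN|_]; last exact: lexx.
  have [/= + _] := vsat _ (in_pos _ iN).
  by rewrite comb_delta // /v /= iN rat_cle rat_comb /dotn big1 // => j _; rewrite mul0r.
have vbr t : (vbound t <= N)%N -> (forall c, List.In c (br t).1.1 -> List.In c cs) ->
    @bval rat_cone v N (br t) (eval v t).
  move=> tN hcs; apply: branches_val => //; first exact: (brP _ tN).1.
  by move=> c /hcs /vsat.
have [bE pu uE] := vbr _ phiN in_head.
have [_ ne] := vsat _ in_strict; cbn [fst snd] in ne.
have : eval v phi = CQ_one.
  apply: hG => // t /sG ts.
  have [tE pt teq] := vbr _ (sN _ ts) (fun c hc => in_tail _ _ ts (or_intror hc)).
  have [tb _ _] := brE _ (sN _ ts); rewrite (sQ _ ts) /= in tb.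
  have [/= + _] := vsat _ (in_tail _ _ ts (or_introl erefl)).
  move: tE pt teq; rewrite -tb; case: (eval v t) => b' u /= -> pt.
  rewrite !rat_comb rat_cle => teq hle; congr pair.
  move: pt; rewrite /= => pt; lra.
move=> phi1; rewrite phi1 /= in bE uE.
by apply: (ne (esym bE)); rewrite -uE /= rat_comb add0r.
Qed.

(** * Division operators *)

Section ChangComputations.
Definition CQ_ext E (I : forall f : symb E, ('I_(arity f) -> CQ) -> CQ) :
  algebra E := @Algebra E CQ (aZero CQ) (@aNeg _ CQ) (@aPlus _ CQ) I.

Local Notation neg := (@chang_neg rat_cone).
Local Notation plus := (@chang_plus rat_cone).
Local Notation imp u v := (plus (neg u) v).
Local Notation or u v := (plus (neg (plus (neg u) v)) v).
Local Notation and u v := (neg (or (neg u) (neg v))).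

(** The inner match only lets through extrema whose arguments contain no further extremum, so that
    nested ones are resolved from the inside out. *)
Ltac chang_cases :=
  rewrite /CQ_dom /chang_dom /chang_neg /chang_plus /= /rat_cB /=;
  repeat match goal with
  | |- context [Num.max ?a ?b] =>
      lazymatch constr:((a, b)) with
      | context [Num.max _ _] => fail
      | context [Num.min _ _] => fail
      | _ => case: (leP a b) => ? end
  | |- context [Num.min ?a ?b] =>
      lazymatch constr:((a, b)) with
      | context [Num.max _ _] => fail
      | context [Num.min _ _] => fail
      | _ => case: (leP a b) => ? end
  end.

Lemma chang_orE (u v : CQ) : CQ_dom u -> CQ_dom v ->
  or u v = match u, v with
           | (false, g), (false, h) => (false, Num.max g h)
           | (true, g), (true, h) => (true, Num.min g h)
           | (true, g), (false, _) => (true, g)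
           | (false, _), (true, h) => (true, h)
           end.
Proof.
by case: u v => [[] g] [[] h]; chang_cases => //= ? ?; congr pair; lra.
Qed.

Lemma chang_andE (u v : CQ) : CQ_dom u -> CQ_dom v ->
  and u v = match u, v with
            | (false, g), (false, h) => (false, Num.min g h)
            | (true, g), (true, h) => (true, Num.max g h)
            | (true, _), (false, h) => (false, h)
            | (false, g), (true, _) => (false, g)
            end.
Proof.
by case: u v => [[] g] [[] h]; chang_cases => //= ? ?; congr pair; lra.
Qed.

Lemma chang_iff1 (u v : CQ) : CQ_dom u -> CQ_dom v ->
  and (imp u v) (imp v u) = CQ_one <-> u = v.
Proof.
rewrite /CQ_one; case: u v => [[] g] [[] h]; chang_cases => //= ? ?;
  split=> H; have := congr1 fst H; have := congr1 snd H => //= ? _;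
  congr pair; lra.
Qed.

Lemma chang_plus_CQ_dom (u v : CQ) : CQ_dom u -> CQ_dom v -> CQ_dom (plus u v).
Proof. exact: chang_plus_dom. Qed.

Lemma CQ_luk (u v w : CQ) : CQ_dom u -> CQ_dom v -> CQ_dom w ->
  [/\ imp u (imp v u) = CQ_one,
      imp (imp u v) (imp (imp v w) (imp u w)) = CQ_one,
      imp (imp (imp u v) v) (imp (imp v u) u) = CQ_one,
      imp (imp (neg u) (neg v)) (imp v u) = CQ_one &
      plus (neg (neg u)) v = plus u v].
Proof.
rewrite /CQ_one => du dv dw; split; move: du dv dw;
  case: u v w => [[] f] [[] g] [[] h]; chang_cases => //= ? ? ?; congr pair; lra.
Qed.

Lemma CQ_imp_refl (u : CQ) : CQ_dom u -> imp u u = CQ_one.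
Proof. by rewrite /CQ_one; case: u => [[] g]; chang_cases => //= ?; congr pair; lra. Qed.
Lemma CQ_mp (u v : CQ) : CQ_dom v -> u = CQ_one -> imp u v = CQ_one -> v = CQ_one.
Proof.
rewrite /CQ_one => + ->; case: v => [[] g]; chang_cases => //= ? H;
  have := congr1 fst H; have := congr1 snd H => //= ? _; congr pair; lra.
Qed.

(** The axiom D_p with an arbitrary candidate d for the p-th part of x, in any signature: it also
    states that a division is definable by a term. *)
Definition Dterm E V (p : nat) (d x : term E V) : term E V :=
  (((nmul p d && ~~ nmul 2 (d ^ 2)) || d ^ p) <==> x)%MV.

Lemma iterop_morph A B (h : A -> B) (op : A -> A -> A) (op' : B -> B -> B) k x z :
  (forall a b, h (op a b) = op' (h a) (h b)) ->
  h (iterop k op x z) = iterop k op' (h x) (h z).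
Proof.
by move=> hop; case: k => // k; rewrite !iteropS; elim: k => //= k <-.
Qed.

Lemma subst_nmul E V W (s : V -> term E W) k t :
  subst s (nmul k t) = nmul k (subst s t).
Proof. exact: iterop_morph. Qed.

Lemma subst_power E V W (s : V -> term E W) k t :
  subst s (t ^ k)%MV = (subst s t ^ k)%MV.
Proof. exact: iterop_morph. Qed.

Lemma subst_Dterm E V W (s : V -> term E W) p d x :
  subst s (Dterm p d x) = Dterm p (subst s d) (subst s x).
Proof. by rewrite /Dterm /Iff /And /Or /= subst_nmul !subst_power. Qed.

Lemma translate_nmul E1 E2 (T : translation E1 E2) V k (t : term E1 V) :
  translate T (nmul k t) = nmul k (translate T t).
Proof. exact: iterop_morph. Qed.

Lemma translate_power E1 E2 (T : translation E1 E2) V k (t : term E1 V) :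
  translate T (t ^ k)%MV = (translate T t ^ k)%MV.
Proof. exact: iterop_morph. Qed.

Lemma translate_Dterm E1 E2 (T : translation E1 E2) V p (d x : term E1 V) :
  translate T (Dterm p d x) = Dterm p (translate T d) (translate T x).
Proof. by rewrite /Dterm /Iff /And /Or /= translate_nmul !translate_power. Qed.

Section ExtEval.
Variables (E : signature) (I : forall f : symb E, ('I_(arity f) -> CQ) -> CQ).
Hypothesis Idom : forall f a, (forall i, CQ_dom (a i)) -> CQ_dom (I (f := f) a).
Variable V : Type.
Implicit Types (w : V -> CQ_ext I) (s t : term E V).

Lemma CQ_ext_dom w t : (forall v, CQ_dom (w v)) -> CQ_dom (eval w t).
Proof.
move=> wD; elim: t => [v||t h|t1 h1 t2 h2|f a h].
- exact: wD.
- exact: lexx.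
- exact: h.
- exact: chang_plus_CQ_dom.
- exact: Idom.
Qed.

Lemma eval_Iff w s t : (forall v, CQ_dom (w v)) ->
  eval w (s <==> t)%MV = CQ_one <-> eval w s = eval w t.
Proof. by move=> wD; apply: chang_iff1; exact: CQ_ext_dom. Qed.

Lemma eval_Plus w s t : eval w (s + t)%MV = plus (eval w s) (eval w t).
Proof. by []. Qed.

Lemma eval_Star w s t :
  eval w (s * t)%MV = neg (plus (neg (eval w s)) (neg (eval w t))).
Proof. by []. Qed.

Lemma eval_Or w s t :
  eval w (s || t)%MV = plus (neg (plus (neg (eval w s)) (eval w t))) (eval w t).
Proof. by []. Qed.

Lemma eval_And w s t : eval w (s && t)%MV =
  neg (plus (neg (plus (neg (neg (eval w s))) (neg (eval w t)))) (neg (eval w t))).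
Proof. by []. Qed.

Lemma eval_nmul_inf w t g k :
  eval w t = (false, g) -> eval w (nmul k t) = (false, k%:R * g).
Proof.
move=> tg; case: k => [|k]; first by rewrite mul0r.
rewrite /nmul iteropS; elim: k => [|k IH]; first by rewrite /= mul1r.
rewrite iterS eval_Plus IH tg /=; congr pair; rewrite /= [in RHS]mulrSr; ring.
Qed.

Lemma eval_nmul_coinf w t g k : (1 < k)%N ->
  eval w t = (true, g) -> eval w (nmul k t) = (true, 0).
Proof.
case: k => [|[|k]] // _ tg.
rewrite /nmul iteropS; elim: k => [|k IH]; rewrite iterS eval_Plus tg //.
by rewrite IH.
Qed.

Lemma eval_power_coinf w t g k :
  eval w t = (true, g) -> eval w (t ^ k)%MV = (true, k%:R * g).
Proof.
move=> tg; case: k => [|k]; first by rewrite /= mul0r.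
rewrite /power iteropS; elim: k => [|k IH]; first by rewrite /= mul1r.
rewrite iterS eval_Star tg IH /=; congr pair; rewrite /= [in RHS]mulrSr; ring.
Qed.

Lemma eval_power_inf w t g k : (1 < k)%N ->
  eval w t = (false, g) -> eval w (t ^ k)%MV = (false, 0).
Proof.
case: k => [|[|k]] // _ tg.
rewrite /power iteropS; elim: k => [|k IH]; rewrite iterS eval_Star tg //.
by rewrite IH.
Qed.

(** The left side of D_p multiplies the infinitesimal part of d by p and keeps its Boolean part: the
    negation of 2d^2 is 1 for infinitesimal d and 0 otherwise, so it selects between pd and d^p. *)
Lemma eval_Dterm w p d x : (1 < p)%N -> (forall v, CQ_dom (w v)) ->
  eval w (Dterm p d x) = CQ_one <->
  eval w d = ((eval w x).1, (eval w x).2 / p%:R).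
Proof.
move=> p1 wD; rewrite eval_Iff //.
have p0 : p%:R != 0 :> rat by rewrite pnatr_eq0; case: p p1.
have pge0 : 0 <= p%:R :> rat by exact: ler0n.
set l := eval w _.
suff -> : l = ((eval w d).1, p%:R * (eval w d).2).
  case: (eval w x) (eval w d) => [bx gx] [bd gd] /=; split=> -[-> h]; congr pair.
    by rewrite -h mulrC mulKf.
  by rewrite h mulrC divfK.
have dD := CQ_ext_dom d wD; have dD2 := CQ_ext_dom (nmul 2 (d ^ 2))%MV wD.
have dDp := CQ_ext_dom (d ^ p)%MV wD; have dDn := CQ_ext_dom (nmul p d) wD.
rewrite /l eval_Or chang_orE //; last exact: CQ_ext_dom.
rewrite eval_And chang_andE // -[eval w (~~ _)%MV]/(neg (eval w (nmul 2 (d ^ 2))%MV)).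
case E1 : (eval w d) dD => [[] g] dg.
  rewrite (eval_nmul_coinf p1 E1) (eval_power_coinf p E1).
  rewrite (eval_nmul_coinf (isT : (1 < 2)%N) (eval_power_coinf 2 E1)) //=.
rewrite (eval_nmul_inf p E1) (eval_power_inf p1 E1).
rewrite (eval_nmul_inf 2 (eval_power_inf (isT : (1 < 2)%N) E1)) /= /chang_neg /=.
by congr pair; rewrite max_l // mulr_ge0.
Qed.

End ExtEval.

Local Notation semCQ := (@sem mv CQ CQ_dom CQ_one).

Lemma CQ_eval_dom V (w : V -> CQ) (t : term mv V) :
  (forall v, CQ_dom (w v)) -> CQ_dom (eval w t).
Proof. exact: chang_eval_dom. Qed.

Lemma semCQ_logic : is_logic semCQ.
Proof. by apply: sem_logic => w t; exact: CQ_eval_dom. Qed.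

Lemma CQ_perfect (u : CQ) : CQ_dom u ->
  let s := chang_neg (chang_plus (chang_neg u) (chang_neg u)) in
  chang_plus s s =
  chang_neg (chang_plus (chang_neg (chang_plus u u)) (chang_neg (chang_plus u u))).
Proof.
by case: u => [[] g] //=; rewrite /chang_neg /= /rat_cB; rewrite /CQ_dom /chang_dom /=.
Qed.

Lemma lukasiewicz_sound G phi : lukasiewicz G phi -> semCQ G phi.
Proof.
apply: least_logic_min; first exact: semCQ_logic.
split; try by (apply/sem_thm => w wD;
  have [] := CQ_luk (CQ_eval_dom (Var 0%N) wD) (CQ_eval_dom (Var 1%N) wD)
                    (CQ_eval_dom (Var 2%N) wD)).
- apply/sem_thm => w wD.
  have [_ _ _ _ h] := CQ_luk (wD 0%N) (wD 1%N) (wD 0%N).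
  rewrite -[LHS]/(imp (plus (w 0%N) (w 1%N)) (plus (neg (neg (w 0%N))) (w 1%N))) h.
  apply: CQ_imp_refl; exact: chang_plus_CQ_dom.
- apply/sem_thm => w wD.
  have [_ _ _ _ h] := CQ_luk (wD 0%N) (wD 1%N) (wD 0%N).
  rewrite -[LHS]/(imp (plus (neg (neg (w 0%N))) (w 1%N)) (plus (w 0%N) (w 1%N))) h.
  apply: CQ_imp_refl; exact: chang_plus_CQ_dom.
- apply/sem_finite; first by rewrite finite_setU; split; exact: finite_set1.
  move=> w wD h; apply: (CQ_mp (wD 1%N)); first exact: (h _ (or_introl erefl)).
  exact: (h _ (or_intror erefl)).
Qed.

Lemma LP_sound G phi : LP G phi -> semCQ G phi.
Proof.
apply: least_logic_min; first exact: semCQ_logic.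
split; first exact: lukasiewicz_sound.
apply/sem_thm => w wD.
set l := nmul 2 (Var 0%N ^ 2)%MV; set r := (nmul 2 (Var 0%N) ^ 2)%MV.
apply/(chang_iff1 (CQ_eval_dom l wD) (CQ_eval_dom r wD)).
exact: CQ_perfect.
Qed.

Section Division.
Variable S : set prime_number.

Definition divI (p : symb (sigS S)) (a : 'I_(arity p) -> CQ) : CQ :=
  ((a ord0).1, (a ord0).2 / (sval (sval p))%:R).

Definition CQS : algebra (sigS S) := CQ_ext divI.

Lemma divI_dom p a : (forall i, CQ_dom (a i)) -> CQ_dom (@divI p a).
Proof.
by move=> aD; rewrite /CQ_dom /chang_dom /=; apply: divr_ge0; [exact: aD|].
Qed.

Definition semS := @sem (sigS S) CQS CQ_dom CQ_one.

Lemma CQS_dom V (w : V -> CQS) (t : term (sigS S) V) :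
  (forall v, CQ_dom (w v)) -> CQ_dom (eval w t).
Proof. by apply: CQ_ext_dom => p a; exact: divI_dom. Qed.

Lemma semS_logic : is_logic semS.
Proof. by apply: sem_logic => w t; exact: CQS_dom. Qed.

Lemma sem_mv_incl E (I : forall f : symb E, ('I_(arity f) -> CQ) -> CQ) G phi :
  semCQ G phi ->
  @sem E (CQ_ext I) CQ_dom CQ_one (translate (mv_incl E) @` G)
    (translate (mv_incl E) phi).
Proof.
move=> [F [finF FG h]]; exists (translate (mv_incl E) @` F).
split; [exact: finite_image|exact: image_subset|] => w wD hF.
rewrite eval_mv_incl; apply: h => // psi Fpsi.
by have := hF _ (ex_intro2 _ _ psi Fpsi erefl); rewrite eval_mv_incl.
Qed.

Lemma LPS_spec : is_logic (LPS S) /\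
  (morphism (mv_incl (sigS S)) LP (LPS S) /\ forall p, LPS S set0 (axD p)).
Proof.
apply: least_logicP; apply: finitary_and.
  exact: finitary_morphism LP_logic.
by apply: finitary_forall => p; exact: finitary_thm.
Qed.

Lemma LPS_logic : is_logic (LPS S). Proof. by case: LPS_spec. Qed.

Lemma axDE p : @axD S p = Dterm (sval (sval p)) (div_op p (Var 0%N)) (Var 0%N).
Proof. by []. Qed.

Lemma LPS_LP : morphism (mv_incl (sigS S)) LP (LPS S).
Proof. by case: LPS_spec => _ []. Qed.

Lemma prime_number_gt1 (p : prime_number) : (1 < sval p)%N.
Proof. by case: p => p pp; exact: prime_gt1 pp. Qed.

Lemma eval_axD (p : {p | S p}) V (w : V -> CQS) (d x : term (sigS S) V) :
  (forall v, CQ_dom (w v)) ->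
  eval w (Dterm (sval (sval p)) d x) = CQ_one <->
  eval w d = ((eval w x).1, (eval w x).2 / (sval (sval p))%:R).
Proof. by apply: eval_Dterm => [q a|]; [exact: divI_dom|exact: prime_number_gt1]. Qed.

Lemma LPS_sound G phi : LPS S G phi -> semS G phi.
Proof.
apply: least_logic_min; first exact: semS_logic.
split=> [H psi h|p]; first exact: sem_mv_incl (LP_sound h).
by apply/sem_thm => w wD; apply/(eval_axD p) => //.
Qed.

(** * Elimination of the division symbols *)

Section Flatten.
Variable s : seq (formula (sigS S)).

Let idx (t : formula (sigS S)) : nat := index (t : {classic _}) s.

(** Each outermost application of a division, and each variable, becomes the variable numbered by
    its position in s. The meaning of the divisions is lost here and restored by additional
    premises. *)
Fixpoint flat (t : formula (sigS S)) : formula mv :=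
  match t with
  | Var i => Var (idx (Var i))
  | Zero => Zero
  | Neg t1 => Neg (flat t1)
  | Plus t1 t2 => Plus (flat t1) (flat t2)
  | App f a => Var (idx (App f a))
  end.

Definition unflat (i : nat) : formula (sigS S) := nth Zero s i.

Fixpoint atoms (t : formula (sigS S)) : seq (formula (sigS S)) :=
  match t with
  | Var i => [:: Var i]
  | Zero => [::]
  | Neg t1 => atoms t1
  | Plus t1 t2 => atoms t1 ++ atoms t2
  | App f a => App f a :: atoms (a ord0)
  end.

Let nth_idx t : List.In t s -> unflat (idx t) = t.
Proof.
move=> ts; apply: (@nth_index {classic _} Zero t s).
elim: (s) ts => //= u s' IH [->|/IH]; rewrite inE ?eqxx // => ->.
by rewrite orbT.
Qed.

Lemma flatK t : (forall u, List.In u (atoms t) -> List.In u s) ->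
  subst unflat (translate (mv_incl (sigS S)) (flat t)) = t.
Proof.
elim: t => //= [i|t IH|t1 IH1 t2 IH2|f a _] h.
- by apply: nth_idx; apply: h; left.
- by rewrite IH.
- by rewrite IH1 ?IH2 // => u hu; apply: h; apply/List.in_app_iff; auto.
- by apply: nth_idx; apply: h; left.
Qed.

Lemma eval_flat (v : nat -> CQ) (w : nat -> CQS) t :
  (forall i, w i = v (idx (Var i))) ->
  (forall p a, List.In (App p a) s ->
     v (idx (App p a)) = ((eval v (flat (a ord0))).1,
                 (eval v (flat (a ord0))).2 / (sval (sval p))%:R)) ->
  (forall u, List.In u (atoms t) -> List.In u s) ->
  eval w t = eval v (flat t).
Proof.
move=> wv hv; elim: t => //= [t IH|t1 IH1 t2 IH2|f a IH] h.
- by rewrite IH.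
- by rewrite IH1 ?IH2 // => u hu; apply: h; apply/List.in_app_iff; auto.
- rewrite hv; last by apply: h; left.
  by rewrite /divI -IH // => u hu; apply: h; right.
Qed.

End Flatten.

Lemma atoms_trans t u v :
  List.In u (atoms t) -> List.In v (atoms u) -> List.In v (atoms t).
Proof.
elim: t => //= [i|t1 IH1 t2 IH2|f a IH].
- by move=> [<-|[]].
- by move=> /List.in_app_iff[/IH1|/IH2] h /h ?; apply/List.in_app_iff; auto.
- by move=> [<- //|/IH h /h]; right.
Qed.

(** With the applications replaced by variables, and with the equations D_p between these variables
    as further premises, the rule is one of LP. Substituting the applications back turns the further
    premises into instances of axioms. *)
Lemma LPS_complete G phi : finite_set G ->
  (forall w : nat -> CQS, (forall i, CQ_dom (w i)) ->
     (forall psi, G psi -> eval w psi = CQ_one) -> eval w phi = CQ_one) ->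
  LPS S G phi.
Proof.
move=> finG hG; have [r rG] := seq_of_finite finG.
have [hL [LPL axL]] := LPS_spec.
pose s := List.flat_map atoms (phi :: r).
have sphi u : List.In u (atoms phi) -> List.In u s.
  by move=> hu; apply/List.in_flat_map; exists phi; split=> //; left.
have sG psi u : G psi -> List.In u (atoms psi) -> List.In u s.
  by move=> /rG hpsi hu; apply/List.in_flat_map; exists psi; split=> //; right.
have sapp p a u : List.In (App p a) s -> List.In u (atoms (a ord0)) -> List.In u s.
  move=> /List.in_flat_map[t [ht hpa]] hu; apply/List.in_flat_map; exists t.
  by split=> //; apply: atoms_trans hpa _; right.
pose f := flat s.
(* An application contributes the equation that its variable must satisfy, any other atom the
   theorem [One]. *)
pose D (t : formula (sigS S)) : formula mv :=
  if t is App p a then Dterm (sval (sval p)) (f (App p a)) (f (a ord0)) else One.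
pose H := f @` G `|` [set D t | t in [set t | List.In t s]].
have finH : finite_set H.
  rewrite finite_setU; split; apply: finite_image => //.
  by elim: (s) => [|t s' IH]; [exact: finite_set0|
    rewrite (_ : [set _ | _] = t |` [set u | List.In u s']) ?finite_setU;
    [split=> //; exact: finite_set1|apply/seteqP; split=> u /= []; auto]].
have /LPL /(logic_struct hL (unflat s)) : LP H (f phi).
  apply: LP_complete => // v vD hv.
  have appE p a : List.In (App p a) s ->
     v (index (App p a : {classic _}) s) = ((eval v (f (a ord0))).1,
                 (eval v (f (a ord0))).2 / (sval (sval p))%:R).
    move=> pas; have : eval v (D (App p a)) = CQ_one.
      by apply: hv; right; exists (App p a).
    by move/(@eval_Dterm mv _ _ _ _ _ _ _); apply=> //; exact: prime_number_gt1.
  pose w i := v (index (Var i : {classic formula (sigS S)}) s) : CQS.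
  have wE t (ht : forall u, List.In u (atoms t) -> List.In u s) :
      eval w t = eval v (f t) by exact: eval_flat.
  rewrite -wE //; apply: hG => [i|psi Gpsi]; first exact: vD.
  by rewrite wE => [|u]; [apply: hv; left; exists psi|exact: sG].
rewrite flatK // => /(logic_cut hL); apply => _ [_ [_ [[psi Gpsi <-]|[t ts <-]] <-] <-].
  by rewrite flatK => [|u]; [exact: (logic_refl hL)|exact: sG].
have L1 : LPS S set0 One.
  by have := LPL set0 One; rewrite image_set0; apply; exact: LP_complete.
have DE p a : D (App p a) = Dterm (sval (sval p)) (f (App p a)) (f (a ord0)).
  by [].
case: t ts => [i||?|? ?|p a] ts; try exact: (logic_thm hL _ L1).
apply: (logic_thm hL); rewrite DE translate_Dterm subst_Dterm !flatK /=; last 2 first.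
- by move=> u hu; exact: sapp ts hu.
- by move=> u [<- //|hu]; exact: sapp ts hu.
rewrite (_ : Dterm _ _ _ = subst (fun=> a ord0) (axD p)).
  exact: (logic_struct0 hL).
rewrite axDE.
rewrite subst_Dterm /=; congr (Dterm _ (App _ _) _).
by apply/funext => i; rewrite ord1.
Qed.

Lemma LPS_iff G phi : LPS S G phi <-> semS G phi.
Proof.
split=> [|[F [finF FG h]]]; first exact: LPS_sound.
by apply: (logic_weaken LPS_logic FG); exact: LPS_complete.
Qed.

End Division.

Theorem LPS_conservative (S S' : set prime_number) (SS' : S `<=` S') :
  conservative (sigS_incl SS') (LPS S) (LPS S').
Proof.
have evalI (w : nat -> CQ) t :
    eval (w : nat -> CQS S') (translate (sigS_incl SS') t) =
    eval (w : nat -> CQS S) t.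
  by rewrite eval_translate.
split=> G phi.
  move=> /LPS_iff[F [finF FG h]]; apply/LPS_iff.
  exists (translate (sigS_incl SS') @` F).
  split; [exact: finite_image|exact: image_subset|] => w wD hF.
  rewrite evalI; apply: h => // psi Fpsi; rewrite -evalI.
  by apply: hF; exists psi.
move=> /LPS_iff[F [finF FG h]]; apply/LPS_iff.
have [B [finB BG BF]] := image_lift_finite finF FG.
exists B; split=> // w wD hB; rewrite -evalI; apply: h => // psi.
by rewrite -BF => -[chi Bchi <-]; rewrite evalI; exact: hB.
Qed.

End ChangComputations.

(** * Piecewise linear functions *)

Section Crossing.

Definition aff (f : rat * rat) s := f.1 + f.2 * s.
Definition asat (c : seq (rat * rat)) s := all (fun f => 0 <= aff f s) c.

Lemma aff_convex f a b s : a <= s <= b -> 0 <= aff f a -> 0 <= aff f b ->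
  0 <= aff f s.
Proof.
rewrite /aff => /andP[as_ sb] fa fb.
have [f0|f0] := leP 0 f.2.
  by have := ler_wpM2l f0 as_; lra.
by have := ler_wnM2l (ltW f0) sb; lra.
Qed.

Lemma asat_convex c a b s : a <= s <= b -> asat c a -> asat c b -> asat c s.
Proof.
move=> asb; elim: c => //= f c IH /andP[fa ca] /andP[fb cb].
by rewrite (aff_convex asb) // IH.
Qed.

(** The solutions form a closed interval. Its right end is rational, being the least zero of the
    forms that fail at b. *)
Lemma last_point c a b : a <= b -> asat c a -> ~~ asat c b ->
  exists m, [/\ a <= m, m < b, asat c m & forall s, m < s <= b -> ~~ asat c s].
Proof.
move=> ab; elim: c => //= f c IH /andP[fa ca].
have [fb|fb] /= := leP 0 (aff f b).
  move=> /(IH ca)[m [am mb cm hm]]; exists m; split=> //.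
    by rewrite cm (@aff_convex _ a b) // am ltW.
  by move=> s /hm /negPf ->; rewrite andbF.
move=> _; have f2 : f.2 < 0.
  rewrite ltNge; apply/negP => f2; move: fa fb; rewrite /aff => fa fb.
  by have := ler_wpM2l f2 ab; lra.
pose r := - f.1 / f.2.
have affE s : aff f s = f.2 * (s - r) by rewrite /aff /r; field; rewrite lt_eqF.
have posr s : (0 <= aff f s) = (s <= r).
  by rewrite affE nmulr_rge0 // subr_le0.
have ar : a <= r by rewrite -posr.
have rb : r < b by rewrite ltNge -posr -ltNge.
have [cb|/(IH ca)[m [am mb cm hm]]] := boolP (asat c b).
  exists r; split=> //.
    by rewrite posr lexx (@asat_convex _ a b) // ar ltW.
  by move=> s /andP[rs _]; rewrite posr leNgt rs.
have [rm|mr] := leP r m.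
  exists r; split=> //.
    by rewrite posr lexx (@asat_convex _ a m) // ar.
  by move=> s /andP[rs _]; rewrite posr leNgt rs.
exists m; split=> //; first by rewrite posr ltW.
by move=> s /hm /negPf ->; rewrite andbF.
Qed.

Lemma aff_fail_right f s : aff f s < 0 ->
  exists2 e, 0 < e & forall s', s <= s' <= s + e -> aff f s' < 0.
Proof.
(* Over a length e the form grows by at most (|f.2| + 1) e, which is half of its deficit at s; the
   added 1 keeps the denominator positive for constant forms. *)
move=> fs; exists (- aff f s / (`|f.2| + 1) / 2).
  by rewrite !divr_gt0 ?oppr_gt0 // ltr_wpDl.
move=> s' /andP[ss' s'e].
have -> : aff f s' = aff f s + f.2 * (s' - s) by rewrite /aff; ring.
have n0 : 0 < `|f.2| + 1 by rewrite ltr_wpDl.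
have h : f.2 * (s' - s) <= (`|f.2| + 1) * (- aff f s / (`|f.2| + 1) / 2).
  have d0 : 0 <= s' - s by rewrite subr_ge0.
  apply: le_trans (ler_wpM2r d0 (ler_norm _)) _.
  by apply: ler_pM; rewrite ?lerDl // lerBlDl.
move: h; rewrite [X in _ <= X](_ : _ = - aff f s / 2); last first.
  by field; rewrite gt_eqF.
by lra.
Qed.

Lemma asat_fail_right c s : ~~ asat c s ->
  exists2 e, 0 < e & forall s', s <= s' <= s + e -> ~~ asat c s'.
Proof.
rewrite -has_predC => /(has_nthP (0, 0))[i ic /=]; rewrite -ltNge.
move=> /aff_fail_right[e e0 he]; exists e => // s' /he fs'.
rewrite -has_predC; apply/(has_nthP (0, 0)); exists i => //=.
by rewrite -ltNge.
Qed.

Lemma seq_fail_right I (c : I -> seq (rat * rat)) (l : seq I) s :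
  (forall i, List.In i l -> ~~ asat (c i) s) ->
  exists2 e, 0 < e & forall i s', List.In i l -> s <= s' <= s + e ->
    ~~ asat (c i) s'.
Proof.
elim: l => [|i l IH] h; first by exists 1.
have [e e0 he] := IH (fun j hj => h j (or_intror hj)).
have [d d0 hd] := asat_fail_right (h i (or_introl erefl)).
exists (Num.min d e); first by rewrite lt_min d0.
move=> j s' [<-|hj] /andP[ss' s'e].
  by apply: hd; rewrite ss'; apply: le_trans s'e _; rewrite lerD2l ge_min lexx.
by apply: he => //; rewrite ss'; apply: le_trans s'e _; rewrite lerD2l ge_min lexx orbT.
Qed.

(* Leave the piece i of a at its last point p.  If the line of i is above G b at
   b, the line found by induction on [p, b] is above that of i at p and below it
   at b, hence above it at a. *)
Lemma crossing I (c : I -> seq (rat * rat)) (m : I -> rat * rat) G (l : seq I) a b :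
  a <= b ->
  (forall s, a <= s <= b -> exists2 i, List.In i l & asat (c i) s) ->
  (forall i s, List.In i l -> a <= s <= b -> asat (c i) s -> aff (m i) s = G s) ->
  exists i, [/\ List.In i l, G a <= aff (m i) a & aff (m i) b <= G b].
Proof.
have [k] := ubnP (size l); elim: k l a => // k IH l a lk ab cover agree.
have aa : a <= a <= b by rewrite lexx.
have bb : a <= b <= b by rewrite lexx andbT.
have [i il ia] := cover a aa.
have [ib|ib] := boolP (asat (c i) b).
  by exists i; split=> //; rewrite agree.
have [p [ap pb ip hp]] := last_point ab ia ib.
have [l1 [l2 lE]] := List.in_split _ _ il.
pose l' := l1 ++ l2.
have l'l j : List.In j l' -> List.In j l.
  by rewrite lE => /List.in_app_iff h; apply/List.in_app_iff; case: h => h;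
    [left|right; right].
have ll' j : List.In j l -> j = i \/ List.In j l'.
  rewrite lE => /List.in_app_iff[h|[h|h]]; [right|left|right] => //;
    apply/List.in_app_iff; auto.
have cover' s : p < s <= b -> exists2 j, List.In j l' & asat (c j) s.
  move=> /[dup] /hp ns /andP[ps sb].
  have [|j jl js] := cover s; first by rewrite sb (le_trans ap) // ltW.
  by exists j => //; have [ji|//] := ll' j jl; rewrite ji (negPf ns) in js.
(* If every other piece missed p, it would miss a short interval to the right of p as well, contrary
   to [cover']. *)
have coverp : exists2 j, List.In j l' & asat (c j) p.
  apply: contrapT => np.
  have [|e e0 he] := @seq_fail_right _ c l' p.
    by move=> j jl; apply/negP => jp; apply: np; exists j.
  pose s := Num.min (p + e) b.
  have ps : p < s <= b by rewrite /s lt_min ge_min pb lexx orbT ltrDl e0.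
  have [j jl] := cover' s ps; apply/negP; apply: he => //.
  by case/andP: ps => /ltW -> _; rewrite /s ge_min lexx.
have [||s|j s jl' /andP[ps sb]|j [jl jp jb]] := IH l' p.
- by move: lk; rewrite lE !size_cat /= addnS.
- exact: ltW.
- move=> /andP[]; rewrite le_eqVlt => /orP[/eqP <- //|ps sb].
  by apply: cover'; rewrite ps.
- by apply: agree; [exact: l'l|rewrite (le_trans ap ps)].
have [mb|mb] := leP (aff (m i) b) (G b).
  by exists i; split=> //; rewrite agree.
exists j; split=> //; first exact: l'l.
have pE : aff (m i) p = G p by apply: agree => //; rewrite ap ltW.
rewrite -(agree i a) //; move: jp jb mb; rewrite -pE /aff => jp jb mb.
have d0 : (m j).2 - (m i).2 < 0.
  rewrite ltNge; apply/negP => d0.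
  by have := ler_wpM2l d0 (ltW pb); lra.
by have := ler_wnM2l (ltW d0) ap; lra.
Qed.

End Crossing.

(** * Finite convex covers of cubes *)

Section Cubes.

Definition upd (u : nat -> rat) n t : nat -> rat :=
  fun i => if i == n then t else u i.

Definition cube n (v : nat -> rat) d (u : nat -> rat) : Prop :=
  (forall i, (i < n)%N -> v i <= u i <= v i + d) /\
  (forall i, (n <= i)%N -> u i = v i).

Lemma cube_refl n v d : 0 <= d -> cube n v d v.
Proof. by move=> d0; split=> // i _; rewrite lexx lerDl. Qed.

Lemma cube_updK n v d u t : cube n (upd v n t) d u ->
  u n = t /\ cube n v d (upd u n (v n)).
Proof.
move=> [h1 h2]; split; first by rewrite h2 // /upd eqxx.
split=> i ni; rewrite /upd; first by have := h1 i ni; rewrite /upd ltn_eqF.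
by case: eqP => [->//|/eqP/negPf e]; rewrite h2 // /upd e.
Qed.

Lemma updE u n t : upd u n t n = t.
Proof. by rewrite /upd eqxx. Qed.

Lemma updK u n t t' : upd (upd u n t) n t' = upd u n t'.
Proof. by apply/funext => i; rewrite /upd; case: eqP. Qed.

Lemma updid u n t : u n = t -> upd u n t = u.
Proof. by move=> un; apply/funext => i; rewrite /upd; case: eqP => // ->. Qed.

Variable K : nat.

Definition convex (X : (nat -> rat) -> Prop) : Prop :=
  forall x y t, 0 <= t <= 1 -> X x -> X y -> X (fun i => x i + t * (y i - x i)).

(* Apply the statement to nested slices at K + 1 heights: two of the slices lie
   in the same convex set. *)
Lemma cube_lemma n (X : 'I_K -> (nat -> rat) -> Prop) v d :
  (forall k, convex (X k)) -> 0 < d ->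
  (forall u, cube n v d u -> exists k, X k u) ->
  exists k v' d', 0 < d' /\ forall u, cube n v' d' u -> cube n v d u /\ X k u.
Proof.
move=> cX; elim: n v d => [|n IH] v d d0 cover.
  have [|k Xv] := cover v; first by apply: cube_refl; exact: ltW.
  exists k, v, d; split=> // u hu; split=> //.
  by rewrite (_ : u = v) //; apply/funext => i; rewrite hu.2.
(* The heights are distinct points of the edge in direction n. *)
pose t j : rat := v n + d / j.+1%:R.
have tP j : v n <= t j <= v n + d.
  rewrite /t lerDl lerD2l; apply/andP; split.
    by rewrite divr_ge0 // ltW.
  by rewrite ler_pdivrMr ?ltr0n // ler_peMr ?ler1n // ltW.
have t_anti i j : (i < j)%N -> t j < t i.
  move=> ij; rewrite /t ltrD2l ltr_pM2l // ltf_pV2 ?posrE ?ltr0n //.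
  by rewrite ltr_nat.
(* For the first M heights, an n-dimensional base cube is shrunk until its copy at each of them lies
   in a single convex set. *)
have nested M : exists (f : nat -> 'I_K) v' d', [/\ 0 < d',
    forall u, cube n v' d' u -> cube n v d u &
    forall j u, (j < M)%N -> cube n v' d' u -> X (f j) (upd u n (t j))].
  elim: M => [|M [f [v' [d' [d'0 sub hf]]]]].
    have [k _] := cover v (cube_refl _ _ (ltW d0)).
    by exists (fun=> k), v, d; split.
  have [||k [v'' [d'' [d''0 h]]]] := IH (upd v' n (t M)) d' => //.
    move=> u /cube_updK[un /sub [h1 h2]]; apply: cover; split=> i.
      rewrite ltnS leq_eqVlt => /orP[/eqP ->|ni]; first by rewrite un.
      by have := h1 i ni; rewrite /upd ltn_eqF.
    by move=> ni; have := h2 i (ltnW ni); rewrite /upd gtn_eqF.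
  have hupd u : cube n (upd v'' n (v' n)) d'' u -> cube n v' d' u /\ X k (upd u n (t M)).
    move=> /cube_updK[un /h[/cube_updK[]]]; rewrite updK updE => -> + Xk.
    by rewrite updid.
  exists (fun j => if j == M then k else f j), (upd v'' n (v' n)), d''; split=> //.
    by move=> u /hupd[/sub].
  move=> j u; rewrite ltnS leq_eqVlt => /orP[/eqP ->|jM] /hupd[hu Xk].
    by rewrite eqxx.
  by rewrite ltn_eqF //; exact: hf.
have [f [v' [d' [d'0 sub hf]]]] := nested K.+1.
have : ~ injective (fun j : 'I_K.+1 => f j).
  by move=> /leq_card; rewrite !card_ord ltnn.
move=> ninj.
have [j1 [j2 [j12 fE]]] : exists j1 j2 : 'I_K.+1, (j1 < j2)%N /\ f j1 = f j2.
  apply: contrapT => h; apply: ninj => i j fij; apply/val_inj/eqP.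
  by case: (ltngtP i j) => // ij; case: h; [exists i, j|exists j, i].
have tt := t_anti _ _ j12.
(* The side must fit into the base cube and between the two heights: each point of the new cube is
   then a convex combination of its projections to these heights. *)
pose e := Num.min d' (t j1 - t j2).
exists (f j1), (upd v' n (t j2)), e.
have ed' : e <= d' by rewrite /e ge_min lexx.
have et : e <= t j1 - t j2 by rewrite /e ge_min lexx orbT.
split=> [|u [h1 h2]]; first by rewrite lt_min d'0 subr_gt0.
have un := h1 n (ltnSn n); rewrite /upd eqxx in un.
have hu : cube n v' d' (upd u n (v' n)).
  split=> i ni; rewrite /upd.
    have := h1 i (ltnW ni); rewrite ltn_eqF // /upd ltn_eqF // => /andP[-> /= h].
    by apply: le_trans h _; rewrite lerD2l.
  case: eqP => [-> //|/eqP ne]; rewrite h2 /upd ?(negPf ne) //.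
  by rewrite ltn_neqAle eq_sym ne.
split.
  have [s1 s2] := sub _ hu; split=> i ni.
    move: ni; rewrite ltnS leq_eqVlt => /orP[/eqP ->|ni].
      have := tP j1; have := tP j2; lra.
    by have := s1 i ni; rewrite /upd ltn_eqF.
  by have := s2 i (ltnW ni); rewrite /upd gtn_eqF.
pose s := (u n - t j2) / (t j1 - t j2).
have tp : 0 < t j1 - t j2 by rewrite subr_gt0.
rewrite (_ : u = fun i => upd u n (t j2) i + s * (upd u n (t j1) i - upd u n (t j2) i)).
  apply: cX.
  - apply/andP; split; first by apply: divr_ge0; lra.
    by rewrite ler_pdivrMr // mul1r; lra.
  - by rewrite fE -(updK u n (v' n)); apply: hf.
  - by rewrite -(updK u n (v' n)); apply: hf.
apply/funext => i; rewrite /upd; case: eqP => [->|_]; last by ring.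
by rewrite /s; field; rewrite gt_eqF.
Qed.

End Cubes.

Lemma In_mem (T : eqType) (x : T) s : List.In x s <-> x \in s.
Proof.
elim: s => //= y s IH; rewrite inE; split=> [[->|/IH ->]|/orP[/eqP ->|/IH]];
  rewrite ?eqxx ?orbT; auto.
Qed.

(** * Linear forms and the cones they define *)

Definition dot N (l w : nat -> rat) : rat := \sum_(i < N) l i * w i.

Definition sat N (P : seq (nat -> rat)) w := all (fun l => 0 <= dot N l w) P.

Lemma dotD N l w w' : dot N l (fun i => w i + w' i) = dot N l w + dot N l w'.
Proof. by rewrite /dot -big_split; apply: eq_bigr => i _ /=; rewrite mulrDr. Qed.

Lemma dotZ N l c w : dot N l (fun i => c * w i) = c * dot N l w.
Proof. by rewrite /dot mulr_sumr; apply: eq_bigr => i _ /=; ring. Qed.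

Lemma eq_dot N l w w' : (forall i, (i < N)%N -> w i = w' i) ->
  dot N l w = dot N l w'.
Proof. by move=> h; apply: eq_bigr => i _; rewrite h. Qed.

Lemma eq_sat N P w w' : (forall i, (i < N)%N -> w i = w' i) ->
  sat N P w = sat N P w'.
Proof. by move=> h; apply: eq_all => l; rewrite (eq_dot _ h). Qed.

Lemma satD N P w w' : sat N P w -> sat N P w' -> sat N P (fun i => w i + w' i).
Proof.
elim: P => //= l P IH /andP[lw Pw] /andP[lw' Pw'].
by rewrite dotD addr_ge0 // IH.
Qed.

Lemma satZ N P c w : 0 <= c -> sat N P w -> sat N P (fun i => c * w i).
Proof.
by move=> c0; elim: P => //= l P IH /andP[lw Pw]; rewrite dotZ mulr_ge0 // IH.
Qed.

Lemma common_denominator n (u : nat -> rat) : (forall i, (i < n)%N -> 0 <= u i) ->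
  exists (M : nat) (f : nat -> nat), (0 < M)%N /\
    forall i, (i < n)%N -> M%:R * u i = (f i)%:R.
Proof.
elim: n => [|n IH] u0; first by exists 1%N, id.
have [|M [f [M0 hf]]] := IH; first by move=> i /ltnW; exact: u0.
have [a [b [b0 ab]]] : exists a b : nat, (0 < b)%N /\ b%:R * u n = a%:R.
  exists `|numq (u n)|%N, `|denq (u n)|%N; rewrite absz_gt0 denq_neq0; split=> //.
  have := u0 n (ltnSn n); rewrite -numq_ge0 => n0.
  by rewrite !natr_absz !ger0_norm ?denq_ge0 // numqE mulrC.
exists (M * b)%N, (fun i => if i == n then M * a else b * f i)%N.
rewrite muln_gt0 M0 b0; split=> // i; rewrite ltnS leq_eqVlt.
move=> /orP[/eqP ->|ni]; first by rewrite eqxx !natrM -mulrA ab.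
by rewrite ltn_eqF // !natrM -hf //; ring.
Qed.

(** * Linear pieces of an implicitly defined function *)

Section PiecewiseLinear.
Variables n N K : nat.
Variables (P : 'I_K -> seq (nat -> rat)) (H : (nat -> rat) -> nat -> rat).

Definition nonneg (g : nat -> rat) : Prop := forall i, (i < n)%N -> 0 <= g i.

Hypothesis Hcover : forall g, nonneg g -> exists k, sat N (P k) (H g).
Hypothesis Hid : forall g i, nonneg g -> (i < n)%N -> H g i = g i.
Hypothesis Huniq : forall k g w, nonneg g -> (forall i, (i < n)%N -> w i = g i) ->
  sat N (P k) w -> forall j, (j < N)%N -> w j = H g j.

Definition dom k g : Prop := nonneg g /\ sat N (P k) (H g).

Lemma dom_ext k g g' : (forall i, (i < n)%N -> g i = g' i) -> dom k g ->
  dom k g' /\ forall j, (j < N)%N -> H g j = H g' j.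
Proof.
move=> gg' [g0 sg]; have g'0 : nonneg g' by move=> i ni; rewrite -gg' // g0.
have e := Huniq g'0 _ sg.
have {}e : forall j, (j < N)%N -> H g j = H g' j.
  by apply: e => i ni; rewrite Hid // gg'.
by split=> //; split=> //; rewrite -(eq_sat _ e).
Qed.

(** The sum of [H g] and [H g'] satisfies the homogeneous system [P k] over g + g', where [Huniq]
    admits only the value of H. *)
Lemma domD k g g' : dom k g -> dom k g' ->
  dom k (fun i => g i + g' i) /\
  forall j, (j < N)%N -> H (fun i => g i + g' i) j = H g j + H g' j.
Proof.
move=> [g0 sg] [g'0 sg']; have s0 : nonneg (fun i => g i + g' i).
  by move=> i ni; rewrite addr_ge0 ?g0 ?g'0.
have e : forall j, (j < N)%N -> H g j + H g' j = H (fun i => g i + g' i) j.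
  by apply: Huniq s0 _ (satD sg sg') => i ni; rewrite !Hid.
by split=> [|j jN]; [split=> //; rewrite -(eq_sat _ e); exact: satD|rewrite e].
Qed.

Lemma domZ k c g : 0 <= c -> dom k g ->
  dom k (fun i => c * g i) /\
  forall j, (j < N)%N -> H (fun i => c * g i) j = c * H g j.
Proof.
move=> c0 [g0 sg]; have s0 : nonneg (fun i => c * g i).
  by move=> i ni; rewrite mulr_ge0 ?g0.
have e : forall j, (j < N)%N -> c * H g j = H (fun i => c * g i) j.
  by apply: Huniq s0 _ (satZ c0 sg) => i ni; rewrite !Hid.
by split=> [|j jN]; [split=> //; rewrite -(eq_sat _ e); exact: satZ|rewrite e].
Qed.

Lemma dom_convex k : convex (dom k).
Proof.
move=> x y t /andP[t0 t1] dx dy.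
have t1' : 0 <= 1 - t by rewrite subr_ge0.
rewrite (_ : (fun i => _) = fun i => (1 - t) * x i + t * y i).
  exact: (domD (domZ t1' dx).1 (domZ t0 dy).1).1.
by apply/funext => i; ring.
Qed.

Definition bump_at (u : nat -> rat) i : nat -> rat := fun j => u j + (j == i)%:R.

(** A witness that the convex cone [dom k] has full dimension: it contains the vertices u and u +
    e_i of a simplex. The slopes of H on the piece are differences of values at these points. *)
Definition corner k u : Prop :=
  dom k u /\ forall i, (i < n)%N -> dom k (bump_at u i).

Definition slope (u : nat -> rat) j i : rat := H (bump_at u i) j - H u j.

(* sum_i x_i (u + e_i) = (sum_i x_i) u + x is a relation in the cone dom k. *)
Lemma corner_linear k u x : corner k u -> dom k x ->
  forall j, (j < N)%N -> H x j = dot n (slope u j) x.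
Proof.
move=> [du dui] dx j jN.
pose y m l := \sum_(i < m) x i * bump_at u i l.
have dy m : (m <= n)%N -> dom k (y m) /\
    forall j, (j < N)%N -> H (y m) j = \sum_(i < m) x i * H (bump_at u i) j.
  elim: m => [|m IH] mn.
    have -> : y 0%N = fun i => 0 * u i.
      by apply/funext => l; rewrite /y big_ord0 mul0r.
    by have [d0 e0] := domZ (lexx 0) du; split=> // l lN;
      rewrite e0 // mul0r big_ord0.
  have [dm em] := IH (ltnW mn).
  have [d1 e1] := domZ (dx.1 m mn) (dui m mn).
  have [d2 e2] := domD dm d1.
  have yE : y m.+1 = fun l => y m l + x m * bump_at u m l.
    by apply/funext => l; rewrite /y big_ord_recr.
  rewrite yE; split=> // l lN.
  by rewrite e2 // em // e1 // big_ord_recr.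
have [dn en] := dy n (leqnn n).
pose s := \sum_(i < n) x i.
have s0 : 0 <= s by apply: sumr_ge0 => i _; exact: dx.1.
have [ds es] := domZ s0 du; have [da ea] := domD ds dx.
have [|_ eq] := @dom_ext k (y n) (fun i => s * u i + x i) _ dn.
  move=> l ln; rewrite /y /bump_at.
  under eq_bigr do rewrite mulrDr.
  rewrite big_split /= -mulr_suml; congr (_ + _).
  rewrite (bigD1 (Ordinal ln)) //= eqxx mulr1 big1 ?addr0 // => i.
  by rewrite -val_eqE /= eq_sym => /negPf ->; rewrite mulr0.
have := eq j jN; rewrite en // ea // es // => h.
rewrite /dot /slope; under eq_bigr do rewrite mulrBl mulrC.
by rewrite sumrB h -mulr_sumr -/s; ring.
Qed.

Lemma corner_id k u i j : corner k u -> (i < n)%N -> (j < n)%N ->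
  slope u j i = (j == i)%:R.
Proof.
move=> [[u0 _] h] ni nj; rewrite /slope !Hid //; first by rewrite /bump_at addrC addKr.
by case: (h i ni).
Qed.

(** The system [P k] pulled back along the linear map with which H agrees on [dom k]. *)
Definition closure_forms k u : seq (nat -> rat) :=
  [seq (fun i => \sum_(j < N) l j * slope u j i) | l : nat -> rat <- P k].

(** Conversely to linearity on the piece, if the linear formula satisfies [P k] at g, uniqueness
    identifies its values with [H g]. So a full-dimensional piece is cut out by linear inequalities
    in the arguments alone. *)
Lemma dom_closed k u g : corner k u -> nonneg g ->
  dom k g <-> sat n (closure_forms k u) g.
Proof.
move=> cu g0.
have -> : sat n (closure_forms k u) g = sat N (P k) (fun j => dot n (slope u j) g).
  rewrite /sat /closure_forms all_map; apply: eq_all => l /=; congr (_ <= _).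
  rewrite /dot; under eq_bigr do rewrite mulr_suml.
  rewrite exchange_big /=; apply: eq_bigr => j _; rewrite mulr_sumr.
  by apply: eq_bigr => i _; rewrite mulrA.
split=> [dg|sg].
  have e := corner_linear cu dg.
  by rewrite -(eq_sat _ e); case: dg.
split=> //; rewrite -(@eq_sat _ _ (fun j => dot n (slope u j) g)) //.
apply: Huniq sg => // j jn.
rewrite /dot (bigD1 (Ordinal jn)) //= (corner_id cu) // eqxx mul1r big1 ?addr0 //.
move=> i; rewrite -val_eqE /= (corner_id cu) // eq_sym => /negPf ->.
by rewrite mul0r.
Qed.

Lemma dom_open k g : nonneg g -> ~ dom k g -> (exists u, corner k u) ->
  exists2 e, 0 < e & forall u, cube n g e u -> ~ dom k u.
Proof.
move=> g0 ndg [v cv].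
have : ~~ sat n (closure_forms k v) g by apply/negP => /(dom_closed cv g0).
rewrite /sat -has_predC => /(has_nthP (fun=> 0))[i ic /=]; rewrite -ltNge.
set l := nth _ _ i => lg.
pose M := \sum_(i < n) `|l i|.
have M0 : 0 <= M by apply: sumr_ge0.
(* Raising each coordinate by at most e raises l by at most M e, less than half of the deficit of l
   at g. *)
pose e := - dot n l g / (M + 1) / 2.
have e0 : 0 < e by rewrite !divr_gt0 ?oppr_gt0 // ltr_wpDl.
exists e => // u [h1 h2] du.
have u0 : nonneg u by case: du.
have /(all_nthP (fun=> 0)) /(_ i ic) : sat n (closure_forms k v) u.
  exact/(dom_closed cv u0).
rewrite -/l; apply/negP; rewrite -ltNge.
have uE : dot n l u = dot n l g + \sum_(j < n) l j * (u j - g j).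
  by rewrite /dot -big_split; apply: eq_bigr => j _ /=; ring.
have le : \sum_(j < n) l j * (u j - g j) <= M * e.
  rewrite mulr_suml; apply: ler_sum => j _.
  have /andP[gu ue] := h1 j (ltn_ord j).
  have d0 : 0 <= u j - g j by rewrite subr_ge0.
  apply: le_trans (ler_wpM2r d0 (ler_norm _)) _.
  by apply: ler_wpM2l => //; rewrite lerBlDl.
have Me : M * e + e = - dot n l g / 2.
  by rewrite /e; field; rewrite gt_eqF // ltr_wpDl.
rewrite uE; lra.
Qed.

(** If g were in no full-dimensional piece, a small cube at g would avoid all of these. The pieces
    cover this cube, so by convexity a single one contains a subcube, and such a piece has full
    dimension. *)
Lemma full_cover g : nonneg g -> exists k, (exists u, corner k u) /\ dom k g.
Proof.
move=> g0; apply: contrapT => ng.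
have open k : exists2 e, 0 < e &
    forall u, cube n g e u -> (exists v, corner k v) -> ~ dom k u.
  have [ck|nck] := pselect (exists v, corner k v); last by exists 1.
  have ndg : ~ dom k g by move=> dg; apply: ng; exists k.
  by have [e e0 he] := dom_open g0 ndg ck; exists e => // u /he.
have [e e0 he] : exists2 e, 0 < e & forall k : 'I_K, k \in enum 'I_K ->
    forall u, cube n g e u -> (exists v, corner k v) -> ~ dom k u.
  elim: (enum 'I_K) => [|k s [e e0 he]]; first by exists 1.
  have [d d0 hd] := open k.
  exists (Num.min d e); first by rewrite lt_min d0.
  have sub f u : Num.min d e <= f -> cube n g (Num.min d e) u -> cube n g f u.
    move=> ef [h1 h2]; split=> // i /h1 /andP[-> h] /=.
    by apply: le_trans h _; rewrite lerD2l.
  move=> k'; rewrite inE => /orP[/eqP ->|ks] u hu; [apply: hd|apply: he] => //;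
    by apply: sub hu; rewrite ge_min lexx ?orbT.
have [||u [h1 h2]|k [v [d [d0 hv]]]] := @cube_lemma K n dom g e => //.
- exact: dom_convex.
- have u0 : nonneg u by move=> i ni; apply: le_trans (g0 i ni) _; case/andP: (h1 i ni).
  by have [k sk] := Hcover u0; exists k.
have [vg dv] := hv v (cube_refl _ _ (ltW d0)).
have di : 0 <= d^-1 by rewrite invr_ge0 ltW.
apply: (he k _ v vg _ dv); first by rewrite mem_enum.
(* Scaling by the inverse of the side turns the subcube into a unit cube, whose lower vertex and its
   neighbours form a corner. *)
exists (fun i => d^-1 * v i); split; first exact: (domZ di dv).1.
move=> i ni; have [|_ dvi] := hv (fun j => v j + d * (j == i)%:R).
  split=> j nj; last by rewrite gtn_eqF ?mulr0 ?addr0 // (leq_trans ni).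
  by rewrite lerD2l; case: eqP => _; rewrite ?mulr1 ?mulr0 ?addr0 lexx ?lerDl ltW.
rewrite (_ : bump_at _ _ = fun j => d^-1 * (v j + d * (j == i)%:R)).
  exact: (domZ di dvi).1.
by apply/funext => j; rewrite /bump_at mulrDr mulKf // gt_eqF.
Qed.

(** Denominators can be cleared inside the cone, because M u + e_i = (M - 1) u + (u + e_i). *)
Lemma corner_nat k u : corner k u ->
  exists v : nat -> nat, corner k (fun i => (v i)%:R).
Proof.
move=> [du dui]; have [M [f [M0 hf]]] := common_denominator du.1.
have dM := (domZ (ler0n _ M) du).1.
exists f; split; first by have [] := dom_ext hf dM.
move=> i ni; have M1 : 0 <= M.-1%:R :> rat by exact: ler0n.
have := (domD (domZ M1 du).1 (dui i ni)).1.
move=> /(@dom_ext k _ (bump_at (fun i => (f i)%:R) i))[] // j nj.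
by rewrite /bump_at -hf // -[in RHS](prednK M0) -natr1; ring.
Qed.

Definition pt (x y : nat -> rat) s : nat -> rat := fun i => x i + s * (y i - x i).

Lemma dot_pt l x y s :
  dot n l (pt x y s) = aff (dot n l x, dot n l (fun i => y i - x i)) s.
Proof.
rewrite /aff [in RHS]mulrC /= -(dotZ n l s (fun i => y i - x i)).
exact: dotD.
Qed.

Variable U : 'I_K -> nat -> rat.
Hypothesis cornerU : forall k, (exists u, corner k u) -> corner k (U k).

(** On the segment from x to y the function is piecewise affine, and [crossing] applies to the
    full-dimensional pieces. This separation property is what makes a sup-inf form possible. *)
Lemma two_point x y j : nonneg x -> nonneg y -> (j < N)%N ->
  exists k, [/\ exists u, corner k u, H x j <= dot n (slope (U k) j) x &
                dot n (slope (U k) j) y <= H y j].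
Proof.
move=> x0 y0 jN.
pose full := [seq k <- enum 'I_K | `[< exists u, corner k u >]].
have fullP k : List.In k full <-> exists u, corner k u.
  rewrite In_mem mem_filter mem_enum andbT; split=> [/asboolP|?] //.
  exact/asboolP.
pose c k := [seq (dot n l x, dot n l (fun i => y i - x i)) |
             l : nat -> rat <- closure_forms k (U k)].
pose m k := (dot n (slope (U k) j) x, dot n (slope (U k) j) (fun i => y i - x i)).
have pt0 s : 0 <= s <= 1 -> nonneg (pt x y s).
  move=> /andP[s0 s1] i ni; rewrite (_ : pt x y s i = (1 - s) * x i + s * y i).
    by rewrite addr_ge0 // mulr_ge0 ?subr_ge0 ?x0 ?y0.
  by rewrite /pt; ring.
have cE k s : (exists u, corner k u) -> 0 <= s <= 1 ->
    asat (c k) s <-> dom k (pt x y s).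
  move=> ck /pt0 p0; rewrite (dom_closed (cornerU ck) p0).
  rewrite /asat /c all_map /sat; under eq_all do rewrite /= -dot_pt.
  by [].
have [|||k [/fullP fk hx hy]] := @crossing _ c m (fun s => H (pt x y s) j) full 0 1.
- exact: ler01.
- move=> s hs; have [k [fk dk]] := full_cover (pt0 s hs).
  by exists k; [exact/fullP|exact/cE].
- move=> k s /fullP fk hs /(cE _ _ fk hs) dk.
  by rewrite (corner_linear (cornerU fk) dk) // dot_pt.
have px : pt x y 0 = x by apply/funext => i; rewrite /pt mul0r addr0.
have py : pt x y 1 = y by apply/funext => i; rewrite /pt mul1r addrC subrK.
by exists k; split=> //; move: hx hy; rewrite -!dot_pt px py.
Qed.

End PiecewiseLinear.

(* Sup-inf form: the inner lists are the sets {k : l_k x >= H x}, x >= 0. *)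
Lemma piecewise_linear_sup_inf n N K (P : 'I_K -> seq (nat -> rat))
    (H : (nat -> rat) -> nat -> rat) :
  (forall g, nonneg n g -> exists k, sat N (P k) (H g)) ->
  (forall g i, nonneg n g -> (i < n)%N -> H g i = g i) ->
  (forall k g w, nonneg n g -> (forall i, (i < n)%N -> w i = g i) ->
     sat N (P k) w -> forall j, (j < N)%N -> w j = H g j) ->
  forall j, (j < N)%N -> exists F : seq (seq (nat -> rat)),
    (forall Fs l, List.In Fs F -> List.In l Fs -> exists u : nat -> nat,
       l = slope H (fun i => (u i)%:R) j) /\
    (forall g, nonneg n g ->
       (exists2 Fs, List.In Fs F &
          forall l, List.In l Fs -> H g j <= dot n l g) /\
       (forall Fs, List.In Fs F ->
          exists2 l, List.In l Fs & dot n l g <= H g j)).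
Proof.
move=> Hcover Hid Huniq j jN.
have /choice[U hU] : forall k, exists u : nat -> nat,
    (exists v, corner n N P H k v) -> corner n N P H k (fun i => (u i)%:R).
  move=> k; have [[v /(corner_nat Hid Huniq)[u hu]]|nc] :=
    pselect (exists v, corner n N P H k v); first by exists u.
  by exists id.
pose L k := slope H (fun i => (U k i)%:R) j.
pose full k := `[< exists u, corner n N P H k u >].
(* There are infinitely many x but only finitely many sets of piece indices, so F is a finite
   list. *)
pose J x := [set k | full k && (H x j <= dot n (L k) x)]%SET.
pose F := map (fun A : {set 'I_K} => map L (enum A))
  (enum [set A | `[< exists2 x, nonneg n x & A = J x >]]%SET).
exists F; split.
  move=> Fs l /List.in_map_iff[A [<- _]] /List.in_map_iff[k [<- _]].
  by exists (U k).
move=> g g0; split.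
  exists (map L (enum (J g))).
    apply/List.in_map_iff; exists (J g); split=> //; apply/In_mem.
    by rewrite mem_enum inE; apply/asboolP; exists g.
  move=> l /List.in_map_iff[k [<- /In_mem]].
  by rewrite mem_enum inE => /andP[].
move=> Fs /List.in_map_iff[A [<- /In_mem]].
rewrite mem_enum inE => /asboolP[x x0 ->].
(* The linear function of k is above H at x, hence it belongs to the inner list of x, and it is
   below H at g. *)
have [k [fk hx hy]] := two_point Hcover Hid Huniq hU x0 g0 jN.
exists (L k) => //; apply/List.in_map_iff; exists k; split=> //.
by apply/In_mem; rewrite mem_enum inE hx andbT; apply/asboolP.
Qed.

(** * Piecewise linear functions as terms *)

Section Terms.
Variables (E : signature) (I : forall f : symb E, ('I_(arity f) -> CQ) -> CQ).
Hypothesis Idom : forall f a, (forall i, CQ_dom (a i)) -> CQ_dom (I (f := f) a).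
Variables (V : Type) (w : V -> CQ_ext I).
Hypothesis wD : forall v, CQ_dom (w v).
Implicit Types s t : term E V.

Let evD t : CQ_dom (eval w t). Proof. exact: CQ_ext_dom. Qed.

Lemma eval_And_one s t : eval w s = CQ_one -> eval w (s && t)%MV = eval w t.
Proof.
move=> s1; rewrite eval_And chang_andE // s1 /CQ_one.
by have := evD t; case: (eval w t) => [[] g] //= g0; rewrite max_r.
Qed.

Lemma eval_And_zero s t : eval w s = (false, 0) -> eval w (s && t)%MV = (false, 0).
Proof.
move=> s0; rewrite eval_And chang_andE // s0.
by have := evD t; case: (eval w t) => [[] g] //= g0; rewrite min_l.
Qed.

Lemma eval_Or_zero s t : eval w s = (false, 0) -> eval w (s || t)%MV = eval w t.
Proof.
move=> s0; rewrite eval_Or chang_orE // s0.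
by have := evD t; case: (eval w t) => [[] g] //= g0; rewrite max_r.
Qed.

Lemma eval_Or_zeror s t : eval w t = (false, 0) -> eval w (s || t)%MV = eval w s.
Proof.
move=> s0; rewrite eval_Or chang_orE // s0.
by have := evD s; case: (eval w s) => [[] g] //= g0; rewrite max_l.
Qed.

Lemma eval_And_eq1 s t : eval w (s && t)%MV = CQ_one <->
  eval w s = CQ_one /\ eval w t = CQ_one.
Proof.
rewrite eval_And chang_andE // /CQ_one; have := evD s; have := evD t.
case: (eval w s) => [[] g]; case: (eval w t) => [[] h] /= h0 g0; split;
  try by [case|case=> _|case=> -[]]; last by case=> -[->] [->]; rewrite maxxx.
move: h0 g0; rewrite /CQ_dom /chang_dom /= => h0 g0 [hg].
have [gh|gh] := leP g h; move: hg; [rewrite (max_r gh)|rewrite (max_l (ltW gh))] => e.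
  by split; congr pair; lra.
by split; congr pair; lra.
Qed.

Definition conj (ts : seq (term E V)) := foldr (@And E V) One ts.

Lemma eval_conj ts :
  eval w (conj ts) = CQ_one <-> forall t, List.In t ts -> eval w t = CQ_one.
Proof.
elim: ts => [|s ts IH] //=; rewrite eval_And_eq1 IH.
by split=> [[s1 h] t [<-|/h]|h] //; split=> [|t ht]; apply: h; auto.
Qed.

Definition infpart t : term E V := (t && ~~ t)%MV.

Lemma eval_infpart t : eval w (infpart t) = (false, (eval w t).2).
Proof.
rewrite /infpart eval_And -[eval w (~~ t)%MV]/(@chang_neg rat_cone (eval w t)).
rewrite chang_andE //; last exact: (evD (~~ t)%MV).
by case: (eval w t) => [[] g].
Qed.

Definition boolpart t : term E V := nmul 2 (t ^ 2)%MV.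

Lemma eval_boolpart t : eval w (boolpart t) = ((eval w t).1, 0).
Proof.
case tE : (eval w t) => [[] g].
  exact: eval_nmul_coinf (eval_power_coinf 2 tE).
by rewrite (eval_nmul_inf 2 (eval_power_inf _ tE)) // mulr0.
Qed.

Definition monus s t : term E V := (~~ (~~ s + t))%MV.

Lemma eval_monus s t g h : eval w s = (false, g) -> eval w t = (false, h) ->
  eval w (monus s t) = (false, rat_cB g h).
Proof.
by move=> sE tE; rewrite -[LHS]/(chang_neg (chang_plus (chang_neg (eval w s)) (eval w t)))
  sE tE.
Qed.

Lemma eval_sum (T : Type) (ts : seq T) (f : T -> term E V) (r : T -> rat) :
  (forall i, eval w (f i) = (false, r i)) ->
  eval w (foldr (@Plus E V) Zero (map f ts)) = (false, \sum_(i <- ts) r i).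
Proof.
move=> fE; elim: ts => [|i ts IH]; first by rewrite big_nil.
by rewrite big_cons map_cons [foldr _ _ _]/= eval_Plus IH fE.
Qed.

Lemma eval_conj_inf (T : Type) (i0 : T) (ts : seq T) (f : T -> term E V) r :
  (forall i, eval w (f i) = (false, r i)) ->
  exists q : rat, [/\ eval w (conj (map f (i0 :: ts))) = (false, q),
    exists2 i, List.In i (i0 :: ts) & q = r i &
    forall i, List.In i (i0 :: ts) -> q <= r i].
Proof.
move=> fE; elim: ts i0 => [|j ts IH] i0.
  exists (r i0); split.
  - by rewrite eval_And chang_andE // fE.
  - by exists i0; [left|].
  - by move=> i [<-|].
have [q [qE [k kt qk] qmin]] := IH j; exists (Num.min (r i0) q); split.
- rewrite [conj _]/(f i0 && conj (map f (j :: ts)))%MV.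
  by rewrite eval_And chang_andE // fE qE.
- have [ris|sri] := leP (r i0) q; first by exists i0; [left|].
  by exists k; [right|].
- by move=> l [<-|/qmin h']; rewrite ge_min ?lexx // h' orbT.
Qed.

Definition disj (ts : seq (term E V)) := foldr (@Or E V) Zero ts.

Lemma eval_disj_inf (T : Type) (ts : seq T) (f : T -> term E V) (r : T -> rat) a :
  (forall i, List.In i ts -> eval w (f i) = (false, r i)) ->
  (forall i, List.In i ts -> r i <= a) ->
  (exists2 i, List.In i ts & a <= r i) ->
  eval w (disj (map f ts)) = (false, a).
Proof.
move=> fE h [i0 i0t ri0].
(* A disjunction starts from [Zero], whence the alternative q = 0; it is harmless since the value at
   i0 is nonnegative and at most a. *)
have [q [-> q0 qr qa]] : exists q : rat, [/\ eval w (disj (map f ts)) = (false, q),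
    0 <= q, forall i, List.In i ts -> r i <= q & q = 0 \/ q <= a].
  elim: ts fE h {i0t} => [|i ts IH] fE h; first by exists 0; split; auto.
  have [||q [qE q0 qr qa]] := IH.
  - by move=> j hj; apply: fE; right.
  - by move=> j hj; apply: h; right.
  have ri := h i (or_introl erefl).
  exists (Num.max (r i) q); split.
  - rewrite [disj _]/(f i || disj (map f ts))%MV eval_Or chang_orE //.
    by rewrite qE fE //; left.
  - by rewrite le_max q0 orbT.
  - by move=> j [<-|/qr h']; rewrite le_max ?lexx // h' orbT.
  - have [riq|qri] := leP (r i) q; first exact: qa.
    by right; rewrite (le_trans _ ri).
have aq : a <= q by apply: le_trans ri0 (qr _ i0t).
congr pair; apply/eqP; rewrite eq_le aq andbT.
case: qa => // q00; rewrite q00; move: (evD (f i0)).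
rewrite fE // => r0; exact: le_trans r0 (h _ i0t).
Qed.

Lemma eval_disj_select (T : eqType) (ts : seq T) (f : T -> term E V) i0 :
  uniq ts -> i0 \in ts ->
  (forall i, i != i0 -> eval w (f i) = (false, 0)) ->
  eval w (disj (map f ts)) = eval w (f i0).
Proof.
move=> uts i0t f0.
have aux (rs : seq T) : i0 \notin rs -> eval w (disj (map f rs)) = (false, 0).
  elim: rs => // i rs IH; rewrite inE negb_or eq_sym => /andP[/f0 fi /IH h].
  by rewrite [disj _]/(f i || disj (map f rs))%MV eval_Or_zero.
elim: ts uts i0t => // i ts IH; rewrite cons_uniq => /andP[its uts].
rewrite [disj _]/(f i || disj (map f ts))%MV inE => /orP[/eqP i0i|i0t].
  by rewrite -i0i eval_Or_zeror // aux // i0i.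
rewrite eval_Or_zero ?IH // f0 //; by apply: contraNneq its => ->.
Qed.

End Terms.

(** Division by d is composed of the divisions by its prime factors, taken with multiplicity. *)
Lemma eval_div_term (S : set prime_number) V (d : nat) : (0 < d)%N ->
  (forall p : prime_number, (sval p %| d)%N -> S p) ->
  exists f : term (sigS S) V -> term (sigS S) V, forall (w : V -> CQS S) t,
    eval w (f t) = ((eval w t).1, (eval w t).2 / d%:R).
Proof.
have [k] := ubnP d; elim: k d => // k IH d dk d0 dS.
have [d1|d1] := leqP d 1.
  exists id => w t; have -> : d = 1%N by apply/eqP; rewrite eqn_leq d1.
  by rewrite divr1; case: (eval w t).
pose p : prime_number := exist _ (pdiv d) (pdiv_prime d1).
have pd : (sval p %| d)%N := pdiv_dvd d.
have p0 : (0 < sval p)%N := pdiv_gt0 d.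
have [||q qd|f fE] := IH (d %/ sval p)%N.
- by apply: leq_trans (ltn_Pdiv (prime_gt1 (svalP p)) d0) _.
- by rewrite divn_gt0 // dvdn_leq.
- by apply: dS; apply: dvdn_trans qd (dvdn_div pd).
exists (fun t => @App (sigS S) V (exist _ p (dS p pd)) (fun=> f t)) => w t.
rewrite [LHS]/= /divI fE /=; congr pair.
by rewrite -mulrA -invfM -natrM divnK.
Qed.

(** * Homogeneity *)

Section Scaling.
Variable c : rat.
Hypothesis c0 : 0 <= c.

Definition scale (u : CQ) : CQ := (u.1, c * u.2).

Lemma scale_dom u : CQ_dom u -> CQ_dom (scale u).
Proof. exact: mulr_ge0. Qed.

Lemma scale_cB (a b : rat) : c * rat_cB a b = rat_cB (c * a) (c * b).
Proof. by rewrite /rat_cB maxr_pMr // mulr0 mulrBr. Qed.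

(** Scaling is an endomorphism. The case c = 0 is included: it is the retraction to the Boolean
    elements. *)
Lemma eval_scale V (w : V -> CQ) (t : term mv V) :
  eval (fun v => scale (w v)) t = scale (eval w t).
Proof.
elim: t => [v||t IH|t1 IH1 t2 IH2|[]] //.
- by rewrite /scale /= mulr0.
- by rewrite [LHS]/= IH.
- rewrite [LHS]/= IH1 IH2 [in RHS]/=.
  case: (eval w t1) (eval w t2) => [[] g] [[] h];
    by rewrite /scale /= ?mulr0 ?scale_cB ?mulrDr.
Qed.

End Scaling.

(** * Solutions of a formula as terms *)

Section ImplicitFunction.
Variables (phi : formula mv) (n m : nat).
Let N := (n + m)%N.
Hypothesis phiN : (vbound phi <= N)%N.

(* v assigns to x_0, .., x_{n-1} the values given by w and to the m other
   variables a solution of phi; it is normalized beyond n + m. *)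
Definition solves (w v : nat -> CQ) : Prop :=
  [/\ forall i, CQ_dom (v i), forall i, (i < n)%N -> v i = w i,
      eval v phi = CQ_one & forall i, (n + m <= i)%N -> v i = (false, 0)].

Hypothesis existence : forall w, (forall i, CQ_dom (w i)) ->
  exists v, [/\ forall i, CQ_dom (v i), forall i, (i < n)%N -> v i = w i &
                eval v phi = CQ_one].
Hypothesis uniqueness : forall v v', (forall i, CQ_dom (v i)) ->
  (forall i, CQ_dom (v' i)) -> (forall i, (i < n)%N -> v i = v' i) ->
  eval v phi = CQ_one -> eval v' phi = CQ_one ->
  forall i, (i < n + m)%N -> v i = v' i.

Lemma solves_exists w : (forall i, CQ_dom (w i)) -> exists v, solves w v.
Proof.
move=> /existence[v [vD vw v1]].
exists (fun i => if (i < N)%N then v i else (false, 0)); split.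
- by move=> i; case: ifP => _ //; exact: lexx.
- by move=> i ni; rewrite ltn_addr // vw.
- rewrite -v1; apply: eq_eval_vbound => i hi.
  by rewrite (leq_trans hi).
- by move=> i; rewrite ltnNge => ->.
Qed.

Lemma solves_unique w w' v v' : (forall i, (i < n)%N -> w i = w' i) ->
  solves w v -> solves w' v' -> v = v'.
Proof.
move=> ww' [vD vw v1 vN] [vD' vw' v1' vN']; apply/funext => i.
have [iN|Ni] := ltnP i N; last by rewrite vN // vN'.
by apply: uniqueness iN => // j jn; rewrite vw // vw' // ww'.
Qed.

Lemma solves_scale c w v : 0 <= c -> solves w v ->
  solves (fun i => scale c (w i)) (fun i => scale c (v i)).
Proof.
move=> c0 [vD vw v1 vN]; split.
- by move=> i; exact: scale_dom.
- by move=> i ni; rewrite vw.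
- by rewrite eval_scale // v1 /scale /= mulr0.
- by move=> i Ni; rewrite vN // /scale /= mulr0.
Qed.

Section Pattern.
Variable b : nat -> bool.

Definition at_pattern (g : nat -> rat) : nat -> CQ :=
  fun i => (b i, if (i < n)%N then g i else 0).

Lemma at_pattern_dom g : nonneg n g -> forall i, CQ_dom (at_pattern g i).
Proof.
by move=> g0 i; rewrite /CQ_dom /chang_dom /=; case: ifP => [/g0|_] //; exact: lexx.
Qed.

Lemma sol_ex : exists f : (nat -> rat) -> nat -> CQ,
  forall g, nonneg n g -> solves (at_pattern g) (f g).
Proof.
have h g : exists v, nonneg n g -> solves (at_pattern g) v.
  have [g0|ng] := pselect (nonneg n g); last by exists (fun=> CQ_one).
  by have [v hv] := solves_exists (at_pattern_dom g0); exists v.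
by have [f hf] := choice h; exists f.
Qed.

Definition solution := sval (cid sol_ex).

Lemma solution_solves g : nonneg n g -> solves (at_pattern g) (solution g).
Proof. exact: (svalP (cid sol_ex)). Qed.

Definition solH (g : nat -> rat) (i : nat) : rat := (solution g i).2.

Definition solB (i : nat) : bool := (solution (fun=> 0) i).1.

(** Scaling by 0 keeps Boolean parts and sends the solution over g to a solution over 0, where it is
    unique. *)
Lemma sol_bit g i : nonneg n g -> (solution g i).1 = solB i.
Proof.
move=> g0; have z0 : nonneg n (fun=> 0) by move=> j _; exact: lexx.
have h := solves_scale (lexx 0) (solution_solves g0).
have := solves_unique _ h (solution_solves z0); rewrite /solB => <- //.
by move=> j jn; rewrite /scale /at_pattern /= mul0r jn.
Qed.

Lemma solE g i : nonneg n g -> solution g i = (solB i, solH g i).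
Proof. by move=> g0; rewrite -(sol_bit i g0) /solH; case: (solution g i). Qed.

Definition cform (c : constraint) : nat -> rat :=
  fun i => (c.1.2 i)%:R - (c.1.1 i)%:R.

(** On a branch with Boolean part true, phi has the value 1 exactly when its infinitesimal part
    vanishes; the two opposite forms express this. The rest are the branch conditions and
    nonnegativity. *)
Definition piece (x : branch) : seq (nat -> rat) :=
  map cform x.1.1 ++ [:: cform (x.2, false); cform ((x.2.2, x.2.1), false)] ++
  [seq (fun j => (j == i)%:R) | i <- iota 0 N].

Lemma dot_cform c w : dot N (cform c) w = dotn N c.1.2 w - dotn N c.1.1 w.
Proof.
by rewrite /dot /dotn -sumrB; apply: eq_bigr => i _; rewrite /cform mulrBl.
Qed.

Lemma sat_piece x (w : nat -> rat) : sat N (piece x) w <->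
  [/\ forall c, List.In c x.1.1 -> dotn N c.1.1 w <= dotn N c.1.2 w,
      dotn N x.2.1 w = dotn N x.2.2 w & forall i, (i < N)%N -> 0 <= w i].
Proof.
have h1 : all (fun l => 0 <= dot N l w) (map cform x.1.1) <->
    forall c, List.In c x.1.1 -> dotn N c.1.1 w <= dotn N c.1.2 w.
  elim: (x.1.1) => //= c cs IH; rewrite dot_cform subr_ge0; split.
    by move=> /andP[hc /IH h] c' [<- //|/h].
  by move=> h; rewrite h; [apply/IH => c' hc'; apply: h; right|left].
have h2 : all (fun l => 0 <= dot N l w)
      [seq (fun j => (j == i)%:R) | i <- iota 0 N] <->
    forall i, (i < N)%N -> 0 <= w i.
  have dotE i : (i < N)%N -> dot N (fun j => (j == i)%:R) w = w i.
    move=> iN; rewrite /dot (bigD1 (Ordinal iN)) //= eqxx mul1r big1 ?addr0 //.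
    by move=> j; rewrite -val_eqE /= => /negPf ->; rewrite mul0r.
  rewrite all_map; split=> [/allP h i iN|h].
    by have := h i; rewrite mem_iota /= dotE //; apply.
  by apply/allP => i; rewrite mem_iota /= => iN; rewrite dotE ?h.
rewrite /sat /piece !all_cat [all _ [:: _; _]]/= !dot_cform andbT !subr_ge0 /=.
rewrite -eq_le; split=> [/and3P[/h1 ? /eqP ? /h2 ?]|[/h1 -> -> /h2 ->]] //.
by rewrite eqxx.
Qed.

Let bs := [seq x <- branches solB phi | x.1.2].

Let dflt : branch := ([::], true, (fun=> 0%N, fun=> 0%N)).

Definition pieces (k : 'I_(size bs)) := piece (nth dflt bs k).

Lemma solH_id g i : nonneg n g -> (i < n)%N -> solH g i = g i.
Proof.
move=> /solution_solves[_ h _ _] ni; rewrite /solH h //.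
by rewrite /at_pattern /= ni.
Qed.

Lemma In_bs x : List.In x (branches solB phi) -> x.1.2 ->
  exists k : 'I_(size bs), nth dflt bs k = x.
Proof.
move=> hx xt; have : List.In x bs by apply/List.filter_In.
elim: bs => //= y s IH [->|/IH[k <-]]; first by exists ord0.
by exists (lift ord0 k).
Qed.

Lemma bs_In (k : 'I_(size bs)) :
  List.In (nth dflt bs k) (branches solB phi) /\ (nth dflt bs k).1.2.
Proof.
have : List.In (nth dflt bs k) bs.
  case: k => k /=; elim: bs k => // y s IH [|k] ks; first by left.
  by right; exact: IH.
by move=> /List.filter_In.
Qed.

Lemma sol_bits g : nonneg n g -> (fun i => (solution g i).1) = solB.
Proof. by move=> g0; apply/funext => i; exact: sol_bit. Qed.

Lemma pieces_cover g : nonneg n g -> exists k, sat N (pieces k) (solH g).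
Proof.
move=> g0; have [vD _ v1 _] := solution_solves g0.
have [x] := branches_cover vD phiN; rewrite sol_bits // => hx sx.
have := branches_val vD phiN; rewrite sol_bits // => /(_ x hx sx).
rewrite v1 => -[xt _] /=; rewrite add0r !rat_comb => pq.
have [k kx] := In_bs hx (esym xt).
exists k; rewrite /pieces kx; apply/sat_piece; split=> //.
- by move=> c /sx[+ _]; rewrite !rat_comb => /rat_cle.
- by move=> i _; exact: vD.
Qed.

Lemma pieces_unique k g w : nonneg n g ->
  (forall i, (i < n)%N -> w i = g i) -> sat N (pieces k) w ->
  forall j, (j < N)%N -> w j = solH g j.
Proof.
move=> g0 wg /sat_piece[cs pq w0] j jN.
have [hx xt] := bs_In k.
pose v i : CQ := (solB i, if (i < N)%N then w i else 0).
have vD i : CQ_dom (v i).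
  rewrite /v /CQ_dom /chang_dom /=; case: ifP => [/w0|_] //; exact: lexx.
have vE p : @comb rat_cone (fun i => (v i).2) N p = dotn N p w.
  by rewrite rat_comb; apply: eq_dotn => i iN; rewrite /v /= iN.
have sx : @bsat rat_cone v N (nth dflt bs k).1.1.
  move=> c hc; split; first by rewrite !vE; apply/rat_cle; exact: cs.
  by rewrite (branches_nonstrict hx hc).
have [bE u0] := branches_val vD phiN hx sx; rewrite !vE pq => /= uE.
have v1 : eval v phi = CQ_one.
  move: bE u0 uE; rewrite xt; case: (eval v phi) => b' u /= -> _ uE.
  by congr pair; apply: (addIr (dotn N (nth dflt bs k).2.2 w)); rewrite uE add0r.
have [sD sg s1 _] := solution_solves g0.
have := uniqueness vD sD _ v1 s1 jN; rewrite solE // /v jN => h.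
suff [] : (solB j, w j) = (solB j, solH g j) by [].
apply: h => i ni; rewrite solE // solH_id // (leq_trans ni) ?leq_addr //.
by rewrite wg.
Qed.

End Pattern.

Variable S : set prime_number.
Hypothesis denominators : forall b (u : nat -> nat) i k (p : prime_number),
  (i < n)%N -> (n <= k < n + m)%N ->
  (sval p %| `|denq (slope (solH b) (fun i => (u i)%:R) k i)|)%N -> S p.

Local Notation termS := (term (sigS S) 'I_n).

(** A coefficient is realized by a division by its denominator followed by a multiple. Only
    truncated subtraction is available, so the positive and the negative coefficients are summed
    separately; truncation is the maximum with 0. *)
Lemma linear_term (l : nat -> rat) :
  (forall i (p : prime_number), (i < n)%N -> (sval p %| `|denq (l i)|)%N -> S p) ->
  exists t : termS, forall w : 'I_n -> CQS S, (forall i, CQ_dom (w i)) ->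
    eval w t = (false, Num.max 0 (\sum_(i < n) l i * (w i).2)).
Proof.
move=> hl.
have /choice[f fE] (i : 'I_n) : exists f : termS -> termS,
    forall (w : 'I_n -> CQS S) t,
    eval w (f t) = ((eval w t).1, (eval w t).2 / `|denq (l i)|%N%:R).
  apply: eval_div_term; first by rewrite absz_gt0 denq_neq0.
  by move=> p; exact: hl.
pose part (i : 'I_n) := nmul `|numq (l i)|%N (f i (infpart (Var i))).
have Id := @divI_dom S.
have partE (w : 'I_n -> CQS S) (wD : forall i, CQ_dom (w i)) i :
    eval w (part i) = (false, `|l i| * (w i).2).
  rewrite (@eval_nmul_inf _ _ _ _ _ ((w i).2 / `|denq (l i)|%N%:R)).
    congr pair; rewrite !natr_absz (ger0_norm (denq_ge0 _)) mulrCA mulrC.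
    congr (_ * _); rewrite -{3}[l i]divq_num_den normf_div -intr_norm.
    by rewrite (ger0_norm (_ : 0 <= (denq (l i))%:~R)) // ler0z denq_ge0.
  by rewrite fE eval_infpart.
pose pos (i : 'I_n) := if 0 < l i then part i else Zero.
pose neg (i : 'I_n) := if 0 < l i then Zero else part i.
exists (monus (foldr (@Plus _ _) Zero (map pos (enum 'I_n)))
              (foldr (@Plus _ _) Zero (map neg (enum 'I_n)))) => w wD.
have posE (i : 'I_n) : eval w (pos i) = (false, if 0 < l i then `|l i| * (w i).2 else 0).
  by rewrite /pos; case: ifP => _ //; exact: partE.
have negE (i : 'I_n) : eval w (neg i) = (false, if 0 < l i then 0 else `|l i| * (w i).2).
  by rewrite /neg; case: ifP => _ //; exact: partE.
rewrite (eval_monus (eval_sum _ posE) (eval_sum _ negE)); congr pair.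
rewrite /rat_cB !big_enum /= -sumrB; congr Num.max; apply: eq_bigr => i _.
have [l0|l0] := ltP 0 (l i); first by rewrite gtr0_norm // subr0.
by rewrite sub0r ler0_norm // mulNr opprK.
Qed.

Lemma sup_inf_term b k : (n <= k < n + m)%N ->
  exists t : termS, forall (w : 'I_n -> CQS S) (g : nat -> rat),
    (forall i, CQ_dom (w i)) ->
    (forall i : 'I_n, g i = (w i).2) -> eval w t = (false, solH b g k).
Proof.
move=> nkN; have /andP[nk kN] := nkN.
have [F [Fslope FH]] := piecewise_linear_sup_inf
  (@pieces_cover b) (@solH_id b) (@pieces_unique b) kN.
pose good (l : nat -> rat) := forall i (p : prime_number),
  (i < n)%N -> (sval p %| `|denq (l i)|)%N -> S p.
(* The choice needs a term for every l; the forms with other denominators get [Zero] and do not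
   occur in F. *)
have /choice[tau tauE] l : exists t : termS, forall w : 'I_n -> CQS S,
    (forall i, CQ_dom (w i)) ->
    eval w t = (false, if `[< good l >] then Num.max 0 (\sum_(i < n) l i * (w i).2)
                       else 0).
  have [gl|ngl] := asboolP (good l); first exact: linear_term.
  by exists Zero.
have goodF Fs l : List.In Fs F -> List.In l Fs -> good l.
  move=> hFs hl i p ni; have [u ->] := Fslope _ _ hFs hl.
  exact: denominators.
exists (disj (map (fun Fs => conj (map tau Fs)) F)) => w g wD gw.
have g0 : nonneg n g.
  by move=> i ni; rewrite (gw (Ordinal ni)); exact: wD.
have H0 : 0 <= solH b g k by case: (solution_solves b g0) => vD _ _ _; exact: vD.
have [[F0 F0F F0H] FHs] := FH g g0.
have dotE (l : nat -> rat) : \sum_(i < n) l i * (w i).2 = dot n l g.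
  by apply: eq_bigr => i _; rewrite gw.
have FsE Fs : List.In Fs F -> exists q : rat,
    [/\ eval w (conj (map tau Fs)) = (false, q),
        exists2 l, List.In l Fs & q = Num.max 0 (dot n l g) &
        forall l, List.In l Fs -> q <= Num.max 0 (dot n l g)].
  move=> hF; have [l lFs _] := FHs _ hF.
  case: Fs hF lFs => // l0 Fs hF _.
  have [q [qE [l' l'F ql'] qmin]] :=
    @eval_conj_inf _ _ (@divI_dom S) _ _ wD _ l0 Fs tau _ (fun l => tauE l w wD).
  exists q; split=> //.
    exists l' => //; rewrite ql' -dotE; case: asboolP => // ng.
    by case: ng; apply: goodF hF l'F.
  move=> l1 hl1; have := qmin _ hl1; rewrite -dotE; case: asboolP => // ng.
  by case: ng; apply: goodF hF hl1.
apply: (@eval_disj_inf _ _ (@divI_dom S) _ _ wD _ _ _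
  (fun Fs => (eval w (conj (map tau Fs))).2)).
- by move=> Fs /FsE[q [-> _ _]].
- move=> Fs hF; have [q [-> _ qmin]] := FsE _ hF; have [l lFs lH] := FHs _ hF.
  by apply: le_trans (qmin _ lFs) _; rewrite ge_max H0.
- exists F0 => //; have [q [-> [l lF ->] _]] := FsE _ F0F.
  by rewrite le_max (F0H l lF) orbT.
Qed.

(** The solution is given by a different term for each Boolean pattern b of the arguments. The
    formula [chi b] is 1 on the pattern b and 0 on all others, so the disjunction selects the right
    term. *)
Lemma implicit_term k : (n <= k < n + m)%N ->
  exists t : termS, forall (w : 'I_n -> CQS S) (x v : nat -> CQ),
    (forall i, CQ_dom (w i)) -> (forall i : 'I_n, x i = w i) -> solves x v ->
    eval w t = v k.
Proof.
move=> nkN; pose ext (b : {ffun 'I_n -> bool}) (i : nat) := oapp b false (insub i).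
have /choice[M ME] (b : {ffun 'I_n -> bool}) := sup_inf_term (ext b) nkN.
pose lit (c : bool) (t : termS) := if c then boolpart t else (~~ boolpart t)%MV.
pose chi (b : {ffun 'I_n -> bool}) := conj [seq lit (b i) (Var i) | i <- enum 'I_n].
pose val b := if solB (ext b) k then (~~ M b)%MV else M b.
exists (disj [seq (chi b && val b)%MV | b <- enum {ffun 'I_n -> bool}]).
move=> w x v wD xw xv; have Id := @divI_dom S.
pose b0 := [ffun i : 'I_n => (w i).1].
have litE b i : eval w (lit (b i) (Var i)) = (b i == (w i).1, 0).
  have e : eval w (boolpart (Var i)) = ((w i).1, 0) by exact: eval_boolpart.
  rewrite /lit; case: (b i); first by rewrite e; case: (w i).1.
  rewrite [LHS](_ : _ = chang_neg (eval w (boolpart (Var i)))) // e.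
  by case: (w i).1.
have chi1 : eval w (chi b0) = CQ_one.
  apply/eval_conj => // t /List.in_map_iff[i [<- _]].
  by rewrite litE ffunE eqxx.
have chi0 b : b != b0 -> eval w (chi b) = (false, 0).
  move=> bb0; have [i bi] : exists i, b i != b0 i.
    by apply/existsP; rewrite -negb_forall; apply: contra bb0 => /eqfunP/ffunP ->.
  have : i \in enum 'I_n by rewrite mem_enum.
  rewrite /chi; elim: (enum 'I_n) => // j s IH.
  rewrite inE; have [<- _|_ /IH h] := eqVneq i j.
    rewrite [conj _]/(lit (b i) (Var i) && conj _)%MV; apply: eval_And_zero => //.
    by move: bi; rewrite litE ffunE => /negPf ->.
  rewrite [conj _]/(lit (b j) (Var j) && conj [seq lit (b i) (Var i) | i <- s])%MV.
  have := litE b j; case: (b j == _) => e; first by rewrite eval_And_one.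
  exact: eval_And_zero.
rewrite (@eval_disj_select _ _ Id _ _ wD _ _ _ b0); first last.
- by move=> b /chi0 h; apply: eval_And_zero.
- by rewrite mem_enum.
- exact: enum_uniq.
rewrite eval_And_one //.
pose g i := (x i).2.
have g0 : nonneg n g.
  by move=> i ni; rewrite /g (xw (Ordinal ni)); exact: wD.
have -> : v = solution (ext b0) g.
  apply: solves_unique xv (solution_solves _ g0) => i ni.
  rewrite /at_pattern ni /ext insubT /= ffunE /g (xw (Ordinal ni)).
  by case: (w _).
rewrite solE // /val.
have := ME b0 w g wD (fun i => congr1 snd (xw i)).
by case: (solB _ _) => // h; rewrite [LHS](_ : _ = chang_neg (eval w (M b0))) // h.
Qed.

End ImplicitFunction.

(** * Algebraic expansions *)

Notation mvt := (translate (mv_incl _)).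

Section CQRule.
Variables (E : signature) (L : conseq E).
Hypotheses (hL : is_logic L) (LPL : morphism (mv_incl E) LP L).

(** By completeness, derivations in a logic above LP reduce to computations in the Chang algebra of
    Q. *)
Lemma CQ_rule (G : seq (formula mv)) phi s D :
  (forall w : nat -> CQ, (forall i, CQ_dom (w i)) ->
     (forall psi, List.In psi G -> eval w psi = CQ_one) -> eval w phi = CQ_one) ->
  (forall psi, List.In psi G -> L D (subst s (mvt psi))) ->
  L D (subst s (mvt phi)).
Proof.
move=> hG hD.
have finG : finite_set [set psi | List.In psi G].
  elim: (G) => [|t s' IH]; first exact: finite_set0.
  rewrite (_ : [set _ | _] = t |` [set u | List.In u s']).
    by rewrite finite_setU; split=> //; exact: finite_set1.
  by apply/seteqP; split=> u /= [->|]; auto.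
have /LPL /(logic_struct hL s) /(logic_cut hL) := LP_complete finG hG.
by apply=> _ [_ [psi /hD + <-] <-].
Qed.

Lemma CQ_valid phi s D :
  (forall w : nat -> CQ, (forall i, CQ_dom (w i)) -> eval w phi = CQ_one) ->
  L D (subst s (mvt phi)).
Proof. by move=> h; apply: (@CQ_rule [::]) => // w wD _; exact: h. Qed.

End CQRule.

(* Phi(a, w). *)
Definition inst (Phi : fset_formulas) E (a : 'I_(nx Phi) -> formula E)
    (w : 'I_(nz Phi) -> formula E) : set (formula E) :=
  (fun phi => subst (fun v => match v with inl i => a i | inr j => w j end)
                    (mvt phi)) @` formulas Phi.

Lemma instanceE (Phi : fset_formulas) E (w : 'I_(nz Phi) -> formula E) :
  instance w = inst (fun i => Var (nat_of_ord i)) w.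
Proof. by []. Qed.

Lemma subst_inst Phi E a w (s : nat -> formula E) :
  subst s @` @inst Phi E a w = inst (fun i => subst s (a i)) (fun j => subst s (w j)).
Proof.
rewrite /inst image_comp; congr image; apply/funext => phi /=.
by rewrite subst_subst; apply: eq_subst => -[].
Qed.

Lemma translate_inst Phi E1 E2 (T : translation E1 E2) a w :
  translate T @` @inst Phi E1 a w =
  inst (fun i => translate T (a i)) (fun j => translate T (w j)).
Proof.
rewrite /inst image_comp; congr image; apply/funext => phi /=.
by rewrite translate_subst translate_mv_incl; apply: eq_subst => -[].
Qed.

Lemma inst_finite Phi E a w : finite_set (@inst Phi E a w).
Proof. by apply: finite_image; exact: formulas_finite. Qed.

Definition unique_rule (Phi : fset_formulas) E (L : conseq E) : Prop :=
  forall (a : 'I_(nx Phi) -> formula E) (y z : 'I_(nz Phi) -> formula E) j D,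
    (forall psi, inst a y psi -> L D psi) ->
    (forall psi, inst a z psi -> L D psi) -> L D (y j <==> z j)%MV.

Section Expansion1.
Variable Phi : fset_formulas.
Let n := nx Phi.
Let m := nz Phi.

Lemma unique_ruleP E (L : conseq E) : is_logic L -> unique_rule Phi L <->
  forall j : 'I_m,
    L (instance (fun j : 'I_m => Var (n + j)%N) `|`
       instance (fun j : 'I_m => Var (n + m + j)%N))
      (Var (n + j)%N <==> Var (n + m + j)%N)%MV.
Proof.
move=> hL; split=> [h j|h a y z j D Dy Dz].
  apply: (h (fun i => Var (nat_of_ord i)) (fun j => Var (n + j)%N)
    (fun j => Var (n + m + j)%N)) => psi hpsi; apply: (logic_refl hL).
    by left.
  by right.
(* The three blocks of n, m and m variables receive a, y and z. *)
pose s k : formula E :=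
  if insub k is Some i then a i else
  if insub (k - n)%N is Some j then y j else
  if insub (k - n - m)%N is Some j then z j else Zero.
have sa (i : 'I_n) : s i = a i by rewrite /s valK.
have sy (j' : 'I_m) : s (n + j')%N = y j'.
  by rewrite /s insubN ?ltnNge ?leq_addr // addKn valK.
have sz (j' : 'I_m) : s (n + m + j')%N = z j'.
  rewrite /s insubN; last by rewrite -ltnNge ltnS -addnA leq_addr.
  rewrite -addnA addKn insubN; last by rewrite -ltnNge ltnS leq_addr.
  by rewrite addKn valK.
have /(logic_struct hL s) := h j.
rewrite image_setU !instanceE !subst_inst /= sy sz => /(logic_cut hL); apply.
move=> psi [h'|h']; [apply: Dy|apply: Dz]; move: h'; rewrite /inst.
  by move=> [chi hc <-]; exists chi => //; apply: eq_subst => -[i|j']; rewrite ?sa ?sy.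
by move=> [chi hc <-]; exists chi => //; apply: eq_subst => -[i|j']; rewrite ?sa ?sz.
Qed.

Let f (j : 'I_m) : formula (sig1 Phi) :=
  @App (sig1 Phi) nat j (fun i => Var (nat_of_ord i)).

Lemma expansion1_spec : let L := expansion1 LP (Phi := Phi) in
  is_logic L /\ [/\ morphism (mv_incl (sig1 Phi)) LP L,
    forall phi, instance f phi -> L set0 phi & unique_rule Phi L].
Proof.
pose P (L : conseq (sig1 Phi)) := [/\ morphism (mv_incl (sig1 Phi)) LP L,
    forall phi, instance f phi -> L set0 phi &
    forall j : 'I_m,
    L (instance (fun j : 'I_m => Var (n + j)%N) `|`
       instance (fun j : 'I_m => Var (n + m + j)%N))
      (Var (n + j)%N <==> Var (n + m + j)%N)%MV].
have finP : finitary_rules P.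
  apply: (@finitary_equiv _ (fun L => morphism (mv_incl (sig1 Phi)) LP L /\
    (forall phi, instance f phi -> L set0 phi) /\
    forall j : 'I_m,
    L (instance (fun j : 'I_m => Var (n + j)%N) `|`
       instance (fun j : 'I_m => Var (n + m + j)%N))
      (Var (n + j)%N <==> Var (n + m + j)%N)%MV)).
    by move=> L; split=> [[? []]|[]].
  apply: finitary_and; first exact: finitary_morphism LP_logic.
  apply: finitary_and.
    apply: finitary_forall => phi; apply: finitary_imply; exact: finitary_thm.
  apply: finitary_forall => j; apply: finitary_rule.
  by rewrite finite_setU; split; exact: inst_finite.
have [hL [h1 h2 h3]] := least_logicP finP.
by split=> //; split=> //; apply/unique_ruleP.
Qed.

End Expansion1.

Section Expansion.
Variable Sigma : set fset_formulas.
Local Notation sg := (sig_of Sigma).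
Local Notation EX := (expansion LP Sigma).

Definition fsymb (Phi : {Phi | Sigma Phi}) (a : 'I_(nx (sval Phi)) -> formula sg)
    (j : 'I_(nz (sval Phi))) : formula sg := @App sg nat (existT _ Phi j) a.

Lemma expansion_spec : is_logic EX /\ (morphism (mv_incl sg) LP EX /\
  forall Phi : {Phi | Sigma Phi},
    morphism (sig1_incl (Phi := Phi)) (expansion1 LP (Phi := sval Phi)) EX).
Proof.
apply: least_logicP; apply: finitary_and.
  exact: finitary_morphism LP_logic.
apply: finitary_forall => Phi; apply: finitary_morphism.
by case: (expansion1_spec (sval Phi)).
Qed.

Lemma expansion_logic : is_logic EX. Proof. by case: expansion_spec. Qed.

Lemma expansion_LP : morphism (mv_incl sg) LP EX.
Proof. by case: expansion_spec => _ []. Qed.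

Lemma expansion_exist (Phi : {Phi | Sigma Phi}) a psi :
  inst a (@fsymb Phi a) psi -> EX set0 psi.
Proof.
have [hL [_ /(_ Phi) h]] := expansion_spec.
have [_ [_ h1 _]] := expansion1_spec (sval Phi).
pose s k : formula sg := if insub k is Some i then a i else Zero.
move=> [phi hphi <-].
have := h1 _ (ex_intro2 _ _ phi hphi erefl) => /h.
rewrite image_set0 => /(logic_struct0 hL s).
rewrite translate_subst translate_mv_incl subst_subst.
rewrite (@eq_subst _ _ _ _
  (fun v => match v with inl i => a i | inr j => fsymb a j end)) //.
move=> [i|j] /=; rewrite ?/s ?valK //.
by congr App; apply/funext => i; rewrite /= valK.
Qed.

Lemma expansion_unique (Phi : {Phi | Sigma Phi}) : unique_rule (sval Phi) EX.
Proof.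
have [hL [_ /(_ Phi) h]] := expansion_spec.
have [hL1 [_ _ /(unique_ruleP _ hL1) h1]] := expansion1_spec (sval Phi).
apply/unique_ruleP => // j; have /h := h1 j.
by rewrite image_setU !instanceE !translate_inst.
Qed.

(** The universal property of the expansion. Minimality is used twice: for the join over Sigma, and
    for the expansion by a single Phi. *)
Lemma expansion_morphism E (L : conseq E) (T : translation sg E) :
  is_logic L -> morphism (mv_incl E) LP L ->
  (forall (Phi : {Phi | Sigma Phi}) psi,
     inst (fun i : 'I_(nx (sval Phi)) => Var (nat_of_ord i))
       (fun j => subst (fun i => Var (nat_of_ord i)) (T (existT _ Phi j))) psi ->
     L set0 psi) ->
  (forall Phi : {Phi | Sigma Phi}, unique_rule (sval Phi) L) ->
  morphism T EX L.
Proof.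
move=> hL LPL ex un.
apply: (@least_logic_min _ _ (pullback T L)); first exact: pullback_logic.
have pb E' (U : translation E' sg) G phi :
    pullback T L (translate U @` G) (translate U phi) =
    pullback (translation_comp U T) L G phi.
  rewrite /pullback -translate_comp image_comp; congr (L (_ @` _) _).
  by apply/funext => psi /=; rewrite translate_comp.
split=> [G phi|Phi G phi].
  rewrite pb /pullback => /LPL.
  by congr (L (_ @` _) _); [apply/funext => psi|];
    rewrite -translate_comp translate_mv_incl.
rewrite pb; move: G phi; apply: least_logic_min; first exact: pullback_logic.
split.
- move=> G phi; rewrite /pullback => /LPL.
  rewrite translate_mv_incl image_comp; congr (L (_ @` _) _).
  by apply/funext => psi /=; rewrite translate_mv_incl.
- move=> psi hpsi; rewrite /pullback image_set0; apply: (ex Phi).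
  have : (translate (translation_comp (sig1_incl (Phi:=Phi)) T) @` instance
     (fun j : 'I_(nz (sval Phi)) =>
         @App (sig1 (sval Phi)) nat j (fun i => Var (nat_of_ord i))))
     (translate (translation_comp (sig1_incl (Phi:=Phi)) T) psi) by exists psi.
  rewrite instanceE translate_inst; congr (inst _ _ _).
  apply/funext => j /=; rewrite /translation_comp /=.
  by rewrite subst_subst; apply: eq_subst.
- move=> j; rewrite /pullback image_setU !instanceE !translate_inst.
  by have /(unique_ruleP _ hL) := un Phi; apply.
Qed.

End Expansion.

Definition em_formula : formula mv := (Var 0%N || ~~ Var 0%N)%MV.

Section CQmv.
Variables (w : nat -> CQ) (wD : forall i, CQ_dom (w i)).

Lemma CQ_no_symb : forall (f : symb mv) (a : 'I_(arity f) -> CQ),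
  (forall i, CQ_dom (a i)) -> CQ_dom (@aApp mv CQ f a).
Proof. by case. Qed.

Lemma eval_EM : eval w em_formula = CQ_one <-> (w 0%N).2 = 0.
Proof.
rewrite /em_formula (@eval_Or mv _ _ w); have := wD 0.
rewrite -[eval w (~~ _)%MV]/(chang_neg (w 0%N)) -[eval w (Var 0%N)]/(w 0%N) => w0.
by rewrite chang_orE //; case: (w 0%N) => [[] g] /=; split=> [[]//|->].
Qed.

(* An infinitesimal or coinfinitesimal with the bit c, k times as far from c as
   the variable 0 is. *)
Definition multiple (c : bool) (k : nat) : formula mv :=
  let t := nmul k (infpart (Var 0%N)) in if c then (~~ t)%MV else t.

Lemma eval_multiple c k : eval w (multiple c k) = (c, k%:R * (w 0%N).2).
Proof.
have e : eval w (nmul k (infpart (Var 0%N))) = (false, k%:R * (w 0%N).2).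
  exact: (@eval_nmul_inf mv _ _ w _ _ _ (eval_infpart CQ_no_symb wD _)).
rewrite /multiple; case: c => //.
by rewrite [LHS](_ : _ = chang_neg (eval w (nmul k (infpart (Var 0%N))))) // e.
Qed.

End CQmv.

Lemma subst_multiple E (s : nat -> formula E) c k : s 0%N = Var 0%N ->
  subst s (mvt (multiple c k)) = mvt (multiple c k).
Proof.
by move=> s0; rewrite /multiple; case: c; rewrite /= translate_nmul subst_nmul /= s0.
Qed.

Lemma scale_one c u : 0 < c -> scale c u = CQ_one -> u = CQ_one.
Proof.
case: u => b g c0 [-> /eqP]; rewrite mulf_eq0 gt_eqF //= => /eqP ->.
by [].
Qed.

Lemma scale1 c : scale c CQ_one = CQ_one.
Proof. by rewrite /scale /= mulr0. Qed.

Lemma integral_valuation N (w : nat -> CQ) : (forall i, CQ_dom (w i)) ->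
  exists (M : rat) (k : nat -> nat), 0 < M /\
    forall i, (i < N)%N -> scale M (w i) = ((w i).1, (k i)%:R).
Proof.
move=> wD; have [|M [k [M0 hk]]] := @common_denominator N (fun i => (w i).2).
  by move=> i _; exact: wD.
exists M%:R, k; rewrite ltr0n; split=> // i iN.
by rewrite /scale hk.
Qed.

(** * Transfer from a logic without excluded middle to the Chang algebra *)

Section NonBoolean.
Variables (E : signature) (L : conseq E).
Hypotheses (hL : is_logic L) (LPL : morphism (mv_incl E) LP L).
Hypothesis nonboolean : ~ L set0 (mvt em_formula).

(* A finite rule that fails in CQ fails at integral values, hence at multiples
   of an infinitesimal; L would then prove that there are no infinitesimals. *)
Lemma nonboolean_rule (G : seq (formula mv)) phi :
  L (translate (mv_incl E) @` [set psi | List.In psi G]) (mvt phi) ->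
  forall w : nat -> CQ, (forall i, CQ_dom (w i)) ->
    (forall psi, List.In psi G -> eval w psi = CQ_one) -> eval w phi = CQ_one.
Proof.
move=> rule w wD hG; apply: contrapT => nphi; apply: nonboolean.
pose N := foldr (fun t m => maxn (vbound t) m) (vbound phi) G.
have GN t : List.In t G -> (vbound t <= N)%N.
  rewrite /N; elim: (G) => //= t' s' IH [->|/IH]; rewrite leq_max ?leqnn //.
  by move=> ->; rewrite orbT.
have phiN : (vbound phi <= N)%N.
  by rewrite /N; elim: (G) => //= t' s' IH; rewrite leq_max IH orbT.
have [M [k [M0 hk]]] := integral_valuation N wD.
pose s i := multiple (w i).1 (k i).
have sE (v : nat -> CQ) t : (forall i, CQ_dom (v i)) -> (vbound t <= N)%N ->
    eval v (subst s t) = scale ((v 0%N).2 * M) (eval w t).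
  move=> vD tN; rewrite eval_subst -eval_scale; last first.
    by rewrite mulr_ge0 ?(ltW M0) //; exact: vD.
  apply: eq_eval_vbound => i hi; rewrite /s eval_multiple //.
  have [h1] := hk i (leq_trans hi tN).
  by rewrite /scale -mulrA h1 mulrC.
have /(logic_struct hL (fun i => mvt (s i))) := rule.
move=> /(logic_cut hL) {}rule.
have {}rule : L set0 (subst Var (mvt (subst s phi))).
  rewrite subst_Var translate_subst; apply: rule => _ [_ [psi hpsi <-] <-].
  rewrite -translate_subst -[mvt _]subst_Var.
  apply: (CQ_valid hL LPL) => v vD.
  by rewrite sE //; [rewrite hG // scale1|exact: GN].
rewrite -[mvt em_formula]subst_Var; apply: (@CQ_rule _ _ hL LPL [:: subst s phi]).
  move=> v vD /(_ _ (or_introl erefl)); rewrite sE // => h; apply/eval_EM => //.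
  apply: contrapT => v0; apply: nphi; apply: scale_one h.
  by rewrite mulr_gt0 // lt_neqAle; apply/andP; split; [apply/eqP => /esym|exact: vD].
by move=> _ [<-|[]].
Qed.

(** A multiple M w of the arguments is integral, hence realized by multiples of an infinitesimal
    variable, over which L has solving terms. A valuation in which phi holds there and the variable
    has nonzero infinitesimal part would scale back to a solution over w. If there is none, phi
    implies excluded middle for the variable. *)
Lemma nonboolean_existence n phi :
  (forall a : nat -> formula E, exists s : nat -> formula E,
     (forall i, (i < n)%N -> s i = a i) /\ L set0 (subst s (mvt phi))) ->
  forall w : nat -> CQ, (forall i, CQ_dom (w i)) ->
    exists v : nat -> CQ, [/\ forall i, CQ_dom (v i),
      forall i, (i < n)%N -> v i = w i & eval v phi = CQ_one].
Proof.
move=> ex w wD; apply: contrapT => nex; apply: nonboolean.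
have [M [k [M0 hk]]] := integral_valuation n wD.
pose x i := multiple (w i).1 (k i).
have [s [sx sphi]] := ex (fun i => mvt (x i)).
(* The unknowns are shifted by one because the variable 0 is the infinitesimal. *)
pose r i : formula mv := if (i < n)%N then x i else Var i.+1.
pose s' i : formula E := if i is i'.+1 then s i' else Var 0%N.
rewrite -[mvt em_formula]subst_Var.
have EMs : subst Var (mvt em_formula) = subst s' (mvt em_formula) by [].
rewrite EMs; apply: (@CQ_rule _ _ hL LPL [:: subst r phi]); last first.
  move=> _ [<-|[]]; rewrite translate_subst subst_subst.
  rewrite (@eq_subst _ _ _ _ s) // => i; rewrite /r; case: ifP => // ni.
  by rewrite subst_multiple // sx.
move=> v vD /(_ _ (or_introl erefl)); rewrite eval_subst => h; apply/eval_EM => //.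
apply: contrapT => v0.
have g0 : 0 < (v 0%N).2.
  by rewrite lt_neqAle; apply/andP; split; [apply/eqP => /esym|exact: vD].
have c0 : 0 <= ((v 0%N).2 * M)^-1 by rewrite invr_ge0 mulr_ge0 // ltW.
apply: nex; exists (fun i => scale ((v 0%N).2 * M)^-1 (eval v (r i))); split.
- by move=> i; apply: scale_dom c0 _ _; exact: CQ_eval_dom.
- move=> i ni; rewrite /r ni eval_multiple //; have [h1] := hk i ni.
  rewrite /scale /= -h1 [w i]surjective_pairing; congr pair => /=.
  by field; rewrite !gt_eqF.
- by rewrite eval_scale // h scale1.
Qed.

End NonBoolean.

(** For r = c / d in lowest terms, ac - bd = 1 divided by d reads ar - b = 1 / d. *)
Lemma bezout_denominator (r : rat) : 0 < r -> exists a b : nat,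
  a%:R * r - b%:R = (denq r)%:~R^-1.
Proof.
move=> r0; pose c := `|numq r|%N; pose d := `|denq r|%N.
have c0 : (0 < c)%N by rewrite absz_gt0 gt_eqF // numq_gt0.
have cd : coprime c d by exact: coprime_num_den.
case: (egcdnP d c0) => a b e _; rewrite (eqP cd) in e.
have dE : (denq r)%:~R = d%:R :> rat by rewrite natr_absz gtr0_norm ?denq_gt0.
have cE : (numq r)%:~R = c%:R :> rat by rewrite natr_absz gtr0_norm ?numq_gt0.
have d0 : d%:R != 0 :> rat by rewrite pnatr_eq0 absz_eq0 denq_neq0.
exists a, b; rewrite -[r in LHS]divq_num_den dE cE.
have /(congr1 (fun k => k%:R : rat)) := e; rewrite natrD !natrM => e'.
apply: (mulIf d0); rewrite mulVf // mulrBl mulrA divfK // e'.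
by rewrite addrAC subrr add0r.
Qed.

(* The variables 1 and 2 are two multiples of the variable 0 whose difference
   has a denominator divisible by p: Bezout gives the p-th part of 0. *)
Lemma division_term (p : prime_number) (r : rat) : (sval p %| `|denq r|)%N ->
  exists tau : formula mv, forall (w : nat -> CQ) (h h' : rat),
    (forall i, CQ_dom (w i)) ->
    (w 1%N).2 = (w 0%N).2 * h -> (w 2%N).2 = (w 0%N).2 * h' -> h' - h = r ->
    eval w (Dterm (sval p) tau (Var 0%N)) = CQ_one.
Proof.
move=> pr; have r0 : r != 0.
  apply: contraTneq pr => ->; rewrite dvdn1.
  by have := prime_number_gt1 p; case: (sval p) => [|[]].
have ra0 : 0 < `|r| by rewrite normr_gt0.
have dnorm : denq `|r| = denq r.
  by have [_|_] := ger0P r; rewrite ?denqN.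
have [a [b ab]] := bezout_denominator ra0; rewrite dnorm in ab.
pose d := `|denq r|%N.
have dE : (denq r)%:~R = d%:R :> rat by rewrite natr_absz gtr0_norm ?denq_gt0.
pose part i : formula mv := infpart (Var i).
(* With g the infinitesimal part of the variable 0, [dif] is g |r|, the sign of r deciding which
   subtraction is not truncated to 0. Then e is g / d by Bezout, and q is g / p because p divides
   d. *)
pose dif := if 0 < r then monus (part 2%N) (part 1%N)
            else monus (part 1%N) (part 2%N).
pose e := monus (nmul a dif) (nmul b (part 0%N)).
pose q := nmul (d %/ sval p) e.
pose B : formula mv := boolpart (Var 0%N).
(* The p-th part is q if the variable 0 is infinitesimal and the negation of q if it is
   coinfinitesimal; B decides which. *)
exists ((q && ~~ B) || (~~ q && B))%MV => w h h' wD h1 h2 hr.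
have Id := CQ_no_symb; set g := (w 0%N).2 in h1 h2.
have g0 : 0 <= g by exact: wD.
have partE i : @eval _ CQ _ w (part i) = (false, (w i).2) by exact: (eval_infpart Id wD).
have difE : @eval _ CQ _ w dif = (false, g * `|r|).
  rewrite /dif; have [rp|rn] := ltP 0 r.
    rewrite (@eval_monus mv _ _ w _ _ _ _ (partE 2%N) (partE 1%N)) h1 h2.
    rewrite /rat_cB -mulrBr hr max_r ?gtr0_norm // mulr_ge0 // ltW //.
  rewrite (@eval_monus mv _ _ w _ _ _ _ (partE 1%N) (partE 2%N)) h1 h2.
  rewrite /rat_cB -mulrBr -opprB hr max_r ?ler0_norm // mulr_ge0 // oppr_ge0 //.
have eE : @eval _ CQ _ w e = (false, g / d%:R).
  rewrite (@eval_monus mv _ _ w _ _ _ _ (@eval_nmul_inf mv _ _ w _ _ a difE)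
     (@eval_nmul_inf mv _ _ w _ _ b (partE 0%N))).
  rewrite /rat_cB -/g (_ : _ - _ = g * (a%:R * `|r| - b%:R)); last by ring.
  rewrite ab dE; congr pair.
  by rewrite max_r // mulr_ge0 // invr_ge0.
have qE : @eval _ CQ _ w q = (false, g / (sval p)%:R).
  rewrite (@eval_nmul_inf mv _ _ w _ _ _ eE); congr pair.
  have d0 : d%:R != 0 :> rat by rewrite pnatr_eq0 absz_eq0 denq_neq0.
  have p0 : (sval p)%:R != 0 :> rat.
    by rewrite pnatr_eq0; have := prime_number_gt1 p; case: (sval p).
  by rewrite natf_div //; field; rewrite ?d0 ?p0.
have BE : @eval _ CQ _ w B = ((w 0%N).1, 0) by exact: eval_boolpart.
apply/(@eval_Dterm mv _ Id _ w) => //; first exact: prime_number_gt1.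
have nE t : @eval _ CQ _ w (~~ t)%MV = chang_neg (@eval _ CQ _ w t) by [].
have gp : 0 <= g / (sval p)%:R by rewrite mulr_ge0 // invr_ge0.
rewrite -[@eval _ CQ _ w (Var 0%N)]/(w 0%N).
have andE x y u v : @eval _ CQ _ w x = u -> @eval _ CQ _ w y = v ->
    CQ_dom u -> CQ_dom v -> @eval _ CQ _ w (x && y)%MV = match u, v with
      | (false, g), (false, h) => (false, Num.min g h)
      | (true, g), (true, h) => (true, Num.max g h)
      | (true, _), (false, h) => (false, h)
      | (false, g), (true, _) => (false, g)
      end.
  by move=> <- <- du dv; rewrite (@eval_And mv _ _ w) chang_andE.
have D0 c : CQ_dom (c, 0) by exact: lexx.
have Dp c : CQ_dom (c, g / (sval p)%:R) by [].
have nB : @eval _ CQ _ w (~~ B)%MV = (~~ (w 0%N).1, 0) by rewrite nE BE.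
have nq : @eval _ CQ _ w (~~ q)%MV = (true, g / (sval p)%:R) by rewrite nE qE.
have := andE _ _ _ _ qE nB (Dp _) (D0 _); have := andE _ _ _ _ nq BE (Dp _) (D0 _).
case: (w 0%N).1 => e1 e2.
  by rewrite (@eval_Or_zero mv _ Id _ w wD) ?e1 ?e2 /= ?max_l ?min_r.
by rewrite (@eval_Or_zeror mv _ Id _ w wD) ?e1 ?e2.
Qed.

(** The slope is the difference of the solutions at the integral points u and u + e_i. Over
    multiples of an infinitesimal g, both are named by terms of L, and homogeneity shows that their
    infinitesimal parts are g times these values, as [division_term] requires. *)
Lemma solution_divides E (L : conseq E) phi n m
    (phiN : (vbound phi <= n + m)%N)
    (existence : forall w : nat -> CQ, (forall i, CQ_dom (w i)) ->
      exists v : nat -> CQ, [/\ forall i, CQ_dom (v i),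
        forall i, (i < n)%N -> v i = w i & eval v phi = CQ_one])
    (uniqueness : forall v v' : nat -> CQ, (forall i, CQ_dom (v i)) ->
      (forall i, CQ_dom (v' i)) -> (forall i, (i < n)%N -> v i = v' i) ->
      eval v phi = CQ_one -> eval v' phi = CQ_one ->
      forall i, (i < n + m)%N -> v i = v' i) :
  is_logic L -> morphism (mv_incl E) LP L ->
  (forall a : nat -> formula E, exists s : nat -> formula E,
     (forall i, (i < n)%N -> s i = a i) /\ L set0 (subst s (mvt phi))) ->
  forall b (u : nat -> nat) i k (p : prime_number),
    (i < n)%N -> (n <= k < n + m)%N ->
    (sval p %| `|denq (slope (solH phiN existence b) (fun i => (u i)%:R) k i)|)%N ->
    exists t : formula E, L set0 (Dterm (sval p) t (Var 0%N)).
Proof.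
move=> hL LPL terms b u i k p ni /andP[nk kN] /division_term[tau htau].
pose u' l := (u l + (l == i))%N.
have [s1 [s1x s1phi]] := terms (fun l => mvt (multiple (b l) (u l))).
have [s2 [s2x s2phi]] := terms (fun l => mvt (multiple (b l) (u' l))).
(* The variable 0 is the infinitesimal. The unknowns of the two instances of phi are interleaved:
   odd indices for u, positive even indices for u'. *)
pose r (c : bool) (u : nat -> nat) l : formula mv :=
  if (l < n)%N then multiple (b l) (u l) else Var (l.*2 + c).+1.
pose s l : formula E :=
  if l is l'.+1 then (if odd l' then s2 l'./2 else s1 l'./2) else Var 0%N.
pose rt l : formula mv :=
  match l with 0%N => Var 0%N | 1%N => Var k.*2.+1 | _ => Var (k.*2 + true).+1 end.
exists (subst s (mvt (subst rt tau))).
have -> : Dterm (sval p) (subst s (mvt (subst rt tau))) (Var 0%N) =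
    subst s (mvt (subst rt (Dterm (sval p) tau (Var 0%N)))).
  by rewrite subst_Dterm translate_Dterm subst_Dterm.
apply: (CQ_rule hL LPL (G := [:: subst (r false u) phi; subst (r true u') phi])).
  move=> w wD hw.
  pose g := (w 0%N).2; have g0 : 0 <= g by exact: wD.
  have val (c : bool) (v : nat -> nat) :
      eval w (subst (r c v) phi) = CQ_one ->
      (w (k.*2 + c).+1).2 = g * solH phiN existence b (fun l => (v l)%:R) k.
    rewrite eval_subst => v1.
    have v0 : nonneg n (fun l => (v l)%:R) by move=> l _; exact: ler0n.
    have [sD sx s1' _] := solves_scale g0 (solution_solves phiN existence b v0).
    have wD' l : CQ_dom (eval w (r c v l)) by exact: CQ_eval_dom.
    have agree l : (l < n)%N -> eval w (r c v l) =
        scale g (solution phiN existence b (fun l => (v l)%:R) l).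
      by move=> ln; rewrite sx // /r ln eval_multiple // /scale /at_pattern /= ln mulrC.
    have := uniqueness _ _ wD' sD agree v1 s1' k kN.
    by rewrite /r ltnNge nk /= => ->.
  have h1 := val _ _ (hw _ (or_introl erefl)).
  have h2 := val _ _ (hw _ (or_intror (or_introl erefl))).
  rewrite addn0 in h1; rewrite eval_subst.
  apply: htau; [|exact: h1|exact: h2|].
    by move=> [|[|l]]; exact: wD.
  rewrite /slope; congr (solH _ _ _ _ _ - _); apply/funext => l.
  by rewrite /u' /bump_at natrD.
have substr (c : bool) v (s' : nat -> formula E) :
    (forall l, (l < n)%N -> s' l = mvt (multiple (b l) (v l))) ->
    (forall l, s (l.*2 + c).+1 = s' l) ->
    subst s (mvt (subst (r c v) phi)) = subst s' (mvt phi).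
  move=> sx ss; rewrite translate_subst subst_subst; apply: eq_subst => l.
  rewrite /r; case: ifP => [ln|_]; last exact: ss.
  by rewrite subst_multiple // sx.
move=> _ [<-|[<-|[]]].
  by rewrite (substr _ _ s1) // => l; rewrite addn0 /s odd_double doubleK.
by rewrite (substr _ _ s2) // => l; rewrite addn1 /s /= odd_double uphalf_double.
Qed.

(** * A finite set of formulas as a single formula *)

Section FormulaOf.
Variable Phi : fset_formulas.
Let n := nx Phi.
Let m := nz Phi.

Definition number_var (v : 'I_n + 'I_m) : nat :=
  match v with inl i => i | inr j => (n + j)%N end.

Definition numbered (chi : term mv ('I_n + 'I_m)) : formula mv :=
  subst (fun v => Var (number_var v)) chi.

Let fs := sval (cid (seq_of_finite (@formulas_finite Phi))).

Let fsP chi : formulas Phi chi <-> List.In chi fs.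
Proof. exact: (svalP (cid (seq_of_finite (@formulas_finite Phi)))). Qed.

Definition formula_of : formula mv := conj (map numbered fs).

Lemma vbound_subst V (s : V -> nat) (chi : term mv V) N :
  (forall v, (s v < N)%N) -> (vbound (subst (fun v => Var (s v)) chi) <= N)%N.
Proof. by move=> h; elim: chi => //= t1 h1 t2 h2; rewrite geq_max h1. Qed.

Lemma formula_of_vbound : (vbound formula_of <= n + m)%N.
Proof.
rewrite /formula_of; elim: fs => //= chi l IH.
rewrite !geq_max IH !andbT vbound_subst // => -[i|j] /=.
  by rewrite ltn_addr.
by rewrite ltn_add2l.
Qed.

Lemma eval_formula_of (w : nat -> CQ) : (forall i, CQ_dom (w i)) ->
  eval w formula_of = CQ_one <->
  forall chi, formulas Phi chi -> eval w (numbered chi) = CQ_one.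
Proof.
move=> wD; rewrite (@eval_conj mv _ CQ_no_symb _ _ wD); split=> h.
  by move=> chi /fsP hchi; apply: h; apply/List.in_map_iff; exists chi.
by move=> _ /List.in_map_iff[chi [<- /fsP /h]].
Qed.

Section InLogic.
Variables (E : signature) (L : conseq E).
Hypotheses (hL : is_logic L) (LPL : morphism (mv_incl E) LP L).

Lemma numbered_inst (s : nat -> formula E) chi :
  subst s (mvt (numbered chi)) =
  subst (fun v : 'I_n + 'I_m =>
    match v with inl i => s (nat_of_ord i) | inr j => s (n + j)%N end)
        (mvt chi).
Proof.
by rewrite /numbered translate_subst subst_subst; apply: eq_subst => -[].
Qed.

Lemma formula_of_inst (s : nat -> formula E) D :
  L D (subst s (mvt formula_of)) <->
  forall psi, inst (fun i : 'I_n => s i) (fun j : 'I_m => s (n + j)%N) psi -> L D psi.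
Proof.
split=> [h _ [chi hchi <-]|h].
  rewrite -numbered_inst; apply: (CQ_rule hL LPL (G := [:: formula_of])).
    by move=> w wD /(_ _ (or_introl erefl)) /(eval_formula_of wD); apply.
  by move=> _ [<-|[]].
apply: (CQ_rule hL LPL (G := map numbered fs)).
  by move=> w wD hw; apply/(eval_conj CQ_no_symb wD).
move=> _ /List.in_map_iff[chi [<- /fsP hchi]]; apply: h; rewrite numbered_inst.
by exists chi.
Qed.

Definition assemble (a : 'I_n -> formula E) (z : 'I_m -> formula E) (k : nat) :=
  if insub k is Some i then a i else
  if insub (k - n)%N is Some j then z j else Zero.

Lemma assembleE a z : (forall i : 'I_n, assemble a z i = a i) /\
  (forall j : 'I_m, assemble a z (n + j)%N = z j).
Proof.
split=> [i|j]; rewrite /assemble ?valK // insubN ?addKn ?valK //.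
by rewrite -leqNgt leq_addr.
Qed.

Lemma formula_of_inst' a z D :
  L D (subst (assemble a z) (mvt formula_of)) <->
  forall psi, inst a z psi -> L D psi.
Proof.
rewrite formula_of_inst; have [h1 h2] := assembleE a z.
by rewrite (funext h1) (funext h2).
Qed.

Lemma inst_congr (a b : 'I_n -> formula E) z D :
  (forall i, L D (a i <==> b i)%MV) ->
  (forall psi, inst b z psi -> L D psi) -> (forall psi, inst a z psi -> L D psi).
Proof.
move=> ab; rewrite -!formula_of_inst' => hb.
(* The variables 2k and 2k + 1 carry the k-th entries of (a, z) and (b, z). The unknowns are common
   to both and are read at even indices, so equal arguments make the two instances equal. *)
pose r k : formula mv := Var (if (k < n)%N then k.*2.+1 else k.*2).
pose s k := if odd k then assemble b z k./2 else assemble a z k./2.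
have sE k : s k.*2 = assemble a z k by rewrite /s odd_double doubleK.
have sO k : s k.*2.+1 = assemble b z k by rewrite /s /= odd_double uphalf_double.
have -> : subst (assemble a z) (mvt formula_of) =
    subst s (mvt (subst (fun k => Var k.*2) formula_of)).
  rewrite translate_subst subst_subst; apply: eq_subst => k /=.
  exact/esym/sE.
apply: (CQ_rule hL LPL (G := subst r formula_of ::
    [seq (Var (nat_of_ord i).*2 <==> Var (nat_of_ord i).*2.+1)%MV | i <- enum 'I_n])).
  move=> w wD hw; have h := hw _ (or_introl erefl).
  rewrite eval_subst in h; rewrite eval_subst -[RHS]h.
  apply: eq_eval_term => k /=; rewrite /r; case: ifP => // kn.
  apply/(@eval_Iff mv _ CQ_no_symb _ w (Var _) (Var _) wD); apply: hw; right.
  apply/List.in_map_iff; exists (Ordinal kn); split=> //.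
  by apply/In_mem; rewrite mem_enum.
move=> _ [<-|/List.in_map_iff[i [<- _]]].
  rewrite translate_subst subst_subst.
  rewrite (@eq_subst _ _ _ _ (assemble b z)) // => k.
  rewrite /r; case: ifP => kn; rewrite [LHS]/= ?sO // sE.
  by rewrite /assemble insubN ?kn // insubN ?kn.
have := ab i; have [h1 _] := assembleE a z; have [h2 _] := assembleE b z.
rewrite [subst s _](_ : _ = (s (nat_of_ord i).*2 <==> s (nat_of_ord i).*2.+1)%MV) //.
by rewrite sE sO h1 h2.
Qed.

Lemma semantic_unique_rule :
  (forall v v' : nat -> CQ, (forall i, CQ_dom (v i)) ->
      (forall i, CQ_dom (v' i)) -> (forall i, (i < n)%N -> v i = v' i) ->
      eval v formula_of = CQ_one -> eval v' formula_of = CQ_one ->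
      forall i, (i < n + m)%N -> v i = v' i) ->
  unique_rule Phi L.
Proof.
move=> un a y z j D; rewrite -!formula_of_inst' => hy hz.
(* The common arguments are read at even indices; the unknowns of the second instance are read at
   odd ones. *)
pose r k : formula mv := Var (if (k < n)%N then k.*2 else k.*2.+1).
pose s k := if odd k then assemble a z k./2 else assemble a y k./2.
have [_ hyj] := assembleE a y; have [_ hzj] := assembleE a z.
have sE k : s k.*2 = assemble a y k by rewrite /s odd_double doubleK.
have sO k : s k.*2.+1 = assemble a z k by rewrite /s /= odd_double uphalf_double.
have -> : (y j <==> z j)%MV =
    subst s (mvt (Var (n + j).*2 <==> Var (n + j).*2.+1)%MV).
  rewrite [RHS](_ : _ = (s (n + j).*2 <==> s (n + j).*2.+1)%MV) //.
  by rewrite sE sO hyj hzj.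
apply: (CQ_rule hL LPL (G := [:: subst (fun k => Var k.*2) formula_of;
                                 subst r formula_of])).
  move=> w wD hw; have h1 := hw _ (or_introl erefl).
  have h2 := hw _ (or_intror (or_introl erefl)); rewrite !eval_subst in h1 h2.
  apply/(@eval_Iff mv _ CQ_no_symb _ w _ _ wD) => /=.
  have e : w (n + j).*2 = eval w (r (n + j)%N).
    apply: (un _ _ _ _ _ h1 h2) => [k|k|k kn|]; try exact: wD.
      by rewrite /r kn.
    by rewrite ltn_add2l.
  by rewrite e /r ltnNge leq_addr.
move=> _ [<-|[<-|[]]]; rewrite translate_subst subst_subst.
  by rewrite (@eq_subst _ _ _ _ (assemble a y)).
rewrite (@eq_subst _ _ _ _ (assemble a z)) // => k.
rewrite /r; case: ifP => kn; rewrite [LHS]/= ?sO // sE.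
by rewrite /assemble insubT.
Qed.

End InLogic.
End FormulaOf.

(** * Equivalence is a congruence for the basic connectives *)

Section Congruence.
Variables (E : signature) (L : conseq E).
Hypotheses (hL : is_logic L) (LPL : morphism (mv_incl E) LP L).

Lemma Iff_mp (s t : formula E) D : L D (s <==> t)%MV -> L D s -> L D t.
Proof.
move=> st hs; pose r i := if i is 0%N then s else t.
apply: (@CQ_rule _ _ hL LPL [:: (Var 0%N <==> Var 1%N)%MV; Var 0%N]
  (Var 1%N) r D) => [w wD h|_ [<-|[<-|[]]] //].
have /(@eval_Iff mv _ CQ_no_symb _ w (Var _) (Var _) wD) := h _ (or_introl erefl).
by move=> /= <-; exact: (h _ (or_intror (or_introl erefl))).
Qed.

Lemma Iff_sym (s t : formula E) D : L D (s <==> t)%MV -> L D (t <==> s)%MV.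
Proof.
move=> st; pose r i := if i is 0%N then s else t.
apply: (@CQ_rule _ _ hL LPL [:: (Var 0%N <==> Var 1%N)%MV]
  (Var 1%N <==> Var 0%N)%MV r D) => [w wD h|_ [<-|[]] //].
apply/(@eval_Iff mv _ CQ_no_symb _ w (Var _) (Var _) wD)/esym.
exact/(@eval_Iff mv _ CQ_no_symb _ w (Var _) (Var _) wD)/(h _ (or_introl erefl)).
Qed.

Lemma Iff_Neg (s t : formula E) D :
  L D (s <==> t)%MV -> L D (~~ s <==> ~~ t)%MV.
Proof.
move=> st; pose r i := if i is 0%N then s else t.
apply: (@CQ_rule _ _ hL LPL [:: (Var 0%N <==> Var 1%N)%MV]
  (~~ Var 0%N <==> ~~ Var 1%N)%MV r D) => [w wD h|_ [<-|[]] //].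
apply/(@eval_Iff mv _ CQ_no_symb _ w _ _ wD).
have /(@eval_Iff mv _ CQ_no_symb _ w (Var _) (Var _) wD) := h _ (or_introl erefl).
by move=> /= ->.
Qed.

Lemma Iff_Plus (s t s' t' : formula E) D : L D (s <==> t)%MV ->
  L D (s' <==> t')%MV -> L D (s + s' <==> t + t')%MV.
Proof.
move=> st tu.
pose r i := match i with 0%N => s | 1%N => t | 2%N => s' | _ => t' end.
apply: (@CQ_rule _ _ hL LPL [:: (Var 0%N <==> Var 1%N)%MV; (Var 2%N <==> Var 3%N)%MV]
  (Var 0%N + Var 2%N <==> Var 1%N + Var 3%N)%MV r D)
  => [w wD h|_ [<-|[<-|[]]] //].
have iff i j := @eval_Iff mv _ CQ_no_symb _ w (Var i) (Var j) wD.
have e1 : w 0%N = w 1%N by apply/iff; exact: (h _ (or_introl erefl)).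
have e2 : w 2%N = w 3%N by apply/iff; exact: (h _ (or_intror (or_introl erefl))).
by apply/(@eval_Iff mv _ CQ_no_symb _ w _ _ wD); rewrite /= e1 e2.
Qed.

Lemma Iff_refl (s : formula E) D : L D (s <==> s)%MV.
Proof.
apply: (@CQ_rule _ _ hL LPL [::]
  (Var 0%N <==> Var 0%N)%MV (fun=> s) D) => //.
by move=> w wD _; apply/(@eval_Iff mv _ CQ_no_symb _ w _ _ wD).
Qed.

Lemma Iff_interderivable (s t : formula E) :
  L set0 (s <==> t)%MV -> interderivable L s t.
Proof.
move=> st; split.
  apply: (@Iff_mp s); first exact: (logic_thm hL _ st).
  exact: (logic_refl hL).
apply: (@Iff_mp t); first exact: (logic_thm hL _ (Iff_sym st)).
exact: (logic_refl hL).
Qed.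

End Congruence.

(** * Rigidity, and expansions without excluded middle *)

Section ExpansionFacts.
Variable Sigma : set fset_formulas.
Local Notation sg := (sig_of Sigma).
Local Notation EX := (expansion LP Sigma).

Let hEX : is_logic EX := expansion_logic Sigma.
Let LPEX : morphism (mv_incl sg) LP EX := @expansion_LP Sigma.

(* Uniqueness makes every endomorphism of the expansion the identity. *)
Lemma expansion_rigid (R : translation sg sg) : morphism R EX EX ->
  forall phi, EX set0 (phi <==> translate R phi)%MV.
Proof.
move=> hR; elim=> [i||t IH|t1 IH1 t2 IH2|f a IH].
- exact: (Iff_refl hEX LPEX).
- exact: (Iff_refl hEX LPEX).
- exact: (Iff_Neg hEX LPEX).
- exact: (Iff_Plus hEX LPEX).
case: f a IH => Phi j a IH; pose b i := translate R (a i).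
(* R carries the axioms of Phi to the statement that z solves Phi over b. By congruence z solves Phi
   over a, and uniqueness compares it with the connectives applied to a. *)
pose z j' := subst b (R (existT _ Phi j')).
apply: (@expansion_unique Sigma Phi a (@fsymb Sigma Phi a) z j).
  by move=> psi; exact: expansion_exist.
apply: (inst_congr hEX LPEX (b := b)) => // psi hpsi.
pose x (i : 'I_(nx (sval Phi))) : formula sg := Var (nat_of_ord i).
have hx chi : inst x (fun j' => subst x (R (existT _ Phi j'))) chi -> EX set0 chi.
  have -> : inst x (fun j' => subst x (R (existT _ Phi j'))) =
      translate R @` inst x (@fsymb Sigma Phi x) by rewrite translate_inst.
  by move=> [xi /expansion_exist /hR + <-]; rewrite image_set0.
have : (subst (assemble b (z : 'I_(nz (sval Phi)) -> formula sg)) @`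
    inst x (fun j' => subst x (R (existT _ Phi j')))) psi.
  rewrite subst_inst; move: hpsi; congr (inst _ _ _).
    by apply/funext => i /=; have [-> _] := assembleE b z.
  apply/funext => j' /=; rewrite subst_subst; apply: eq_subst => i /=.
  by have [-> _] := assembleE b z.
by move=> [chi /hx hchi <-]; exact: (logic_struct0 hEX).
Qed.

Lemma expansion_terms (Phi : {Phi | Sigma Phi}) (a : nat -> formula sg) :
  exists s : nat -> formula sg,
    (forall i, (i < nx (sval Phi))%N -> s i = a i) /\
    EX set0 (subst s (mvt (formula_of (sval Phi)))).
Proof.
pose a' (i : 'I_(nx (sval Phi))) := a i.
exists (assemble a' (@fsymb Sigma Phi a')); split.
  by move=> i ni; rewrite /assemble insubT.
by apply/(formula_of_inst' hEX LPEX) => psi; exact: expansion_exist.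
Qed.

Section NonBooleanExpansion.
Hypothesis nonboolean : ~ EX set0 (mvt em_formula).

Lemma nonboolean_solution (Phi : {Phi | Sigma Phi}) (w : nat -> CQ) :
  (forall i, CQ_dom (w i)) ->
    exists v : nat -> CQ, [/\ forall i, CQ_dom (v i),
      forall i, (i < nx (sval Phi))%N -> v i = w i &
      eval v (formula_of (sval Phi)) = CQ_one].
Proof. exact: (nonboolean_existence hEX LPEX nonboolean (expansion_terms Phi)). Qed.

(** With variables for the unknowns, uniqueness is a finite rule in the language of LP, so it passes
    from the expansion to the Chang algebra. *)
Lemma nonboolean_unique (Phi : {Phi | Sigma Phi}) (v v' : nat -> CQ) :
  (forall i, CQ_dom (v i)) -> (forall i, CQ_dom (v' i)) ->
  (forall i, (i < nx (sval Phi))%N -> v i = v' i) ->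
  eval v (formula_of (sval Phi)) = CQ_one ->
  eval v' (formula_of (sval Phi)) = CQ_one ->
  forall i, (i < nx (sval Phi) + nz (sval Phi))%N -> v i = v' i.
Proof.
set n := nx _; set m := nz _; set phi := formula_of _ => vD v'D vv v1 v'1 k kN.
have [kn|nk] := ltnP k n; first exact: vv.
have km : (k - n < m)%N by rewrite ltn_subLR.
pose y i : formula mv := Var i.*2.
pose z i : formula mv := Var (if (i < n)%N then i.*2 else i.*2.+1).
have rule : EX (translate (mv_incl sg) @`
      [set psi | List.In psi [:: subst y phi; subst z phi]])
    (mvt (Var k.*2 <==> Var k.*2.+1)%MV).
  have hyp (r : nat -> formula mv) D : D (mvt (subst r phi)) -> forall psi : formula sg,
      inst (fun i : 'I_n => mvt (r i)) (fun j : 'I_m => mvt (r (n + j)%N)) psi ->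
      EX D psi.
    move=> hD; apply/(@formula_of_inst (sval Phi) _ _ hEX LPEX (fun i => mvt (r i))).
    by rewrite -translate_subst; exact: (logic_refl hEX).
  have := @expansion_unique Sigma Phi (fun i : 'I_n => mvt (y i))
    (fun j : 'I_m => mvt (y (n + j)%N)) (fun j : 'I_m => mvt (z (n + j)%N)) (Ordinal km).
  have zk : z k = Var k.*2.+1 by rewrite /z ltnNge nk.
  rewrite [nat_of_ord _]/= subnKC // zk; apply.
    by apply: hyp; exists (subst y phi) => //; left.
  move=> psi; rewrite (_ : (fun i : 'I_n => mvt (y i)) = fun i : 'I_n => mvt (z i)).
    by move: psi; apply: hyp; exists (subst z phi) => //; right; left.
  by apply/funext => i; rewrite /y /z ltn_ord.
pose w i := if odd i then v' i./2 else v i./2.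
have wD i : CQ_dom (w i) by rewrite /w; case: ifP.
have wE i : w i.*2 = v i by rewrite /w odd_double doubleK.
have wO i : w i.*2.+1 = v' i by rewrite /w /= odd_double uphalf_double.
have := nonboolean_rule hEX LPEX nonboolean rule wD.
rewrite (@eval_Iff mv _ CQ_no_symb _ w (Var _) (Var _) wD) /= wE wO; apply.
move=> _ [<-|[<-|[]]]; rewrite eval_subst.
  by rewrite (@eq_eval_term _ _ _ _ v).
rewrite (@eq_eval_term _ _ _ _ v') // => i; rewrite /z /=.
by case: ifP => h; rewrite ?wO // wE vv.
Qed.

(** By [solution_divides] this set contains every prime factor of a denominator of a slope, so the
    new connectives become terms of [LPS S]; conversely, its divisions are terms of the
    expansion. *)
Definition definable_divisions : set prime_number :=
  [set p | exists t : formula sg, EX set0 (Dterm (sval p) t (Var 0%N))].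

Let S := definable_divisions.

Lemma nonboolean_term (f : symb sg) : exists t : term (sigS S) 'I_(arity f),
  forall (w : nat -> CQS S) v, (forall i, CQ_dom (w i)) ->
    solves (formula_of (sval (projT1 f))) (nx (sval (projT1 f)))
      (nz (sval (projT1 f))) w v ->
    eval (fun i : 'I_(arity f) => w i) t =
    v (nx (sval (projT1 f)) + nat_of_ord (projT2 f))%N.
Proof.
case: f => Phi j /=.
have jN : (nx (sval Phi) <= nx (sval Phi) + j < nx (sval Phi) + nz (sval Phi))%N.
  by rewrite leq_addr ltn_add2l ltn_ord.
have den := solution_divides (phiN := formula_of_vbound (sval Phi))
  (existence := @nonboolean_solution Phi) (@nonboolean_unique Phi)
  hEX LPEX (expansion_terms Phi).
have [t ht] := implicit_term (S := S) (@nonboolean_unique Phi) den jN.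
exists t => w v wD wv.
exact: (ht _ w).
Qed.

Definition toS : translation sg (sigS S) := fun f => sval (cid (nonboolean_term f)).

Lemma toSP (f : symb sg) (w : nat -> CQS S) v : (forall i, CQ_dom (w i)) ->
  solves (formula_of (sval (projT1 f))) (nx (sval (projT1 f)))
    (nz (sval (projT1 f))) w v ->
  eval (fun i : 'I_(arity f) => w i) (toS f) =
  v (nx (sval (projT1 f)) + nat_of_ord (projT2 f))%N.
Proof. exact: (svalP (cid (nonboolean_term f))). Qed.

Lemma toS_morphism : morphism toS EX (LPS S).
Proof.
apply: expansion_morphism; [exact: LPS_logic|exact: LPS_LP| |].
  move=> Phi; set x := fun i => Var _; set y := fun j => subst _ _.
  apply/(formula_of_inst' (LPS_logic S) (@LPS_LP S)).
  apply: LPS_complete => // w wD _.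
  rewrite eval_subst eval_mv_incl.
  have [v wv] :=
    solves_exists (formula_of_vbound (sval Phi)) (@nonboolean_solution Phi) wD.
  have [_ vw v1 _] := wv; rewrite -[RHS]v1; apply: eq_eval_vbound => k hk.
  have {hk} kN := leq_trans hk (formula_of_vbound _).
  have [h1 h2] := assembleE x y.
  have [kn|nk] := ltnP k (nx (sval Phi)).
    by rewrite (h1 (Ordinal kn)) /= vw.
  have km : (k - nx (sval Phi) < nz (sval Phi))%N by rewrite ltn_subLR.
  have := h2 (Ordinal km); rewrite /= subnKC // => ->.
  have := @toSP (existT _ Phi (Ordinal km)) w v wD wv; rewrite /= subnKC // => <-.
  by rewrite /y eval_subst.
move=> Phi; apply: semantic_unique_rule; [exact: LPS_logic|exact: LPS_LP|].
exact: nonboolean_unique.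
Qed.

(** The defining formula of a division may contain several variables; identifying all of them with
    the argument preserves D_p. *)
Definition fromS : translation (sigS S) sg :=
  fun p => subst (fun=> Var ord0) (sval (cid (svalP p))).

Lemma fromS_morphism : morphism fromS (LPS S) EX.
Proof.
apply: (@least_logic_min _ _ (pullback fromS EX)); first exact: pullback_logic.
split=> [G phi|p].
  move=> /LPEX; rewrite /pullback image_comp translate_mv_incl.
  congr (EX (_ @` _) _); apply/funext => psi /=; by rewrite translate_mv_incl.
rewrite /pullback image_set0 axDE.
rewrite translate_Dterm /= subst_subst.
have := logic_struct0 hEX (fun=> Var 0%N) (svalP (cid (svalP p))).
by rewrite subst_Dterm.
Qed.

(** The image of d_p again satisfies D_p, which has only one solution in the Chang algebra. *)
Lemma eval_endo (R : translation (sigS S) (sigS S)) : morphism R (LPS S) (LPS S) ->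
  forall (w : nat -> CQS S) t, (forall i, CQ_dom (w i)) ->
  eval w (translate R t) = eval w t.
Proof.
move=> hR w t wD; elim: t => //= [t ->|t1 -> t2 ->|p a IH] //.
rewrite eval_subst (funext IH).
have := (LPS_spec S).2.2 p => /hR.
rewrite image_set0 axDE.
rewrite translate_Dterm => /LPS_sound /sem_thm h.
have aD : CQ_dom (eval w (a ord0)) by exact: CQS_dom.
have := h (fun=> eval w (a ord0)) (fun=> aD).
move=> /(eval_axD p _ _ (fun=> aD)) /=; rewrite eval_subst /= => h1.
rewrite /divI -h1 (_ : (fun i => eval w (a i)) = fun=> eval w (a ord0)) //.
by apply/funext => i; rewrite ord1.
Qed.

Lemma nonboolean_equipollent : equipollent EX (LPS S).
Proof.
exists toS, fromS; split.
- exact: toS_morphism.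
- exact: fromS_morphism.
- move=> phi; rewrite translate_comp; apply: (Iff_interderivable hEX LPEX).
  by apply: expansion_rigid; exact: morphism_comp toS_morphism fromS_morphism.
- move=> psi; rewrite translate_comp.
  apply: (Iff_interderivable (LPS_logic S) (@LPS_LP S)).
  apply: LPS_complete => // w wD _; apply/(@eval_Iff _ _ (@divI_dom S) _ w) => //.
  by rewrite (eval_endo (morphism_comp fromS_morphism toS_morphism)).
Qed.

End NonBooleanExpansion.
End ExpansionFacts.

(** * Boolean expansions *)

Definition bool_alg : algebra mv :=
  @Algebra mv bool false negb orb (fun f => match f with end).

Lemma bevalE v t : beval v t = @eval _ bool_alg _ v t.
Proof. by elim: t => //= [t ->|t1 -> t2 ->]. Qed.

Lemma eval_CQ_bool V (v : V -> bool) (t : term mv V) :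
  @eval _ CQ _ (fun i => (v i, 0)) t = (@eval _ bool_alg _ v t, 0).
Proof.
elim: t => [//|//|t IH|t1 IH1 t2 IH2|[]]; rewrite [LHS]/= ?IH ?IH1 ?IH2 //.
rewrite /chang_plus [in RHS]/=.
have cB0 : rat_cB 0 0 = 0 by rewrite /rat_cB subrr maxxx.
by case: (@eval mv bool_alg _ v t1); case: (@eval mv bool_alg _ v t2);
  rewrite /= ?cB0 ?addr0.
Qed.

(** An axiomatic presentation of classical logic over LP: minimality then gives morphisms out of
    it. *)
Definition LB : conseq mv := least_logic (fun L =>
  (forall G phi, LP G phi -> L G phi) /\ L set0 em_formula).

Lemma LB_spec : is_logic LB /\
  ((forall G phi, LP G phi -> LB G phi) /\ LB set0 em_formula).
Proof.
apply: least_logicP; apply: finitary_and; last exact: finitary_thm.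
exact: finitary_sub LP_logic.
Qed.

Lemma LB_sound G phi : LB G phi -> classical G phi.
Proof.
move=> hLB; suff [F [_ FG h]] : @sem mv bool_alg setT true G phi.
  move=> v hv; rewrite bevalE; apply: h => // psi /FG; rewrite -bevalE; exact: hv.
move: G phi hLB; apply: least_logic_min; first by apply: sem_logic.
split=> [G phi /LP_sound[F [finF FG h]]|].
  exists F; split=> // v _ hv; have := h (fun i => (v i, 0)).
  rewrite eval_CQ_bool => h'; apply: (congr1 fst (h' _ _)).
    by move=> i; exact: lexx.
  by move=> psi /hv; rewrite eval_CQ_bool => ->.
by apply/sem_thm => v _ /=; case: (v 0%N).
Qed.

Section ChangZero.
Variable K : cone.

Lemma cB00 : cB (c0 K) (c0 K) = c0 K.
Proof.
by have [[_ //]|[h _]] := ctotal (cpos0 K) (cpos0 K); rewrite c0D in h.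
Qed.

(** The equation says that a truncated difference is 0: that of g + g and g for coinfinitesimal u,
    that of g and 0 for infinitesimal u. *)
Lemma chang_em (u : chang K) : cpos u.2 ->
  chang_plus (chang_neg (chang_plus (chang_neg u) (chang_neg u))) (chang_neg u) =
  (true, c0 K) -> u.2 = c0 K.
Proof.
case: u => [[] g] /= pg [].
  have pgg := cposD pg pg.
  have [[h _] _|[h _] e] := ctotal pgg pg.
    rewrite -cDA in h; apply: (@cD_eq0 _ g (cB g (cD g g))) => //.
      exact: cposB.
    by apply: cD_idem h => //; apply: cposD => //; exact: cposB.
  by rewrite e cD0 in h; apply: cD_idem (esym h).
have [[h _] _|[h _] e] := ctotal pg (cpos0 K).
  by apply: cD_eq0 (esym h) => //; apply: cposB => //; exact: cpos0.
by rewrite h e cD0.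
Qed.

Lemma eval_chang_bool V (v : V -> bool) (t : term mv V) :
  @eval _ (chang K) _ (fun i => (v i, c0 K)) t = (@eval _ bool_alg _ v t, c0 K).
Proof.
elim: t => [//|//|t IH|t1 IH1 t2 IH2|[]]; rewrite [LHS]/= ?IH ?IH1 ?IH2 //.
rewrite /chang_plus [in RHS]/=.
by case: (@eval mv bool_alg _ v t1); case: (@eval mv bool_alg _ v t2);
  rewrite /= ?cB00 ?cD0.
Qed.

End ChangZero.

(** Excluded middle kills all infinitesimal parts in the valuation of a prime theory, which is
    therefore Boolean. As G may be infinite, this also yields the compactness of [classical]. *)
Lemma LB_complete G phi : classical G phi -> LB G phi.
Proof.
move=> hG; apply: contrapT => nphi.
have [hL [LPLB em]] := LB_spec.
have hTh := logic_theory G hL LPLB.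
have [Q [hQ ThQ Qphi primeQ]] := prime_theory hTh nphi.
have [K [w [wpos wQ]]] := prime_valuation hQ Qphi primeQ.
have w0 i : (w i).2 = c0 K.
  apply: chang_em => //; apply: (proj1 (wQ (subst (fun=> Var i) em_formula))).
  by apply: ThQ; apply: (logic_thm hL); exact: (logic_struct0 hL).
have wE psi : eval w psi = (beval (fun i => (w i).1) psi, c0 K).
  rewrite bevalE -eval_chang_bool; congr (eval _ _); apply/funext => i.
  by rewrite [LHS]surjective_pairing w0.
apply: Qphi; apply/wQ; rewrite wE hG // => psi Gpsi.
have /wQ : Q psi by apply: ThQ; exact: (logic_refl hL).
by rewrite wE => -[].
Qed.

Lemma classical_LB : classical = LB.
Proof.
apply/funext => G; apply/funext => phi; apply/propext.
by split; [exact: LB_complete|exact: LB_sound].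
Qed.

Lemma classical_logic : is_logic classical.
Proof. by rewrite classical_LB; case: LB_spec. Qed.

Lemma mv_incl_mv (t : formula mv) : translate (mv_incl mv) t = t.
Proof. exact: translate_mv_id. Qed.

Lemma classical_LP : morphism (mv_incl mv) LP classical.
Proof.
move=> G phi /LB_spec.2.1 /LB_sound; rewrite mv_incl_mv.
rewrite (_ : translate (mv_incl mv) @` G = G) //.
by rewrite (funext mv_incl_mv) image_id.
Qed.

Section BooleanLogic.
Variables (E : signature) (L : conseq E).
Hypotheses (hL : is_logic L) (LPL : morphism (mv_incl E) LP L).
Hypothesis boolean : L set0 (mvt em_formula).

Lemma boolean_classical : morphism (mv_incl E) classical L.
Proof.
rewrite classical_LB.
apply: (@least_logic_min _ _ (pullback (mv_incl E) L)); first exact: pullback_logic.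
by split; [exact: LPL|rewrite /pullback image_set0].
Qed.

Lemma classical_rule (G : set (formula mv)) phi s D :
  classical G phi -> (forall psi, G psi -> L D (subst s (mvt psi))) ->
  L D (subst s (mvt phi)).
Proof.
move=> /boolean_classical /(logic_struct hL s) /(logic_cut hL) h hD.
by apply: h => _ [_ [psi /hD + <-] <-].
Qed.

End BooleanLogic.

Lemma inconsistent_all E (L : conseq E) : is_logic L ->
  morphism (mv_incl E) LP L -> L set0 Zero -> forall G phi, L G phi.
Proof.
move=> hL LPL L0 G phi; apply: (logic_thm hL).
apply: (@CQ_rule _ _ hL LPL [:: Zero] (Var 0%N) (fun=> phi) set0) => [w wD h|].
  by have := h _ (or_introl erefl).
by move=> _ [<-|[]].
Qed.

Lemma inconsistent_equipollent E (L : conseq E) : is_logic L ->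
  morphism (mv_incl E) LP L -> L set0 Zero -> equipollent L inconsistent.
Proof.
move=> hL LPL /(inconsistent_all hL LPL) all.
by exists (fun=> Zero), (mv_incl E); split=> // *; split.
Qed.

Definition const E (b : bool) : formula E := if b then One else Zero.

Lemma beval_const v b : beval v (const mv b) = b. Proof. by case: b. Qed.

Lemma mvt_const E b : mvt (const mv b) = const E b. Proof. by case: b. Qed.

Lemma subst_const E b (s : nat -> formula E) : subst s (const E b) = const E b.
Proof. by case: b. Qed.

Lemma beval_subst v (s : nat -> formula mv) t :
  beval v (subst s t) = beval (fun i => beval v (s i)) t.
Proof.
rewrite [LHS]bevalE [RHS]bevalE eval_subst.
by rewrite (funext (fun i => bevalE v (s i))).
Qed.

Lemma eq_beval_vbound (v v' : nat -> bool) t :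
  (forall i, (i < vbound t)%N -> v i = v' i) -> beval v t = beval v' t.
Proof. by rewrite !bevalE => h; exact: (@eq_eval_vbound bool_alg). Qed.

Lemma beval_Iff v s t : beval v (s <==> t)%MV = (beval v s == beval v t).
Proof. by rewrite /=; case: (beval v s); case: (beval v t). Qed.

Section BooleanExpansion.
Variable Sigma : set fset_formulas.
Local Notation sg := (sig_of Sigma).
Local Notation EX := (expansion LP Sigma).

Let hEX : is_logic EX := expansion_logic Sigma.
Let LPEX : morphism (mv_incl sg) LP EX := @expansion_LP Sigma.

Hypothesis boolean : EX set0 (mvt em_formula).
Hypothesis consistent : ~ EX set0 Zero.

(** Applied to constants, the new connectives solve Phi. If no Boolean assignment did, this instance
    of Phi would be classically refutable and the expansion would prove 0. *)
Lemma boolean_solution (Phi : {Phi | Sigma Phi}) (v : nat -> bool) :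
  exists v' : nat -> bool, (forall i, (i < nx (sval Phi))%N -> v' i = v i) /\
    beval v' (formula_of (sval Phi)).
Proof.
apply: contrapT => nex; apply: consistent.
have [s [sx s1]] := expansion_terms Phi (fun i => const sg (v i)).
pose r i : formula mv := if (i < nx (sval Phi))%N then const mv (v i) else Var i.
apply: (classical_rule hEX LPEX boolean (G := [set subst r (formula_of (sval Phi))])
  (phi := Zero) (s := s)).
  move=> u /(_ _ erefl); rewrite beval_subst => h; case: nex.
  exists (fun i => beval u (r i)); split=> // i ni.
  by rewrite /r ni beval_const.
move=> _ ->; rewrite translate_subst subst_subst.
rewrite (@eq_subst _ _ _ _ s) // => i; rewrite /r; case: ifP => // ni.
by rewrite mvt_const subst_const sx.
Qed.

(** Both assignments, written with constants, are provable solutions, so the expansion proves that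
    their entries are equivalent; distinct constants would make it inconsistent. *)
Lemma boolean_unique (Phi : {Phi | Sigma Phi}) (v v' : nat -> bool) :
  (forall i, (i < nx (sval Phi))%N -> v i = v' i) ->
  beval v (formula_of (sval Phi)) -> beval v' (formula_of (sval Phi)) ->
  forall i, (i < nx (sval Phi) + nz (sval Phi))%N -> v i = v' i.
Proof.
set n := nx _; set m := nz _; set phi := formula_of _ => vv v1 v'1 k kN.
have [kn|nk] := ltnP k n; first exact: vv.
have km : (k - n < m)%N by rewrite ltn_subLR.
have thm (u : nat -> bool) : beval u phi -> forall psi : formula sg,
    inst (fun i : 'I_n => const sg (u i)) (fun j : 'I_m => const sg (u (n + j)%N)) psi ->
    EX set0 psi.
  move=> u1; apply/(@formula_of_inst (sval Phi) _ _ hEX LPEX (fun i => const sg (u i))).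
  have := @classical_rule _ _ hEX LPEX boolean set0
    (subst (fun i => const mv (u i)) phi) Var set0.
  rewrite subst_Var translate_subst
    (_ : (fun i => mvt (const mv (u i))) = fun i => const sg (u i)).
    apply=> // w _; rewrite beval_subst.
    by rewrite (_ : (fun i => beval w (const mv (u i))) = u) //; apply/funext => i;
      exact: beval_const.
  by apply/funext => i; exact: mvt_const.
have := @expansion_unique Sigma Phi (fun i : 'I_n => const sg (v i))
    (fun j : 'I_m => const sg (v (n + j)%N)) (fun j : 'I_m => const sg (v' (n + j)%N))
    (Ordinal km) set0 (thm _ v1).
rewrite [nat_of_ord _]/= subnKC // => h.
have {}h : EX set0 (const sg (v k) <==> const sg (v' k))%MV.
  apply: h => psi.
  rewrite (_ : (fun i : 'I_n => const sg (v i)) =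
    fun i : 'I_n => const sg (v' i)).
    exact: thm.
  by apply/funext => i; rewrite vv.
apply: contrapT => ne; apply: consistent.
apply: (classical_rule hEX LPEX boolean (phi := Zero) (s := Var)
  (G := [set (const mv (v k) <==> const mv (v' k))%MV])).
  by move=> u /(_ _ erefl); rewrite beval_Iff !beval_const => /eqP.
move=> _ ->; rewrite subst_Var [translate _ _](_ : _ =
  (mvt (const mv (v k)) <==> mvt (const mv (v' k)))%MV) //.
by rewrite !mvt_const.
Qed.

(** Disjunctive normal form: the minterms [chi b] of the patterns b at which the entry n + j of the
    solution is true. *)
Lemma boolean_term (f : symb sg) : exists t : term mv 'I_(arity f),
  forall v v' : nat -> bool,
    (forall i, (i < nx (sval (projT1 f)))%N -> v' i = v i) ->
    beval v' (formula_of (sval (projT1 f))) ->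
    @eval _ bool_alg _ (fun i : 'I_(arity f) => v i) t =
    v' (nx (sval (projT1 f)) + nat_of_ord (projT2 f))%N.
Proof.
case: f => Phi j /=; set n := nx (sval Phi).
have kN : (n + j < n + nz (sval Phi))%N by rewrite ltn_add2l.
pose ext (b : {ffun 'I_n -> bool}) (i : nat) := oapp b false (insub i).
have /choice[g gP] (b : {ffun 'I_n -> bool}) := boolean_solution Phi (ext b).
pose lit (c : bool) (t : term mv 'I_n) := if c then t else (~~ t)%MV.
pose chi (b : {ffun 'I_n -> bool}) := conj [seq lit (b i) (Var i) | i <- enum 'I_n].
exists (disj [seq chi b | b <- enum {ffun 'I_n -> bool} & g b (n + j)%N]).
move=> v v' vv v1; pose w (i : 'I_n) : bool_alg := v i.
have litE b i : eval w (lit (b i) (Var i)) = (b i == v i :> bool).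
  by rewrite /lit; case: (b i); rewrite /= /w; case: (v i).
have chiE b : eval w (chi b) = (b == [ffun i : 'I_n => v i]).
  have -> : eval w (chi b) = all (fun i : 'I_n => b i == v i) (enum 'I_n).
    rewrite /chi; elim: (enum 'I_n) => //= i s <-.
    by rewrite litE; case: (b i == v i); case: (eval w _).
  apply/allP/eqP => [h|-> i _]; last by rewrite ffunE.
  by apply/ffunP => i; rewrite ffunE; apply/eqP/h; rewrite mem_enum.
have disjE s : eval w (disj [seq chi b | b <- s]) = ([ffun i : 'I_n => v i] \in s).
  elim: s => //= b s; rewrite /disj => ->; rewrite inE chiE eq_sym.
  by case: (_ == b); case: (_ \in s).
rewrite -/w disjE mem_filter mem_enum andbT.
have [ge g1] := gP [ffun i : 'I_n => v i].
apply: (@boolean_unique Phi) => // i ni.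
by rewrite ge // vv // /ext insubT /= ffunE.
Qed.

Definition to_bool : translation sg mv := fun f => sval (cid (boolean_term f)).

Lemma to_boolP (f : symb sg) (v v' : nat -> bool) :
  (forall i, (i < nx (sval (projT1 f)))%N -> v' i = v i) ->
  beval v' (formula_of (sval (projT1 f))) ->
  @eval _ bool_alg _ (fun i : 'I_(arity f) => v i) (to_bool f) =
  v' (nx (sval (projT1 f)) + nat_of_ord (projT2 f))%N.
Proof. exact: (svalP (cid (boolean_term f))). Qed.

Lemma to_bool_morphism : morphism to_bool EX classical.
Proof.
apply: expansion_morphism; [exact: classical_logic|exact: classical_LP| |].
  move=> Phi; set x := fun i => Var _; set y := fun j => subst _ _.
  apply/(formula_of_inst' classical_logic classical_LP) => v _.
  rewrite beval_subst mv_incl_mv; have [v' [v'v v'1]] := boolean_solution Phi v.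
  rewrite (eq_beval_vbound (v' := v')) // => k hk.
  have {hk} kN := leq_trans hk (formula_of_vbound _).
  have [h1 h2] := assembleE x y.
  have [kn|nk] := ltnP k (nx (sval Phi)).
    by rewrite (h1 (Ordinal kn)) /= v'v.
  have km : (k - nx (sval Phi) < nz (sval Phi))%N by rewrite ltn_subLR.
  have := h2 (Ordinal km); rewrite /= subnKC // => ->.
  have := @to_boolP (existT _ Phi (Ordinal km)) v v' v'v v'1.
  by rewrite /= subnKC // => <-; rewrite /y bevalE eval_subst.
move=> Phi a y z j D.
rewrite -!(formula_of_inst' classical_logic classical_LP) !mv_incl_mv => hy hz v hv.
have := hy v hv; have := hz v hv; rewrite beval_Iff !beval_subst => h2 h1.
have [yx yz] := assembleE a y; have [zx zz] := assembleE a z.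
rewrite -yz -zz; apply/eqP; apply: (boolean_unique _ h1 h2); last by rewrite ltn_add2l.
by move=> i ni; rewrite (yx (Ordinal ni)) (zx (Ordinal ni)).
Qed.

Lemma boolean_equipollent : equipollent EX classical.
Proof.
exists to_bool, (mv_incl sg); split.
- exact: to_bool_morphism.
- exact: boolean_classical.
- move=> phi; rewrite translate_comp; apply: (Iff_interderivable hEX LPEX).
  apply: expansion_rigid; apply: morphism_comp to_bool_morphism _.
  exact: boolean_classical.
- move=> psi; rewrite translate_mv_incl mv_incl_mv.
  by split; apply: (logic_refl classical_logic).
Qed.

End BooleanExpansion.

(** * Classification *)

Lemma expansion_classification (Sigma : set fset_formulas) :
  exists k : listed, equipollent (expansion LP Sigma) (listed_logic k).
Proof.
have hEX := expansion_logic Sigma; have LPEX := @expansion_LP Sigma.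
have [bool|nonbool] := pselect (expansion LP Sigma set0 (mvt em_formula)); last first.
  exists (Perfect (definable_divisions Sigma)); exact: nonboolean_equipollent.
have [incons|cons] := pselect (expansion LP Sigma set0 Zero).
  by exists Inconsistent; exact: inconsistent_equipollent.
by exists Classical; exact: boolean_equipollent.
Qed.

Lemma prime_number_inj (p q : prime_number) : sval p = sval q -> p = q.
Proof. by case: p q => p hp [q hq] /= pq; exact: eq_exist. Qed.

(** * Comparison of the listed logics *)

Definition S_rational (S : set prime_number) (r : rat) : Prop :=
  exists (a : int) (d : nat), [/\ (0 < d)%N,
    forall p : prime_number, (sval p %| d)%N -> S p & r = a%:~R / d%:R].

Section SRational.
Variable S : set prime_number.

Lemma S_rational_int (a : int) : S_rational S a%:~R.
Proof.
exists a, 1%N; split=> //; last by rewrite divr1.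
move=> p; rewrite dvdn1 => /eqP p1; have := prime_number_gt1 p.
by rewrite p1.
Qed.

Lemma S_rationalD r s : S_rational S r -> S_rational S s -> S_rational S (r + s).
Proof.
move=> [a [d [d0 dS ->]]] [b [e [e0 eS ->]]].
exists (a * e%:Z + b * d%:Z)%R, (d * e)%N; split.
- by rewrite muln_gt0 d0.
- by move=> p; rewrite Euclid_dvdM ?(svalP p) // => /orP[/dS|/eS].
rewrite intrD !intrM natrM -!pmulrn; field.
by rewrite !pnatr_eq0 -!lt0n d0 e0.
Qed.

Lemma S_rationalN r : S_rational S r -> S_rational S (- r).
Proof.
by move=> [a [d [d0 dS ->]]]; exists (- a), d; split; rewrite // intrN mulNr.
Qed.

Lemma S_rational_cB r s : S_rational S r -> S_rational S s ->
  S_rational S (rat_cB r s).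
Proof.
move=> hr hs; rewrite /rat_cB; have [_|_] := leP 0 (r - s).
  by apply: S_rationalD => //; exact: S_rationalN.
exact: (S_rational_int 0).
Qed.

Lemma S_rational_div r (p : prime_number) : S p ->
  S_rational S r -> S_rational S (r / (sval p)%:R).
Proof.
move=> pS [a [d [d0 dS ->]]]; exists a, (d * sval p)%N; split.
- by rewrite muln_gt0 d0 ltnW // prime_number_gt1.
- move=> q; rewrite Euclid_dvdM ?(svalP q) // => /orP[/dS //|].
  rewrite dvdn_prime2 ?(svalP q) ?(svalP p) // => /eqP qp.
  by rewrite (prime_number_inj qp).
by rewrite natrM invfM mulrA.
Qed.

(** From 1 / p = a / d it follows that d = ap, so p divides d. *)
Lemma S_rational_inv (p : prime_number) : S_rational S (1 / (sval p)%:R) -> S p.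
Proof.
move=> [a [d [d0 dS e]]]; apply: dS.
have p0 : (sval p)%:R != 0 :> rat by rewrite pnatr_eq0 -lt0n ltnW // prime_number_gt1.
have d0' : d%:R != 0 :> rat by rewrite pnatr_eq0 -lt0n.
have dE : d%:Z = (a * (sval p)%:Z)%R.
  apply/eqP; rewrite -(eqr_int rat) intrM -!pmulrn; apply/eqP.
  have -> : d%:R = d%:R * (sval p)%:R * (1 / (sval p)%:R) :> rat by field.
  by rewrite e; field.
by rewrite -[d]/`|d%:Z|%N dE abszM dvdn_mull.
Qed.

Lemma eval_S_rational V (w : V -> CQS S) t :
  (forall v, S_rational S (w v).2) -> S_rational S (eval w t).2.
Proof.
move=> wS; elim: t => [v||t IH|t1 IH1 t2 IH2|p a IH].
- exact: wS.
- exact: (S_rational_int 0).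
- exact: IH.
- rewrite [eval w _]/(chang_plus (eval w t1) (eval w t2)).
  move: IH1 IH2; case: (eval w t1) => [[] g]; case: (eval w t2) => [[] h] /= hg hh.
  + exact: (S_rational_int 0).
  + exact: S_rational_cB.
  + exact: S_rational_cB.
  + exact: S_rationalD.
- by apply: S_rational_div; [exact: svalP|exact: IH].
Qed.

End SRational.

Lemma LPS_nonboolean (S : set prime_number) : ~ LPS S set0 (mvt em_formula).
Proof.
move=> /LPS_sound /sem_thm h; have := h (fun=> (false, 1)).
rewrite eval_mv_incl => h'.
have /(eval_EM (w := fun=> (false, 1))) :
    @eval _ CQ _ (fun=> (false, 1)) em_formula = CQ_one.
  by apply: h' => i; exact: ler01.
by move=> h2; have : (1 : rat) = 0 by apply: h2 => i; exact: ler01.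
Qed.

Lemma LPS_morphic_sub (S S' : set prime_number) :
  morphic (LPS S) (LPS S') -> S `<=` S'.
Proof.
move=> [T hT] p pS; pose p' : {p | S p} := exist _ p pS.
have := (LPS_spec S).2.2 p' => /hT.
rewrite image_set0 axDE.
rewrite translate_Dterm => /LPS_sound /sem_thm h.
have wD : forall i : nat, CQ_dom (false, 1) by move=> _; exact: ler01.
(* At the infinitesimal 1 the translation of d_p takes the value 1 / p, while terms of [LPS S'] take
   values in the subring generated by the inverses of the primes in S'. *)
have := h (fun=> (false, 1)) wD.
move=> /(eval_Dterm (@divI_dom S')) => /(_ (prime_number_gt1 p) wD) e.
apply: S_rational_inv; have := @eval_S_rational S' _ (fun=> (false, 1)) 
  (translate T (div_op p' (Var 0%N))) (fun=> S_rational_int S' 1).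
by rewrite e.
Qed.

(** The divisions are read as the identity, which satisfies D_p on Boolean elements because their
    infinitesimal part is 0. *)
Lemma LPS_classical (S : set prime_number) : morphic (LPS S) classical.
Proof.
exists (fun=> Var ord0); apply: (@least_logic_min _ _ (pullback _ classical)).
  exact: pullback_logic classical_logic.
split=> [G phi|p].
  move=> /classical_LP; rewrite /pullback image_comp translate_mv_incl.
  by congr (classical (_ @` _) _); apply/funext => psi /=; rewrite translate_mv_incl.
rewrite /pullback axDE.
rewrite translate_Dterm => v _; rewrite bevalE.
pose w i : CQ := (v i, 0); have wD i : CQ_dom (w i) by exact: lexx.
have p1 := prime_number_gt1 (sval p).
pose D : formula mv := Dterm (sval (sval p)) (Var 0%N) (Var 0%N).
have D1 : @eval _ CQ _ w D = CQ_one.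
  by apply/(eval_Dterm CQ_no_symb _ _ p1 wD); rewrite /= /w mul0r.
have : @eval _ bool_alg _ v D = true.
  exact: (congr1 fst (etrans (esym (eval_CQ_bool v D)) D1)).
by [].
Qed.

Lemma morphic_inconsistent E (L : conseq E) : morphic L inconsistent.
Proof. by exists (fun=> Zero). Qed.

Lemma morphic_refl E (L : conseq E) : morphic L L.
Proof.
exists (fun f => App f Var) => G phi; rewrite translate_id.
by rewrite (_ : translate _ @` G = G) // (funext (@translate_id E nat)) image_id.
Qed.

Lemma morphic_thm E1 E2 (L1 : conseq E1) (L2 : conseq E2) (t : formula mv) :
  morphic L1 L2 -> L1 set0 (mvt t) -> L2 set0 (mvt t).
Proof. by move=> [T hT] /hT; rewrite image_set0 translate_mv_incl. Qed.

Lemma prime_enumeration : exists (e : nat -> prime_number) (r : prime_number -> nat),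
  cancel e r /\ cancel r e.
Proof.
have : ([set: prime_number] #= [set: nat])%card.
  rewrite card_eq_le; apply/andP; split; first exact: countableP.
  apply/infiniteP => fin.
  have /finite_seqP[s sE] := finite_image (@sval _ _ : prime_number -> nat) fin.
  have [p sp pp] := prime_above (\max_(i <- s) i).
  have : (@sval _ _ @` [set: prime_number]) p by exists (exist _ p pp).
  rewrite sE /= => ps; have := @leq_bigmax_seq _ s xpredT id p ps isT.
  by rewrite leqNgt sp.
move=> /card_set_bijP[r [_ inj surj]].
have /choice[e er] n : exists p, r p = n by have [p _ <-] := surj n I; exists p.
by exists e, r; split=> [|p] //; apply: inj; rewrite ?inE.
Qed.

Section Rank.
Variables (e : nat -> prime_number) (r : prime_number -> nat).
Hypotheses (eK : cancel e r) (rK : cancel r e).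

Definition rank (k : listed) : ordsum (set nat) bool :=
  match k with
  | Perfect P => inl (e @^-1` P)
  | Classical => inr false
  | Inconsistent => inr true
  end.

Lemma rank_inj : injective rank.
Proof.
move=> [||P] [||Q] //= [PQ]; congr Perfect; apply/funext => p.
by rewrite -(rK p) -[P _]/((e @^-1` P) (r p)) PQ.
Qed.

Lemma rank_surj u : exists k, rank k = u.
Proof.
case: u => [A|[]]; [|by exists Inconsistent|by exists Classical].
exists (Perfect (r @^-1` A)); congr inl; apply/funext => n.
by rewrite /preimage /= eK.
Qed.

(** Theorems in the common language rule out downward morphisms: 0 for the inconsistent logic,
    excluded middle for the classical one. Between two sets of primes, morphisms correspond to
    inclusions. *)
Lemma rank_le k1 k2 :
  morphic (listed_logic k1) (listed_logic k2) <-> (rank k1 <= rank k2)%O.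
Proof.
have noZero k : k <> Inconsistent -> ~ listed_logic k set0 (mvt Zero).
  case: k => [/(_ erefl) //|_ /(_ (fun=> true)) h|P _ h].
    by have : false by exact: h.
  apply: (@LPS_nonboolean P).
  by apply: (inconsistent_all (LPS_logic P) (@LPS_LP P)).
have em : classical set0 em_formula by move=> v _ /=; case: (v 0%N).
case: k1 k2 => [||P] [||Q]; rewrite /Order.le //=; split=> // h.
- exact: morphic_refl.
- by case: (noZero Classical) => //; exact: morphic_thm h _.
- by case: (noZero (Perfect Q)) => //; exact: morphic_thm h _.
- exact: morphic_inconsistent.
- exact: morphic_refl.
- move: em; rewrite -(mv_incl_mv em_formula) => /(morphic_thm h).
  by move=> /LPS_nonboolean.
- exact: morphic_inconsistent.
- exact: LPS_classical.
- by apply/asboolP => n; exact: LPS_morphic_sub h _.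
- have PQ : P `<=` Q.
    by move=> p; rewrite -(rK p); move/asboolP: h; apply.
  by exists (sigS_incl PQ); case: (LPS_conservative PQ).
Qed.

Lemma listed_anti k1 k2 : morphic (listed_logic k1) (listed_logic k2) ->
  morphic (listed_logic k2) (listed_logic k1) -> k1 = k2.
Proof.
by move=> /rank_le k12 /rank_le k21; apply/rank_inj/le_anti; rewrite k12.
Qed.

End Rank.

(** * Every listed logic comes from an algebraic expansion *)

Section Realization.

Lemma division_finite p :
  finite_set [set (Dterm p (Var (inr ord0)) (Var (inl ord0)) : term mv ('I_1 + 'I_1))].
Proof. exact: finite_set1. Qed.

Definition division (p : prime_number) : fset_formulas :=
  FsetFormulas (division_finite (sval p)).

Lemma division_unique_rule (p : prime_number) E (L : conseq E) : is_logic L ->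
  morphism (mv_incl E) LP L -> unique_rule (division p) L.
Proof.
move=> hL LPL a y z j D hy hz; rewrite [j]ord1.
pose V i : formula mv := Var i.
pose G := [:: Dterm (sval p) (V 1%N) (V 0%N); Dterm (sval p) (V 2%N) (V 0%N)].
pose s i := match i with 0 => a ord0 | 1 => y ord0 | _ => z ord0 end.
apply: (@CQ_rule _ _ hL LPL G (V 1%N <==> V 2%N)%MV s) => [w wD h|psi].
  apply/(@eval_Iff mv _ CQ_no_symb _ w) => //.
  have Dw i : List.In (Dterm (sval p) (V i) (V 0%N)) G ->
      eval w (V i) = ((w 0%N).1, (w 0%N).2 / (sval p)%:R).
    by move=> /h /(eval_Dterm CQ_no_symb _ _ (prime_number_gt1 p) wD).
  by rewrite !Dw //; [right; left|left].
have inst_D w : inst a w (Dterm (sval p) (w ord0) (a ord0)).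
  by eexists; [reflexivity|rewrite translate_Dterm subst_Dterm].
move=> [<-|[<-|[]]]; rewrite translate_Dterm subst_Dterm /=.
  by apply: hy; exact: inst_D.
by apply: hz; exact: inst_D.
Qed.

(** D_p determines the p-th part uniquely in every logic above LP, so taking it as Phi adds exactly
    the connective d_p with its axiom. *)
Lemma division_realization (P : set prime_number) :
  morphic (expansion LP (division @` P)) (LPS P) /\
  morphic (LPS P) (expansion LP (division @` P)).
Proof.
split.
- have existence (Phi : {Phi | (division @` P) Phi}) :
      exists t : 'I_(nz (sval Phi)) -> term (sigS P) 'I_(nx (sval Phi)),
      forall psi, inst (fun i => Var (nat_of_ord i))
        (fun j => subst (fun i => Var (nat_of_ord i)) (t j)) psi ->
      LPS P set0 psi.
    case: Phi => Phi [p Pp /= e]; case: Phi / e.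
    exists (fun=> @App (sigS P) _ (exist _ p Pp) Var) => _ [_ -> <-].
    rewrite translate_Dterm subst_Dterm /=.
    rewrite (_ : (fun i : 'I_1 => _) = fun=> Var 0%N); last first.
      by apply/funext => i; rewrite ord1.
    exact: (LPS_spec P).2.2 (exist _ p Pp).
  exists (fun f => sval (cid (existence (projT1 f))) (projT2 f)).
  apply: expansion_morphism => [||Phi psi|[Phi [p Pp e]]].
  + exact: LPS_logic.
  + exact: LPS_LP.
  + exact: (svalP (cid (existence Phi))).
  + rewrite /= -e; apply: division_unique_rule; [exact: LPS_logic|exact: LPS_LP].
- have EXL := expansion_logic (division @` P).
  pose Phi (p : {p | P p}) : {Phi | (division @` P) Phi} :=
    exist _ (division (sval p)) (imageP division (svalP p)).
  pose T : translation (sigS P) (sig_of (division @` P)) :=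
    fun p => @App (sig_of (division @` P)) _ (existT _ (Phi p) ord0) Var.
  exists T.
  apply: (@least_logic_min _ _ (pullback T (expansion LP (division @` P)))).
    exact: pullback_logic.
  split=> [G phi|p].
    move=> /expansion_LP; rewrite /pullback image_comp translate_mv_incl.
    rewrite (_ : translate T \o _ = translate (mv_incl (sig_of (division @` P)))) //.
    by apply/funext => psi /=; rewrite translate_mv_incl.
  rewrite /pullback image_set0.
  apply: (@expansion_exist _ (Phi p) (fun=> Var 0%N)).
  eexists; [reflexivity|].
  rewrite axDE.
  by rewrite !translate_Dterm subst_Dterm.
Qed.

Lemma em_finite :
  finite_set [set (Var (inl ord0) || ~~ Var (inl ord0))%MV : term mv ('I_1 + 'I_0)].
Proof. exact: finite_set1. Qed.

(** A set Phi without unknowns adds no connective, only axioms. *)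
Lemma classical_realization : let Sigma := [set FsetFormulas em_finite] in
  morphic (expansion LP Sigma) classical /\ morphic classical (expansion LP Sigma).
Proof.
move=> Sigma; have EXL := expansion_logic Sigma.
split.
- exists (fun=> Zero); apply: expansion_morphism => //.
  + exact: classical_logic.
  + exact: classical_LP.
  + move=> [Phi e] /=; rewrite {}e => _ [_ -> <-] v _ /=.
    by case: (v _).
  + by move=> [Phi e] /=; rewrite {}e => a y z [].
- exists (mv_incl _); apply: boolean_classical => //; first exact: expansion_LP.
  pose Phi : {Phi | Sigma Phi} := exist _ (FsetFormulas em_finite) erefl.
  apply: (@expansion_exist _ Phi (fun=> Var 0%N)).
  by eexists; [reflexivity|].
Qed.

Lemma zero_finite : finite_set [set (Zero : term mv ('I_0 + 'I_0))].
Proof. exact: finite_set1. Qed.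

Lemma inconsistent_realization : let Sigma := [set FsetFormulas zero_finite] in
  morphic (expansion LP Sigma) inconsistent /\
  morphic inconsistent (expansion LP Sigma).
Proof.
move=> Sigma; split; first exact: morphic_inconsistent.
exists (mv_incl _) => G phi _.
apply: inconsistent_all; [exact: expansion_logic|exact: expansion_LP|].
pose Phi : {Phi | Sigma Phi} := exist _ (FsetFormulas zero_finite) erefl.
apply: (@expansion_exist _ Phi (fun=> Var 0%N)).
by eexists; [reflexivity|].
Qed.

(** Morphisms in both directions suffice: the classification provides an equipollent listed logic,
    and [listed_anti] identifies it with k. *)
Lemma realization k : exists Sigma,
  morphic (expansion LP Sigma) (listed_logic k) /\
  morphic (listed_logic k) (expansion LP Sigma).
Proof.
case: k => [||P].
- by exists [set FsetFormulas zero_finite]; exact: inconsistent_realization.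
- by exists [set FsetFormulas em_finite]; exact: classical_realization.
- by exists (division @` P); exact: division_realization.
Qed.

End Realization.

Theorem theorem5p16 :
  (forall Sigma : set fset_formulas,
     exists! k : listed, equipollent (expansion LP Sigma) (listed_logic k)) /\
  (exists F : set fset_formulas -> ordsum (set nat) bool,
     [/\ (forall u, exists Sigma, F Sigma = u),
         (forall Sigma1 Sigma2,
            equipollent (expansion LP Sigma1) (expansion LP Sigma2) <->
            F Sigma1 = F Sigma2) &
         (forall Sigma1 Sigma2,
            morphic (expansion LP Sigma1) (expansion LP Sigma2) <->
            (F Sigma1 <= F Sigma2)%O)])
  /\
  (forall (S S' : set prime_number) (SS' : S `<=` S'),
     conservative (sigS_incl SS') (LPS S) (LPS S')).
Proof.
have [e [r [eK rK]]] := prime_enumeration.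
have anti := listed_anti rK; have /choice[kof kofP] := expansion_classification.
have to_kof Sigma := (equipollent_morphic (kofP Sigma)).1.
have of_kof Sigma := (equipollent_morphic (kofP Sigma)).2.
have kof_unique Sigma k : morphic (expansion LP Sigma) (listed_logic k) ->
    morphic (listed_logic k) (expansion LP Sigma) -> kof Sigma = k.
  move=> EXk kEX; apply: anti; first exact: morphic_trans (of_kof _) EXk.
  exact: morphic_trans kEX (to_kof _).
have EXL := expansion_logic.
split; [|split; last exact: LPS_conservative].
  move=> Sigma; exists (kof Sigma); split=> // k /equipollent_morphic[].
  exact: kof_unique.
exists (fun Sigma => rank e (kof Sigma)); split=> [u|Sigma1 Sigma2|Sigma1 Sigma2].
- have [k <-] := rank_surj eK u; have [Sigma [EXk kEX]] := realization k.
  by exists Sigma; rewrite (kof_unique _ _ EXk kEX).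
- split=> [h|/(rank_inj rK) e12].
    have [h12 h21] := equipollent_morphic h.
    congr rank; apply: kof_unique; first exact: morphic_trans h12 (to_kof _).
    exact: morphic_trans (of_kof _) h21.
  (* Equal ranks give the same index, and both expansions are equipollent to the logic listed
     there. *)
  apply: equipollent_trans (kofP Sigma1) _ => //; rewrite e12.
  exact/equipollent_sym/kofP.
- rewrite -(rank_le rK); split=> h.
    exact: morphic_trans (of_kof _) (morphic_trans h (to_kof _)).
  exact: morphic_trans (to_kof _) (morphic_trans h (of_kof _)).
Qed.
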